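(* Let $m = m_n$ be positive integers with $m^2 \to \infty$ and $m^2/n \to 0$ as $n \to \infty$, and let $A_1,\ldots,A_n$ be independent $m \times m$ GOE matrices. Let $\xi = \xi_m$ be the sequence tending to $1$ as $m\to\infty$ described in the context. Then for any constants $\beta < 1 < \gamma$, \[ \lim_{n \to \infty} \mathbb{P}\left(\beta\frac{2}{e^{3/4}}\sqrt{nm}\,4^{-\xi n/m^2} \leq \mathrm{disc}(A_1,\ldots,A_n) \leq \gamma\frac{2}{e^{3/4}}\sqrt{nm}\,4^{-\xi n/m^2}\right) = 1. \]
   Context: An $m\times m$ GOE matrix is a random symmetric matrix whose entries on and above the diagonal are independent centered normal variables, with variance $2$ on the diagonal and variance $1$ off the diagonal. For symmetric matrices $A_1,\ldots,A_n$, $\mathrm{disc}(A_1,\ldots,A_n) = \min_{x \in \{\pm1\}^n} \|\sum_{i=1}^n x_iA_i\|$, where $\|\cdot\|$ is the spectral norm. The sequence $\xi=\xi_m$ is defined through the small-ball probability of a single $m\times m$ GOE matrix $X$: it tends to $1$ as $m\to\infty$ and satisfies $\mathbb{P}(\|X\| \leq \delta) = \left(\frac{e^{3/4}}{2\sqrt{m}}\delta\right)^{\xi^{-1}m^2/2}$ (for the values $\delta = o(\sqrt m)$ under consideration). *)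

(* Defs.v *)
From HB Require Import structures.
From mathcomp Require Import all_boot all_order all_algebra.
From mathcomp Require Import all_classical all_reals all_analysis.
From mathcomp Require Import normal_distribution.

Set Implicit Arguments.
Unset Strict Implicit.
Unset Printing Implicit Defensive.

Import Order.TTheory GRing.Theory Num.Theory.
Local Open Scope classical_set_scope.
Local Open Scope ring_scope.

Section defs.
Variable R : realType.

Definition vnorm m (v : 'cV[R]_m) : R := Num.sqrt (\sum_(j < m) v j 0 ^+ 2).

Definition opnorm m (M : 'M[R]_m) : R :=
  sup [set vnorm (M *m v) | v in [set v : 'cV[R]_m | vnorm v = 1]].

Definition sgnb (b : bool) : R := if b then 1 else -1.

Definition disc n m (A : 'I_n -> 'M[R]_m) : R :=
  inf [set opnorm (\sum_(i < n) sgnb (x i) *: A i) | x in [set: {ffun 'I_n -> bool}]].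

(* mutual independence of a finite family of real random variables:
   product rule for all families of Borel sets (taking B i = setT gives
   the product rule for every subfamily) *)
Definition mutually_independent d (T : measurableType d) (P : probability T R)
    (I : finType) (X : I -> T -> R) : Prop :=
  (forall i, measurable_fun setT (X i)) /\
  forall B : I -> set R, (forall i, measurable (B i)) ->
    P (\bigcap_(i in [set: I]) (X i @^-1` B i)) = (\prod_(i : I) P (X i @^-1` B i))%E.

Definition upper_idx n m := {x : 'I_n * 'I_m * 'I_m | (x.1.2 <= x.2)%N}.

Definition rmatrix d (T : measurableType d) n m (Y : 'I_n -> 'I_m -> 'I_m -> T -> R)
    (i : 'I_n) (t : T) : 'M[R]_m := \matrix_(j, k) Y i j k t.

Definition indep_GOE d (T : measurableType d) (P : probability T R) n m
    (Y : 'I_n -> 'I_m -> 'I_m -> T -> R) : Prop :=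
  [/\ (forall i j k, Y i j k = Y i k j),
      (forall i j k (B : set R), measurable B ->
         P (Y i j k @^-1` B) = normal_prob 0 (if j == k then Num.sqrt 2 else 1) B)
    & mutually_independent P
        (fun x : upper_idx n m => Y (val x).1.1 (val x).1.2 (val x).2)].

End defs.

(* Main.v *)
Require Import Defs.
From HB Require Import structures.
From mathcomp Require Import all_boot all_order all_algebra.
From mathcomp Require Import all_classical all_reals all_analysis.
From mathcomp Require Import normal_distribution measurable_realfun.
From mathcomp Require Import zify ring lra.
Import Order.TTheory GRing.Theory Num.Theory.
Import numFieldNormedType.Exports.
Local Open Scope classical_set_scope.
Local Open Scope ring_scope.

Set Implicit Arguments.
Unset Strict Implicit.
Unset Printing Implicit Defensive.

(* Let [p r] be the probability that a GOE matrix has norm at most [r], let [N = m (m + 1) / 2]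
   be its number of independent entries, and let [delta] be the radius with [p delta = 2^-n]; the
   window in the theorem is around [sqrt n * delta]. A signed sum of the matrices, divided by
   [sqrt n], is again GOE, so the expected number of signings of norm at most [sqrt n * r] is
   [2^n * p r]. Gaussian scaling gives [p (s r) <= s^N p r] for [s >= 1], with an almost matching
   lower bound when [r] is small compared with [sqrt m], which holds at [delta] because [N = o(n)].
   Hence the expectation is exponentially small in [N] at [r = beta delta], which settles the lower
   bound on the discrepancy, and exponentially large at [r = gamma delta].

   For the upper bound one uses second moments. The normalized sums of two signings with
   correlation [rho] are [X] and [rho X + tau W] with [X, W] independent and [tau^2 = 1 - rho^2].
   Since the norm ball is symmetric and convex, Anderson's inequality, a consequence of
   Prekopa-Leindler, lets one drop the shift [rho X], so both sums are small with probability at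
   most [tau^-N (p r)^2]. Averaged over pairs of signings, [tau^-N], which is about
   [exp (N rho^2 / 2)], tends to [1] because [rho^2] is of order [1 / n] and [N = o(n)]; the few
   strongly correlated pairs are counted by a Chernoff bound and covered by the trivial bound
   [p r]. *)

(** * Lebesgue and Gaussian integrals on the line *)

(** The hypothesis on $\xi$ speaks of one radius: at $\delta = 2e^{-3/4}\sqrt m\,4^{-\xi n/m^2}$ the
    base of the small-ball formula is $4^{-\xi n/m^2}$, and the exponent $\xi^{-1}m^2/2$ turns it
    into $4^{-n/2} = 2^{-n}$. Everything else about $p$ comes from scaling. The upper scaling bound
    is free, but the lower one loses $\exp(-(s^2-1)mr^2/4)$, which could cancel the gain $s^N$
    unless $r^2$ is small against $m$. Smallness of $\delta/\sqrt m$ is therefore derived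
    separately, by comparison with a ball of radius $32\sqrt m$, whose probability is at least $1/2$
    by a lattice net. In the second moment a constant factor would be fatal: the average of
    $\tau^{-N}$ must be $1 + o(1)$. This is why the shift is removed by Anderson's inequality, which
    costs nothing, and why the average is controlled by $w = n/N \to \infty$ through convexity of
    the exponential. That $N \to \infty$ makes the first-moment errors vanish. *)

Definition push_measure d1 d2 (T1 : measurableType d1) (T2 : measurableType d2)
    (R : realFieldType) (m : {measure set T1 -> \bar R}) (f : T1 -> T2)
    (mf : measurable_fun setT f) : {measure set T2 -> \bar R} :=
  measure_function_pushforward__canonical__measure_function_Measure m mf.

Definition push_prob d1 d2 (T1 : measurableType d1) (T2 : measurableType d2)
    (R : realType) (P : probability T1 R) (f : T1 -> T2)
    (mf : measurable_fun setT f) : probability T2 R :=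
  distribution P (HB.pack f (isMeasurableFun.Build _ _ _ _ f mf)
                  : {mfun T1 >-> T2}).

Section lebesgue_affine.
Context {R : realType}.
Local Notation mu := (@lebesgue_measure R).

(** By uniqueness of Lebesgue measure only the intervals []c, d]] have to be compared; a negative
    slope turns them into intervals open on the right, of the same length. *)
Lemma lebesgue_measure_affine (a b : R) (A : set R) : a != 0 -> measurable A ->
  (mu A = `|a|%:E * mu ((fun x => a * x + b)%R @^-1` A))%E.
Proof.
move=> a0 mA.
have mphi : @measurable_fun _ _ (measurableTypeR R) (measurableTypeR R) setT
    (fun x : R => a * x + b).
  by apply: measurable_funD => //; apply: measurable_funM.
have := @lebesgue_measure_unique R
  (mscale (NngNum (normr_ge0 a)) (push_measure mu mphi)) _ A mA.
apply => X [[c d] _ <-] /=; rewrite /mscale/= /pushforward.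
have [ap|an] := ltP 0 a.
- have -> : (fun x => a * x + b) @^-1` `]c, d] =
            `](c - b) / a, (d - b) / a]%classic.
    apply/seteqP; split => x /=; rewrite !in_itv/= => /andP[H1 H2].
      by rewrite ltr_pdivrMr// ler_pdivlMr//; apply/andP; split; lra.
    move: H1 H2; rewrite ltr_pdivrMr// ler_pdivlMr// => H1 H2.
    by apply/andP; split; lra.
  rewrite !lebesgue_measure_itv /= !lte_fin ltr_pM2r ?invr_gt0// ltrD2r.
  case: ifPn => _; last by rewrite mule0.
  by rewrite -!EFinD -EFinM gtr0_norm//; congr _%:E; field.
have {}an : a < 0 by rewrite lt_neqAle a0.
have -> : (fun x => a * x + b) @^-1` `]c, d] =
            `[(d - b) / a, (c - b) / a[%classic.
  apply/seteqP; split => x /=; rewrite !in_itv/= => /andP[H1 H2].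
    by rewrite ltr_ndivlMr// ler_ndivrMr//; apply/andP; split; lra.
  move: H1 H2; rewrite ltr_ndivlMr// ler_ndivrMr// => H1 H2.
  by apply/andP; split; lra.
rewrite !lebesgue_measure_itv /= !lte_fin ltr_nM2r ?invr_lt0// ltrD2r.
case: ifPn => _; last by rewrite mule0.
by rewrite -!EFinD -EFinM ltr0_norm//; congr _%:E; field.
Qed.

Lemma ge0_integral_affine (a b : R) (f : R -> \bar R) : a != 0 ->
  measurable_fun setT f -> (forall x, 0 <= f x)%E ->
  (\int[mu]_x f x = `|a|%:E * \int[mu]_x f (a * x + b)%R)%E.
Proof.
move=> a0 mf f0.
have mphi : @measurable_fun _ _ (measurableTypeR R) (measurableTypeR R) setT
    (fun x : R => a * x + b).
  by apply: measurable_funD => //; apply: measurable_funM.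
rewrite (@eq_measure_integral _ _ _ _
  (mscale (NngNum (normr_ge0 a)) (push_measure mu mphi))) //.
  by rewrite ge0_integral_mscale//= ge0_integral_pushforward.
by move=> A mA _; exact: lebesgue_measure_affine.
Qed.

End lebesgue_affine.

Section density.
Local Open Scope ereal_scope.
Context d (T : measurableType d) (R : realType).
Variables (mu nu : {measure set T -> \bar R}) (g : T -> R).
Hypothesis mg : measurable_fun setT g.
Hypothesis g0 : forall x, (0 <= g x)%R.
Hypothesis nuE : forall A, measurable A -> nu A = \int[mu]_(x in A) (g x)%:E.

Import HBNNSimple.

(** Monotone approximation by simple functions reduces the claim to indicators, where it is
    [nuE]. *)
Lemma ge0_integral_density (f : T -> \bar R) : measurable_fun setT f ->
  (forall x, 0 <= f x) -> \int[nu]_x f x = \int[mu]_x (f x * (g x)%:E).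
Proof.
move=> mf f0; pose h := nnsfun_approx measurableT mf.
have mgE : measurable_fun setT (EFin \o g) by exact/measurable_EFinP.
have mh n : measurable_fun setT (EFin \o h n).
  by apply/measurable_EFinP; exact/measurable_funP.
have fE x : f x = lim ((EFin \o h n) x @[n --> \oo]).
  by apply/esym/cvg_lim => //; exact: cvg_nnsfun_approx.
under eq_integral do rewrite fE.
rewrite monotone_convergence//; last 2 first.
- by move=> n x _ /=; rewrite lee_fin.
- by move=> x _ a b ab; rewrite lee_fin; exact/lefP/nd_nnsfun_approx.
have fgE x : f x * (g x)%:E = lim (((EFin \o h n) x * (g x)%:E) @[n --> \oo]).
  by apply/esym/cvg_lim => //; apply: cvgeZr => //; exact: cvg_nnsfun_approx.
under [RHS]eq_integral do rewrite fgE.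
rewrite monotone_convergence//; last 3 first.
- by move=> n; apply: emeasurable_funM.
- by move=> n x _ /=; rewrite mule_ge0 ?lee_fin.
- move=> x _ a b ab /=; rewrite lee_wpmul2r ?lee_fin//.
  exact/lefP/nd_nnsfun_approx.
apply: congr_lim; apply/funext => n.
under eq_integral do rewrite /= fimfunE -fsumEFin//.
have indich r : measurable_fun setT (fun x => (r * \1_(h n @^-1` [set r]) x)%:E).
  by apply/measurable_EFinP; apply: measurable_funM.
rewrite ge0_integral_fsum//; last first.
  by move=> y x _; exact: nnfun_muleindic_ge0.
transitivity (\int[mu]_x (\sum_(y \in range (h n))
    (y * \1_(h n @^-1` [set y]) x)%:E * (g x)%:E)); last first.
  apply: eq_integral => x _.
  rewrite -ge0_mule_fsuml => [|y]; last exact: nnfun_muleindic_ge0.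
  by rewrite fsumEFin//= -(fimfunE _ x).
rewrite ge0_integral_fsum//; last 2 first.
- by move=> y; apply: emeasurable_funM.
- move=> y x _; apply: mule_ge0; last by rewrite lee_fin.
  exact: nnfun_muleindic_ge0.
apply: eq_fsbigr => r _.
rewrite integralZl_indic_nnsfun// integral_indic// setIT nuE//.
have [r0|r0] := ltP r 0%R.
  rewrite preimage_nnfun0// integral_set0 mule0 integral0_eq// => x _.
  by rewrite indicE in_set0 mulr0 mul0e.
under [RHS]eq_integral do rewrite EFinM -muleA.
have mA : measurable (h n @^-1` [set r]) by exact: measurable_sfunP.
rewrite ge0_integralZl_EFin//; last 2 first.
- by move=> x _; rewrite mule_ge0 ?lee_fin.
- by apply: emeasurable_funM => //; exact/measurable_EFinP.
rewrite integral_mkcond; congr (_ * _); apply: eq_integral => x _.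
by rewrite /patch indicE; case: ifPn; rewrite ?mul1e ?mul0e.
Qed.

End density.

Section std_normal.
Context {R : realType}.
Local Notation mu := (@lebesgue_measure R).

(* [R] and [measurableTypeR R] carry the same sigma-algebra with different
   displays; pushing forward along the identity moves between the two. *)
Let measurable_idR : @measurable_fun _ _ (measurableTypeR R) R setT idfun.
Proof. by move=> _ A mA; rewrite setTI. Qed.

Definition stdn : probability R R := push_prob (normal_prob 0 1) measurable_idR.

Definition phi (x : R) : R := normal_peak 1 * expR (- (x ^+ 2 / 2)).

Lemma phiE : phi = normal_pdf 0 1.
Proof.
apply/funext => x; rewrite normal_pdfE ?oner_neq0//; congr (_ * expR _).
by rewrite subr0 expr1n mulNr.
Qed.

Lemma phi_gt0 x : 0 < phi x.
Proof. by rewrite mulr_gt0 ?expR_gt0// normal_peak_gt0// oner_neq0. Qed.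

Lemma phi_ge0 x : 0 <= phi x. Proof. exact/ltW/phi_gt0. Qed.

Lemma measurable_phi : measurable_fun setT phi.
Proof. by rewrite phiE; exact: measurable_normal_pdf. Qed.

Lemma stdnE A : stdn A = (\int[mu]_(x in A) (phi x)%:E)%E.
Proof. by rewrite phiE. Qed.

Lemma integral_stdn (f : R -> \bar R) : measurable_fun setT f ->
  (forall x, 0 <= f x)%E ->
  (\int[stdn]_x f x = \int[mu]_x (f x * (phi x)%:E))%E.
Proof.
move=> mf f0; rewrite ge0_integral_pushforward//=.
rewrite (@ge0_integral_density _ _ _ mu (normal_prob 0 1) phi)//.
- exact: measurable_phi.
- exact: phi_ge0.
- by move=> A _; rewrite phiE.
Qed.

End std_normal.

Section std_normal_changes.
Context {R : realType}.
Local Notation mu := (@lebesgue_measure R).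
Local Notation MR := (measurableTypeR R).

(** The substitution moves the scaling from [F] to the density, and the exponential is the ratio
    $\varphi(x/s)/\varphi(x)$. Keeping [stdn] as the reference measure lets the formula be iterated
    over coordinates. *)
Lemma integral_stdn_scale (s : R) (F : R -> \bar R) : s != 0 ->
  measurable_fun setT F -> (forall x, 0 <= F x)%E ->
  (\int[stdn]_x F (s * x)%R =
   `|s|^-1%:E * \int[stdn]_x (F x * (expR (- ((s ^- 2 - 1) * x ^+ 2 / 2)))%:E))%E.
Proof.
move=> s0 mF F0.
have ms : measurable_fun setT (fun x : R => s * x) by exact: measurable_funM.
rewrite integral_stdn//; last exact: (measurableT_comp mF ms).
rewrite integral_stdn//; last 2 first.
- apply: emeasurable_funM => //; apply/measurable_EFinP.
  apply: measurableT_comp => //; apply: measurableT_comp => //.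
  do 2 apply: measurable_funM => //.
- by move=> x; rewrite mule_ge0// lee_fin expR_ge0.
pose g x := (F x * (phi (x / s))%:E)%E.
have mg : measurable_fun setT g.
  apply: emeasurable_funM => //; apply/measurable_EFinP.
  by apply: measurableT_comp; [exact: measurable_phi|exact: measurable_funM].
have g0 x : (0 <= g x)%E by rewrite mule_ge0// lee_fin phi_ge0.
transitivity (\int[mu]_x g (s * x + 0)%R)%E.
  by apply: eq_integral => x _; rewrite /g addr0 mulrAC divff// mul1r.
transitivity (`|s|^-1%:E * \int[mu]_x g x)%E.
  rewrite [in RHS](@ge0_integral_affine _ s 0 g)// muleA -EFinM.
  by rewrite mulVf ?normr_eq0// mul1e.
congr (_ * _)%E; apply: eq_integral => x _; rewrite -muleA -EFinM.
congr (_ * _%:E)%E; rewrite /phi mulrCA -expRD; congr (_ * expR _).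
by rewrite expr_div_n; field.
Qed.

(** Two one-variable substitutions: $x = cu + sv$ at fixed $v$, with Jacobian $|c|$, then $y =
    (s/c)x - v/c$ at fixed $x$, with Jacobian $1/|c|$. *)
Lemma ge0_integral_lebesgue_reflection (c s : R) (H : MR * MR -> \bar R) :
  c != 0 -> c ^+ 2 + s ^+ 2 = 1 -> measurable_fun setT H ->
  (forall x, 0 <= H x)%E ->
  (\int[mu]_u \int[mu]_v H (c * u + s * v, s * u - c * v)%R =
   \int[mu]_u \int[mu]_v H (u, v))%E.
Proof.
move=> c0 cs mH H0.
have mHl (x : R) : measurable_fun setT (fun y : MR => H (x, y)).
  exact/(measurableT_comp mH)/pair1_measurable.
have mlin (k l : R) : measurable_fun setT (fun z : MR * MR => k * z.1 + l * z.2).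
  by apply: measurable_funD; apply: measurable_funM.
have mlinB (k l : R) : measurable_fun setT (fun z : MR * MR => k * z.1 - l * z.2).
  by apply: measurable_funB; apply: measurable_funM.
pose H1 := fun z : MR * MR => H (c * z.1 + s * z.2, s * z.1 - c * z.2).
have mH1 : measurable_fun setT H1.
  apply: (measurableT_comp mH); apply: measurable_fun_pair; first exact: mlin.
  exact: mlinB.
pose H2 := fun z : MR * MR => H (z.1, (s / c) * z.1 + (- c^-1) * z.2).
have mH2 : measurable_fun setT H2.
  apply: (measurableT_comp mH); apply: measurable_fun_pair => //; exact: mlin.
have mH2r (y : R) : measurable_fun setT (fun x : MR => H2 (x, y)).
  exact/(measurableT_comp mH2)/(pair2_measurable (y : MR)).
have mH2l (x : R) : measurable_fun setT (fun y : MR => H2 (x, y)).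
  exact/(measurableT_comp mH2)/(pair1_measurable (x : MR)).
have H10 z : (0 <= H1 z)%E by exact: H0.
have H20 z : (0 <= H2 z)%E by exact: H0.
rewrite (fubini_tonelli H1)//.
transitivity (\int[mu]_y \int[mu]_x (`|c|^-1%:E * H2 (x, y)))%E.
  apply: eq_integral => v _.
  rewrite ge0_integralZl_EFin//.
  rewrite (@ge0_integral_affine _ c (s * v) (fun x => H2 (x, v)))//; last first.
    exact: mH2r.
  rewrite muleA -EFinM mulVf ?normr_eq0// mul1e.
  apply: eq_integral => u _; rewrite /H1 /H2/=; congr (H (_, _)).
  have -> : s / c * (c * u + s * v) + - c^-1 * v =
            s * u + (s ^+ 2 - 1) / c * v by field.
  by rewrite -cs opprD addrCA subrr addr0; field.
rewrite -(fubini_tonelli (fun z => `|c|^-1%:E * H2 z)%E)/=; last 2 first.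
- exact: emeasurable_funM.
- by move=> z; rewrite mule_ge0// lee_fin.
apply: eq_integral => x _.
rewrite (@ge0_integral_affine _ (- c^-1) (s / c * x) (fun y => H (x, y)))//.
  rewrite normrN normfV ge0_integralZl_EFin//.
  by congr (_ * _)%E; apply: eq_integral => y _; rewrite /H2 /= addrC.
  by rewrite oppr_eq0 invr_eq0.
exact: mHl.
Qed.

Lemma ge0_integral_stdn2 (F : R * R -> \bar R) : measurable_fun setT F ->
  (forall x, 0 <= F x)%E ->
  (\int[stdn]_u \int[stdn]_v F (u, v) =
   \int[mu]_u \int[mu]_v (F (u, v) * (phi u * phi v)%:E))%E.
Proof.
move=> mF F0.
rewrite integral_stdn; last 2 first.
- exact: (measurable_fun_fubini_tonelli_F F).
- by move=> x; apply: integral_ge0.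
apply: eq_integral => u _.
have mFu : measurable_fun setT (fun v => F (u, v)).
  exact/(measurableT_comp mF)/pair1_measurable.
rewrite integral_stdn// -ge0_integralZr//; last first.
- by rewrite lee_fin phi_ge0.
- by move=> v _; rewrite mule_ge0// lee_fin phi_ge0.
- by apply: emeasurable_funM => //; apply/measurable_EFinP; exact: measurable_phi.
by apply: eq_integral => v _; rewrite -muleA -EFinM [in RHS]mulrC.
Qed.

(** The reflection preserves $u^2 + v^2$, hence the product density, so the Lebesgue case applies to
    [F] times the density. *)
Lemma integral_stdn_reflection (c s : R) (F : R * R -> \bar R) :
  c != 0 -> c ^+ 2 + s ^+ 2 = 1 -> measurable_fun setT F ->
  (forall x, 0 <= F x)%E ->
  (\int[stdn]_u \int[stdn]_v F (c * u + s * v, s * u - c * v)%R =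
   \int[stdn]_u \int[stdn]_v F (u, v))%E.
Proof.
move=> c0 cs mF F0.
have mlin (k l : R) : measurable_fun setT (fun z : R * R => k * z.1 + l * z.2).
  by apply: measurable_funD; apply: measurable_funM.
have mlinB (k l : R) : measurable_fun setT (fun z : R * R => k * z.1 - l * z.2).
  by apply: measurable_funB; apply: measurable_funM.
pose F1 (z : R * R) := F (c * z.1 + s * z.2, s * z.1 - c * z.2).
have mF1 : measurable_fun setT F1.
  apply: (measurableT_comp mF); apply: measurable_fun_pair; first exact: mlin.
  exact: mlinB.
pose G (z : MR * MR) := (F z * (phi z.1 * phi z.2)%:E)%E.
have mG : measurable_fun setT G.
  apply: emeasurable_funM => //; apply/measurable_EFinP.
  by apply: measurable_funM; apply: measurableT_comp => //; exact: measurable_phi.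
have G0 z : (0 <= G z)%E by rewrite mule_ge0// lee_fin mulr_ge0// phi_ge0.
transitivity (\int[mu]_u \int[mu]_v G (c * u + s * v, s * u - c * v)%R)%E.
  transitivity (\int[stdn]_u \int[stdn]_v F1 (u, v))%E; first by [].
  rewrite (ge0_integral_stdn2 mF1 (fun z => F0 _)).
  apply: eq_integral => u _; apply: eq_integral => v _.
  rewrite /F1 /G /=; congr (_ * _%:E)%E.
  rewrite /phi mulrACA [RHS]mulrACA -!expRD; congr (_ * expR _).
  have E : u ^+ 2 + v ^+ 2 = (c * u + s * v) ^+ 2 + (s * u - c * v) ^+ 2.
    by rewrite -[LHS]mul1r -cs; ring.
  by rewrite -!opprD -!mulrDl E.
rewrite (ge0_integral_lebesgue_reflection c0 cs mG G0).
by rewrite (ge0_integral_stdn2 mF F0).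
Qed.

End std_normal_changes.

(** * The Prekopa-Leindler inequality *)

Section prekopa_leindler_line.
Context {R : realType}.
Local Notation mu := (@lebesgue_measure R).
Local Notation MR := (measurableTypeR R).

(** The set $(V + b)/2$ lies to the left of $p = (a+b)/2$ and $(a + W)/2$ to the right; both are in
    $H$, they share at most the point $p$, and they have half the measure of $V$ and $W$. *)
Lemma brunn_minkowski_pivot (V W H : set R) (a b : R) :
  measurable V -> measurable W -> measurable H ->
  V a -> W b -> (forall x, V x -> x <= a) -> (forall y, W y -> b <= y) ->
  (forall x y, V x -> W y -> H ((x + y) / 2)) ->
  (mu V + mu W <= 2%:E * mu H)%E.
Proof.
move=> mV mW mH Va Wb Vub Wlb VWH.
pose p := (a + b) / 2; pose H1 := H `&` `]-oo, p]; pose H2 := H `\` `]-oo, p].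
have mH1 : measurable H1 by exact: measurableI.
have mH2 : measurable H2 by exact: measurableD.
have halves (A : set R) (z : R) : measurable A ->
    mu ((fun x => 2^-1 * x + z) @^-1` A) = (2%:E * mu A)%E.
  move=> mA; rewrite (@lebesgue_measure_affine _ (2^-1) z A)//.
  by rewrite gtr0_norm// muleA -EFinM divff// mul1e.
have mpre (A : set R) (z : R) : measurable A ->
    measurable ((fun x : R => 2^-1 * x + z) @^-1` A).
  move=> mA; rewrite -[X in measurable X]setTI.
  by apply: measurable_funD => //; apply: measurable_funM.
have VH1 : (mu V <= 2%:E * mu H1)%E.
  rewrite -(halves _ (b / 2))//; apply: le_measure; rewrite ?inE//; first exact: mpre.
  move=> x Vx /=; split.
    by have := VWH _ _ Vx Wb; congr H; field.
  by rewrite /= in_itv/= /p; have := Vub _ Vx; lra.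
(* [H2] excludes the pivot, which is the image of [b]; removing this one point does not change the
   measure of [W]. *)
have mWb : measurable (W `\ b) by exact: measurableD.
have WH2 : (mu W <= 2%:E * mu H2)%E.
  rewrite -(halves _ (a / 2))//.
  rewrite (_ : mu W = mu (W `\ b)); last first.
    rewrite -[in LHS](setDUK (_ : [set b] `<=` W)); last by move=> _ ->.
    rewrite setUC measureU0//; exact: lebesgue_measure_set1.
  apply: le_measure; rewrite ?inE//; first exact: mpre.
  move=> y [Wy yb] /=; split.
    by have := VWH _ _ Va Wy; congr H; field.
  rewrite /= in_itv/= /p; apply/negP; rewrite -ltNge.
  have := Wlb _ Wy; rewrite le_eqVlt => /orP[/eqP by_|]; last lra.
  by case: yb.
have -> : (mu H = mu H1 + mu H2)%E by rewrite addeC; exact: measureDI.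
by rewrite ge0_muleDr// leeD.
Qed.

End prekopa_leindler_line.

Section prekopa_leindler_line2.
Context {R : realType}.
Local Notation mu := (@lebesgue_measure R).
Local Notation MR := (measurableTypeR R).

Lemma compact_max (V : set R) : compact V -> V !=set0 ->
  exists2 a, V a & forall x, V x -> x <= a.
Proof.
move=> cV V0; have := @compact_EVT_max _ R id V V0 cV (continuous_subspaceT (fun x => cvg_id)).
by move=> [a /set_mem Va H]; exists a => // x /mem_set /H.
Qed.

Lemma compact_min (V : set R) : compact V -> V !=set0 ->
  exists2 a, V a & forall x, V x -> a <= x.
Proof.
move=> cV V0; have := @compact_EVT_min _ R id V V0 cV (continuous_subspaceT (fun x => cvg_id)).
by move=> [a /set_mem Va H]; exists a => // x /mem_set /H.
Qed.

(** Inner regularity reduces to compact subsets, which have the extreme points required by the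
    pivot; an empty compact subset is replaced by a point of [A] or [B], and there nonemptiness
    enters. *)
Lemma brunn_minkowski_line (A B H : set R) :
  measurable A -> measurable B -> measurable H -> A !=set0 -> B !=set0 ->
  (forall x y, A x -> B y -> H ((x + y) / 2)) ->
  (mu A + mu B <= 2%:E * mu H)%E.
Proof.
move=> mA mB mH [a0 Aa0] [b0 Bb0] ABH.
(* The suprema over the two compact sets are taken one after the other, by subtracting the measure
   of the other set, which calls for finite measures. *)
have [Hoo|Hfin] := leP +oo%E (mu H).
  by move: Hoo; rewrite leye_eq => /eqP ->; rewrite gt0_muley ?lte_fin// leey.
have fH : (2%:E * mu H)%E \is a fin_num.
  by rewrite fin_numM// ge0_fin_numE.
have key V W : compact V -> V `<=` A -> compact W -> W `<=` B ->
    (mu V + mu W <= 2%:E * mu H)%E.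
  move=> cV VA cW WB.
  wlog V0 : V cV VA / V !=set0.
    move=> hw; have [V0|/set0P/negP] := pselect (V !=set0); first exact: hw.
    rewrite negbK => /eqP ->; rewrite measure0.
    apply: le_trans (hw [set a0] _ _ _); last 3 first.
    - exact: compact_set1.
    - by move=> _ ->.
    - by exists a0.
    by rewrite leeD2r.
  wlog W0 : W cW WB / W !=set0.
    move=> hw; have [W0|/set0P/negP] := pselect (W !=set0); first exact: hw.
    rewrite negbK => /eqP ->; rewrite measure0.
    apply: le_trans (hw [set b0] _ _ _); last 3 first.
    - exact: compact_set1.
    - by move=> _ ->.
    - by exists b0.
    by rewrite leeD2l.
  have [a Va Vub] := compact_max cV V0.
  have [b Wb Wlb] := compact_min cW W0.
  apply: (brunn_minkowski_pivot _ _ mH Va Wb) => //; try exact: compact_measurable.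
  by move=> x y Vx Wy; apply: ABH; [exact: VA|exact: WB].
have sup_le (D : set R) (M : \bar R) : measurable D ->
    (forall V, compact V -> V `<=` D -> mu V <= M)%E -> (mu D <= M)%E.
  move=> mD DM; rewrite (@lebesgue_regularity_inner_sup R D mD).
  by apply: ge_ereal_sup => _ [V [cV VD] <-]; exact: DM.
have fW W : compact W -> (mu W \is a fin_num).
  by move=> cW; rewrite ge0_fin_numE// compact_finite_measure.
have key2 W : compact W -> W `<=` B -> (mu A + mu W <= 2%:E * mu H)%E.
  move=> cW WB; rewrite -leeBrDr ?fW//; apply: sup_le => // V cV VA.
  by rewrite leeBrDr ?fW//; exact: key.
have fA : mu A \is a fin_num.
  rewrite ge0_fin_numE//; have := key2 set0 compact0 (@sub0set _ B).
  by rewrite measure0 adde0 => /le_lt_trans; apply; rewrite ltey_eq fH.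
rewrite -leeBrDl//; apply: sup_le => // W cW WB.
by rewrite leeBrDl//; exact: key2.
Qed.

(** Tonelli for the region under the graph; the condition [0 <= l] makes negative levels contribute
    nothing. *)
Lemma layer_cake (f : R -> R) : measurable_fun setT f -> (forall x, 0 <= f x) ->
  (\int[mu]_x (f x)%:E = \int[mu]_l mu [set x | (0 <= l < f x)%R])%E.
Proof.
move=> mf f0.
pose b (z : MR * MR) : bool := (0 <= z.2) && (z.2 < f z.1).
have mb : measurable_fun setT b.
  apply: measurable_and; first exact: measurable_fun_ler.
  apply: measurable_fun_ltr => //.
  exact: (measurableT_comp mf).
pose D : set (MR * MR) := [set z | b z].
have mD : measurable D.
  by rewrite -[D]setTI; exact: (mb measurableT [set true]).
transitivity (\int[mu]_x \int[mu]_l (\1_D (x, l))%:E)%E.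
  apply: eq_integral => x _.
  transitivity (\int[mu]_l (\1_(`[0%R, f x[%classic : set MR) l)%:E)%E; last first.
    apply: eq_integral => l _; rewrite !indicE.
    suff -> : ((x, l) \in D) = (l \in (`[0%R, f x[%classic : set MR)) by [].
    by apply/idP/idP => /set_mem H; apply/mem_set; move: H; rewrite /D /b/= in_itv.
  rewrite integral_indic// setIT.
  transitivity (mu `[0, f x[%classic); last by [].
  rewrite lebesgue_measure_itv /= lte_fin.
  case: ifPn => [_|]; first by rewrite oppr0 adde0.
  rewrite -leNgt => fx; congr _%:E; apply/eqP; rewrite eq_le f0 andbT.
  exact: fx.
rewrite (fubini_tonelli (fun z => (\1_D z)%:E)); last 2 first.
- exact/measurable_EFinP/measurable_indic.
- by move=> z; rewrite lee_fin.
apply: eq_integral => l _.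
have mDl : measurable [set x : MR | (0 <= l < f x)%R].
  have := measurable_ysection l mD; rewrite /ysection.
  by congr measurable; apply/seteqP; split => x /=; rewrite inE.
transitivity (\int[mu]_x (\1_([set x : MR | (0 <= l < f x)%R] : set MR) x)%:E)%E.
  apply: eq_integral => x _; rewrite !indicE.
  suff -> : ((x, l) \in D) = (x \in ([set x : MR | (0 <= l < f x)%R] : set MR)).
    by [].
  by apply/idP/idP; rewrite !inE.
by rewrite integral_indic// setIT.
Qed.
End prekopa_leindler_line2.

Section prekopa_leindler_gauss.
Context {R : realType}.
Local Notation mu := (@lebesgue_measure R).
Local Notation MR := (measurableTypeR R).
Implicit Types f g h : R -> R.

(** Since both suprema are $1$, the level sets of $f$ and $g$ at any $0 \le l < 1$ are nonempty
    together, and their half-sums lie in the level set of $h$ because $fg > l^2$ forces $h > l$.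
    Brunn-Minkowski is then integrated over $l$. *)
Lemma prekopa_leindler_sup1 f g h :
  measurable_fun setT f -> measurable_fun setT g -> measurable_fun setT h ->
  (forall x, 0 <= f x <= 1) -> (forall x, 0 <= g x <= 1) ->
  (forall x, 0 <= h x) ->
  (forall l, l < 1 -> exists x, l < f x) ->
  (forall l, l < 1 -> exists x, l < g x) ->
  (forall x y, f x * g y <= h ((x + y) / 2) ^+ 2) ->
  (\int[mu]_x (f x)%:E + \int[mu]_x (g x)%:E <= 2%:E * \int[mu]_x (h x)%:E)%E.
Proof.
move=> mf mg mh f01 g01 h0 fs gs fgh.
have f0 x : 0 <= f x by case/andP: (f01 x).
have g0 x : 0 <= g x by case/andP: (g01 x).
have mlev (k : R -> R) : measurable_fun setT k ->
    measurable_fun setT (fun l : MR => mu [set x : R | (0 <= l < k x)%R]).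
  move=> mk.
  pose b (z : MR * MR) : bool := (0 <= z.2) && (z.2 < k z.1).
  have mb : measurable_fun setT b.
    apply: measurable_and; first exact: measurable_fun_ler.
    apply: measurable_fun_ltr => //.
    exact: (measurableT_comp mk).
  have mD : measurable ([set z | b z] : set (MR * MR)).
    by rewrite -[X in measurable X]setTI; exact: (mb measurableT [set true]).
  have := measurable_fun_ysection mu mD; congr measurable_fun.
  apply/funext => l /=; congr (mu _); apply/seteqP.
  by split => x; rewrite /ysection/= inE.
have mset (k : R -> R) (l : R) : measurable_fun setT k -> measurable [set x : R | (0 <= l < k x)%R].
  move=> mk; have mb : measurable_fun setT (fun x : R => (0 <= l) && (l < k x)).
    by apply: measurable_and => //; exact: measurable_fun_ltr.
  by rewrite -[X in measurable X]setTI; exact: (mb measurableT [set true]).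
rewrite !layer_cake// -ge0_integralD//; last 2 first.
- exact: mlev.
- exact: mlev.
rewrite -ge0_integralZl_EFin//; last exact: mlev.
apply: ge0_le_integral => //.
- by move=> l _; rewrite adde_ge0.
- by apply: emeasurable_funD; exact: mlev.
- by apply: emeasurable_funM => //; exact: mlev.
move=> l _; have [l0|l0] := boolP (l < 0).
  have emp (k : R -> R) : mu [set x : MR | (0 <= l < k x)%R] = 0%E.
    rewrite (_ : [set x : MR | _] = set0) ?measure0//.
    by apply/seteqP; split => x //= /andP[]; rewrite leNgt l0.
  by rewrite /= !emp adde0 mule0.
move: l0; rewrite -leNgt => l0.
have [l1|l1] := ltP l 1; last first.
  have emp (k : R -> R) : (forall x, 0 <= k x <= 1) ->
      mu [set x : MR | (0 <= l < k x)%R] = 0%E.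
    move=> k1; rewrite (_ : [set x : MR | _] = set0) ?measure0//.
    apply/seteqP; split => x //= /andP[_].
    by have /andP[_ /le_trans/(_ l1)] := k1 x; rewrite leNgt => /negbTE ->.
  by rewrite /= (emp f)// (emp g)// adde0 mule_ge0.
apply: brunn_minkowski_line; try exact: mset.
- by have [x lx] := fs _ l1; exists x; rewrite /= l0.
- by have [x lx] := gs _ l1; exists x; rewrite /= l0.
move=> x y /= /andP[_ lx] /andP[_ ly]; rewrite l0/=.
rewrite -(@ltr_pXn2r _ 2)// ?nnegrE//.
by apply: lt_le_trans (fgh _ _); rewrite expr2 ltr_pM.
Qed.

(** Dividing $f$, $g$ and $h$ by $a = \sup f$, $b = \sup g$ and $\sqrt{ab}$ preserves the
    hypothesis; the arithmetic-geometric mean inequality then turns the sum of the normalized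
    integrals into a product. *)
Lemma prekopa_leindler_lebesgue f g h (M : R) :
  measurable_fun setT f -> measurable_fun setT g -> measurable_fun setT h ->
  (forall x, 0 <= f x <= M) -> (forall x, 0 <= g x <= M) ->
  (forall x, 0 <= h x) ->
  (\int[mu]_x (f x)%:E < +oo)%E -> (\int[mu]_x (g x)%:E < +oo)%E ->
  (\int[mu]_x (h x)%:E < +oo)%E ->
  (forall x y, f x * g y <= h ((x + y) / 2) ^+ 2) ->
  (\int[mu]_x (f x)%:E * \int[mu]_x (g x)%:E <=
   \int[mu]_x (h x)%:E * \int[mu]_x (h x)%:E)%E.
Proof.
move=> mf mg mh fM gM h0 foo goo hoo fgh.
have f0 x : 0 <= f x by case/andP: (fM x).
have g0 x : 0 <= g x by case/andP: (gM x).
have I0 (k : R -> R) : (forall x, 0 <= k x) -> (0 <= \int[mu]_x (k x)%:E)%E.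
  by move=> k0; apply: integral_ge0 => x _; rewrite lee_fin.
have sup_spec (k : R -> R) : (forall x, 0 <= k x <= M) -> exists s, [/\ 0 <= s,
    forall x, k x <= s & forall l, l < s -> exists x, l < k x].
  move=> kM; have hs : has_sup (range k).
    by split; [exists (k 0); exists 0|exists M => _ [x _ <-]; case/andP: (kM x)].
  exists (sup (range k)); split.
  - apply: (@le_trans _ _ (k 0)); first by case/andP: (kM 0).
    by apply: sup_upper_bound => //; exists 0.
  - by move=> x; apply: sup_upper_bound => //; exists x.
  - by move=> l /(sup_gt hs.1)[_ [x _ <-] lx]; exists x.
have zero (k : R -> R) : (forall x, 0 <= k x) -> (forall x, k x <= 0) ->
    (\int[mu]_x (k x)%:E = 0)%E.
  move=> k0 k1; apply: integral0_eq => x _; congr _%:E.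
  by apply/eqP; rewrite eq_le k0 k1.
have [a [a0 fa fas]] := sup_spec f fM.
have [b [b0 gb gbs]] := sup_spec g gM.
move: a0; rewrite le_eqVlt => /orP[/eqP a0|a0].
  by rewrite (zero f)// ?mul0e ?mule_ge0// ?I0// a0.
move: b0; rewrite le_eqVlt => /orP[/eqP b0|b0].
  by rewrite (zero g)// ?mule0 ?mule_ge0// ?I0// b0.
have an0 : a != 0 by rewrite gt_eqF.
have bn0 : b != 0 by rewrite gt_eqF.
pose c := Num.sqrt (a * b).
have c0 : 0 < c by rewrite sqrtr_gt0 mulr_gt0.
have cc : c ^+ 2 = a * b by rewrite sqr_sqrtr// ltW// mulr_gt0.
have mscl (k : R -> R) (s : R) : measurable_fun setT k -> measurable_fun setT (fun x => s^-1 * k x).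
  by move=> mk; exact: measurable_funM.
have := @prekopa_leindler_sup1 (fun x => a^-1 * f x) (fun x => b^-1 * g x)
  (fun x => c^-1 * h x) (mscl _ _ mf) (mscl _ _ mg) (mscl _ _ mh).
have Zl (k : R -> R) (s : R) : 0 < s -> (forall x, 0 <= k x) -> measurable_fun setT k ->
    (\int[mu]_x (s^-1 * k x)%:E = s^-1%:E * \int[mu]_x (k x)%:E)%E.
  move=> s0 k0 mk; under eq_integral do rewrite EFinM.
  rewrite ge0_integralZl_EFin ?invr_ge0 ?(ltW s0)//.
    by move=> x _; rewrite lee_fin.
  exact/measurable_EFinP.
rewrite !Zl//.
have scl (k : R -> R) (s : R) : 0 < s -> (forall x, 0 <= k x) -> (forall x, k x <= s) ->
    forall x, 0 <= s^-1 * k x <= 1.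
  move=> s0 k0 ks x; rewrite mulr_ge0 ?invr_ge0 ?(ltW s0)//=.
  by rewrite mulrC ler_pdivrMr// mul1r.
have scs (k : R -> R) (s : R) : 0 < s -> (forall l, l < s -> exists x, l < k x) ->
    forall l, l < 1 -> exists x, l < s^-1 * k x.
  move=> s0 ks l l1; have [|x lx] := ks (l * s).
    by rewrite -[ltRHS]mul1r ltr_pM2r.
  by exists x; rewrite mulrC ltr_pdivlMr.
move/(_ (scl _ _ a0 f0 fa) (scl _ _ b0 g0 gb)).
move/(_ (fun x => mulr_ge0 (ltW (eq_ind_r (fun z => is_true z) c0 (invr_gt0 c))) (h0 x))).
move/(_ (scs _ _ a0 fas) (scs _ _ b0 gbs)).
have step x y : a^-1 * f x * (b^-1 * g y) <= (c^-1 * h ((x + y) / 2)) ^+ 2.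
  rewrite exprMn exprVn cc mulrACA -invfM ler_wpM2l//.
  by rewrite invr_ge0 mulr_ge0// ltW.
move/(_ step).
have /fineK <- : (\int[mu]_x (f x)%:E)%E \is a fin_num by rewrite ge0_fin_numE ?I0.
have /fineK <- : (\int[mu]_x (g x)%:E)%E \is a fin_num by rewrite ge0_fin_numE ?I0.
have /fineK <- : (\int[mu]_x (h x)%:E)%E \is a fin_num by rewrite ge0_fin_numE ?I0.
have := fine_ge0 (I0 f f0); have := fine_ge0 (I0 g g0); have := fine_ge0 (I0 h h0).
set H := fine _; set G := fine _; set F := fine _ => H0 G0 F0.
rewrite -!EFinM -EFinD !lee_fin => ineq.
have ab0 : 0 <= a * b / 4 by rewrite divr_ge0// mulr_ge0// ltW.
have /(ler_wpM2l ab0) : (a^-1 * F + b^-1 * G) ^+ 2 <= (2 * (c^-1 * H)) ^+ 2.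
  have S0 : 0 <= a^-1 * F + b^-1 * G.
    by rewrite addr_ge0// mulr_ge0// invr_ge0 ltW.
  by rewrite !expr2; apply: ler_pM.
rewrite 2!exprMn exprVn cc.
have -> : a * b / 4 * (2 ^+ 2 * ((a * b)^-1 * H ^+ 2)) = H * H.
  by field; rewrite an0 bn0.
apply: le_trans.
have -> : a * b / 4 * (a^-1 * F + b^-1 * G) ^+ 2 =
          F * G + a * b / 4 * (a^-1 * F - b^-1 * G) ^+ 2.
  by field; rewrite an0 bn0.
by rewrite lerDl mulr_ge0 ?sqr_ge0// divr_ge0// mulr_ge0// ltW.
Qed.

(** The density is absorbed into the three functions; the hypothesis survives by log-concavity,
    $\varphi(x)\varphi(y) \le \varphi((x+y)/2)^2$. *)
Lemma prekopa_leindler_stdn f g h :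
  measurable_fun setT f -> measurable_fun setT g -> measurable_fun setT h ->
  (forall x, 0 <= f x <= 1) -> (forall x, 0 <= g x <= 1) ->
  (forall x, 0 <= h x <= 1) ->
  (forall x y, f x * g y <= h ((x + y) / 2) ^+ 2) ->
  (\int[stdn]_x (f x)%:E * \int[stdn]_x (g x)%:E <=
   \int[stdn]_x (h x)%:E * \int[stdn]_x (h x)%:E)%E.
Proof.
move=> mf mg mh f01 g01 h01 fgh.
have toleb (k : R -> R) : measurable_fun setT k -> (forall x, 0 <= k x <= 1) ->
    (\int[stdn]_x (k x)%:E = \int[mu]_x (k x * phi x)%:E)%E.
  move=> mk k01; rewrite integral_stdn//; first exact/measurable_EFinP.
  by move=> x; rewrite lee_fin; case/andP: (k01 x).
have fin (k : R -> R) : measurable_fun setT k -> (forall x, 0 <= k x <= 1) ->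
    (\int[mu]_x (k x * phi x)%:E < +oo)%E.
  move=> mk k01; rewrite -toleb//.
  apply: (@le_lt_trans _ _ (\int[@stdn R]_x (cst 1%E) x)%E).
    apply: ge0_le_integral => //.
    - by move=> x _; rewrite lee_fin; case/andP: (k01 x).
    - exact/measurable_EFinP.
    - by move=> x _; rewrite lee_fin; case/andP: (k01 x).
  by rewrite integral_cst// mul1e; apply: le_lt_trans (probability_le1 _ _) (ltry _).
have mphi (k : R -> R) : measurable_fun setT k -> measurable_fun setT (fun x => k x * phi x).
  by move=> mk; apply: measurable_funM => //; exact: measurable_phi.
have phi1 x : phi x <= normal_peak 1 :> R.
  rewrite /phi ler_piMr ?normal_peak_ge0// -[leRHS]expR0 ler_expR oppr_le0.
  by rewrite divr_ge0// sqr_ge0.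
have bd (k : R -> R) : (forall x, 0 <= k x <= 1) -> forall x, 0 <= k x * phi x <= normal_peak 1.
  move=> k01 x; have /andP[k0 k1] := k01 x; rewrite mulr_ge0 ?phi_ge0//=.
  by apply: le_trans (phi1 x); rewrite ler_piMl ?phi_ge0.
rewrite !toleb//; apply: (@prekopa_leindler_lebesgue _ _ _ (normal_peak 1)).
- exact: mphi.
- exact: mphi.
- exact: mphi.
- exact: bd.
- exact: bd.
- by move=> x; case/andP: (bd _ h01 x).
- exact: fin.
- exact: fin.
- exact: fin.
move=> x y; rewrite mulrACA exprMn; apply: ler_pM => //.
- by rewrite mulr_ge0//; [case/andP: (f01 x)|case/andP: (g01 y)].
- by rewrite mulr_ge0 ?phi_ge0.
rewrite /phi mulrACA -expRD exprMn -expRM_natl -expr2.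
rewrite ler_wpM2l ?sqr_ge0// ler_expR.
have : 0 <= (x - y) ^+ 2 by exact: sqr_ge0.
by rewrite !expr2; nra.
Qed.

End prekopa_leindler_gauss.

(** * The Gaussian measure on tuples and Anderson's inequality *)

Section gaussn.
Context {R : realType}.

Definition consp n (z : R * n.-tuple R) : n.+1.-tuple R := [tuple of z.1 :: z.2].

Lemma measurable_consp n : measurable_fun setT (@consp n).
Proof. exact: (measurable_cons (f := fst) (g := snd)). Qed.

(** Built one coordinate at a time, so that statements about it go by induction on the dimension
    through Fubini. *)
Fixpoint gaussn n : probability (n.-tuple R) R :=
  if n is n'.+1 then push_prob (stdn \x gaussn n')%E (@measurable_consp n')
  else \d_[tuple].

Lemma integral_gaussnS n (F : n.+1.-tuple R -> \bar R) :
  measurable_fun setT F -> (forall x, 0 <= F x)%E ->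
  (\int[gaussn n.+1]_t F t =
   \int[stdn]_x \int[gaussn n]_t F [tuple of x :: t])%E.
Proof.
move=> mF F0; have mFc := measurableT_comp mF (@measurable_consp n).
rewrite (ge0_integral_pushforward (@measurable_consp n))//.
exact: (fubini_tonelli1 _ mFc (fun z => F0 _)).
Qed.

Arguments gaussn : simpl never.

Lemma measurable_cons_tuple n (x : R) :
  measurable_fun setT (fun t : n.-tuple R => [tuple of x :: t]).
Proof. exact: measurable_cons. Qed.

Lemma integral_gaussn0 (F : 0.-tuple R -> \bar R) : (forall x, 0 <= F x)%E ->
  measurable_fun setT F ->
  (\int[gaussn 0]_t F t = F [tuple])%E.
Proof. by move=> F0 mF; rewrite integral_dirac// diracT mul1e. Qed.

Lemma measurable_gaussn_inner n (F : n.+1.-tuple R -> \bar R) :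
  measurable_fun setT F -> (forall x, 0 <= F x)%E ->
  measurable_fun setT (fun x => (\int[gaussn n]_t F [tuple of x :: t])%E).
Proof.
move=> mF F0; have mFc := measurableT_comp mF (@measurable_consp n).
exact: (measurable_fun_fubini_tonelli_F _ mFc (fun z => F0 _)).
Qed.

Definition scalet n (s : R) (t : n.-tuple R) : n.-tuple R := [tuple s * tnth t i | i < n].
Definition addt n (t u : n.-tuple R) : n.-tuple R := [tuple tnth t i + tnth u i | i < n].
Definition sqt n (t : n.-tuple R) : R := \sum_(i < n) tnth t i ^+ 2.

Lemma scalet_cons n s x (t : n.-tuple R) :
  scalet s [tuple of x :: t] = [tuple of s * x :: scalet s t].
Proof.
apply: eq_from_tnth => i; rewrite tnth_mktuple.
by case: (unliftP ord0 i) => [j ->|->]; rewrite ?tnth0// !tnthS tnth_mktuple.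
Qed.

Lemma addt_cons n x y (t u : n.-tuple R) :
  addt [tuple of x :: t] [tuple of y :: u] = [tuple of x + y :: addt t u].
Proof.
apply: eq_from_tnth => i; rewrite tnth_mktuple.
by case: (unliftP ord0 i) => [j ->|->]; rewrite ?tnth0// !tnthS tnth_mktuple.
Qed.

Lemma sqt_cons n x (t : n.-tuple R) : sqt [tuple of x :: t] = x ^+ 2 + sqt t.
Proof.
rewrite /sqt big_ord_recl tnth0; congr (_ + _).
by apply: eq_bigr => i _; rewrite tnthS.
Qed.

Lemma measurable_scalet n s : measurable_fun setT (@scalet n s).
Proof.
apply/measurable_fun_tnthP => i /=.
rewrite (_ : _ \o _ = fun t => s * tnth t i); last first.
  by apply/funext => t /=; rewrite tnth_mktuple.
by apply: measurable_funM => //; exact: measurable_tnth.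
Qed.

Lemma measurable_addt n d (T : measurableType d) (f g : T -> n.-tuple R) :
  measurable_fun setT f -> measurable_fun setT g ->
  measurable_fun setT (fun x => addt (f x) (g x)).
Proof.
move=> mf mg; apply/measurable_fun_tnthP => i /=.
rewrite (_ : _ \o _ = fun t => tnth (f t) i + tnth (g t) i); last first.
  by apply/funext => t /=; rewrite tnth_mktuple.
apply: measurable_funD.
  exact: (measurableT_comp (measurable_tnth i) mf).
exact: (measurableT_comp (measurable_tnth i) mg).
Qed.

Lemma measurable_sqt n : measurable_fun setT (@sqt n).
Proof.
apply: measurable_sum => i; apply: measurable_funX; exact: measurable_tnth.
Qed.

(** Up to the factor $|s|^{-n}$, the weight is the density of the centered Gaussian of standard
    deviation $|s|$ against the standard one. *)
Definition tiltt n (s : R) (F : n.-tuple R -> \bar R) t : \bar R :=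
  (F t * (expR (- ((s ^- 2 - 1) * sqt t / 2)))%:E)%E.

Lemma measurable_tiltt n s (F : n.-tuple R -> \bar R) :
  measurable_fun setT F -> measurable_fun setT (tiltt s F).
Proof.
move=> mF; apply: emeasurable_funM => //; apply/measurable_EFinP.
apply: measurableT_comp => //; apply: measurableT_comp => //.
apply: measurable_funM => //; apply: measurable_funM => //.
exact: measurable_sqt.
Qed.

Lemma tiltt_ge0 n s (F : n.-tuple R -> \bar R) :
  (forall t, 0 <= F t)%E -> forall t, (0 <= tiltt s F t)%E.
Proof. by move=> F0 t; rewrite mule_ge0// lee_fin expR_ge0. Qed.

Lemma integral_gaussn_scale n (s : R) (F : n.-tuple R -> \bar R) : s != 0 ->
  measurable_fun setT F -> (forall x, 0 <= F x)%E ->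
  (\int[gaussn n]_t F (scalet s t) =
   (`|s| ^- n)%:E * \int[gaussn n]_t tiltt s F t)%E.
Proof.
move=> s0; elim: n F => [|n IH] F mF F0.
  rewrite (integral_gaussn0 (F := fun t => F (scalet s t)))//; last first.
    exact: (measurableT_comp mF (measurable_scalet s)).
  rewrite integral_gaussn0; last 2 first.
  - exact: tiltt_ge0.
  - exact: measurable_tiltt.
  rewrite expr0 invr1 mul1e /tiltt /sqt big_ord0 mulr0 mul0r oppr0 expR0 mule1.
  by rewrite [scalet _ _]tuple0.
have mFs := measurableT_comp mF (@measurable_scalet n.+1 s).
rewrite (integral_gaussnS mFs (fun t => F0 _)).
have mFx x : measurable_fun setT (fun t : n.-tuple R => F [tuple of x :: t]).
  exact: (measurableT_comp mF (measurable_cons_tuple x)).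
pose K y := (\int[gaussn n]_t tiltt s (fun t => F [tuple of y :: t]) t)%E.
(* Measurability of partial integrals is known for functions of the whole tuple, so the tail is
   recovered with [behead]. *)
have mT : measurable_fun setT (fun t : n.+1.-tuple R =>
    F t * (expR (- ((s ^- 2 - 1) * sqt [tuple of behead t] / 2)))%:E)%E.
  apply: emeasurable_funM => //; apply/measurable_EFinP.
  apply: measurableT_comp => //; apply: measurableT_comp => //.
  apply: measurable_funM => //; apply: measurable_funM => //.
  exact: (measurableT_comp (@measurable_sqt n) (@measurable_behead _ R n)).
have beheadE (x : R) (t : n.-tuple R) : [tuple of behead [tuple of x :: t]] = t.
  exact: val_inj.
have mK : measurable_fun setT K.
  rewrite (_ : K = fun x => (\int[gaussn n]_t (F [tuple of x :: t] *
    (expR (- ((s ^- 2 - 1) *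
      sqt [tuple of behead [tuple of x :: t]] / 2)))%:E))%E); last first.
    by apply/funext => x; apply: eq_integral => t _; rewrite beheadE.
  by apply: (measurable_gaussn_inner mT) => t; rewrite mule_ge0// lee_fin expR_ge0.
have K0 y : (0 <= K y)%E.
  by apply: integral_ge0 => t _; apply: tiltt_ge0.
transitivity (\int[stdn]_x ((`|s| ^- n)%:E * K (s * x)%R))%E.
  apply: eq_integral => x _ /=.
  under eq_integral do rewrite scalet_cons.
  by rewrite (IH (fun t => F [tuple of s * x :: t])).
rewrite ge0_integralZl_EFin//; do ?[exact: (measurableT_comp mK)|
  by rewrite invr_ge0 exprn_ge0].
rewrite integral_stdn_scale// muleA -EFinM -invfM -exprSr; congr (_ * _)%E.
rewrite integral_gaussnS; last 2 first.
- exact: measurable_tiltt.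
- exact: tiltt_ge0.
apply: eq_integral => x _; rewrite muleC /K -ge0_integralZl_EFin//;
  do ?[by move=> t _; apply: tiltt_ge0|exact: measurable_tiltt|exact: expR_ge0].
apply: eq_integral => t _; rewrite /tiltt muleCA -EFinM -expRD sqt_cons.
by congr (_ * (expR _)%:E)%E; set k := _ - 1; field.
Qed.

End gaussn.

Section anderson.
Context {R : realType}.

Definition midt n (x y : n.-tuple R) := scalet 2^-1 (addt x y).

Lemma midt_cons n a b (x y : n.-tuple R) :
  midt [tuple of a :: x] [tuple of b :: y] = [tuple of (a + b) / 2 :: midt x y].
Proof. by rewrite /midt addt_cons scalet_cons mulrC. Qed.

Lemma unit_integral_gaussn n (f : n.-tuple R -> R) : measurable_fun setT f ->
  (forall x, 0 <= f x <= 1) -> (0 <= \int[gaussn n]_t (f t)%:E <= 1)%E.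
Proof.
move=> mf f01; apply/andP; split.
  by apply: integral_ge0 => t _; rewrite lee_fin; case/andP: (f01 t).
apply: (@le_trans _ _ (\int[gaussn n]_t (cst 1%E) t)%E).
  apply: ge0_le_integral => //.
  - by move=> x _; rewrite lee_fin; case/andP: (f01 x).
  - exact/measurable_EFinP.
  - by move=> x _; rewrite lee_fin; case/andP: (f01 x).
by rewrite integral_cst// mul1e; apply: probability_le1.
Qed.

(** Tensorization: the induction hypothesis for the sections at first coordinates [a] and [b] is the
    hypothesis of the one-dimensional inequality for the partial integrals. *)
Lemma prekopa_leindler_gaussn n (f g h : n.-tuple R -> R) :
  measurable_fun setT f -> measurable_fun setT g -> measurable_fun setT h ->
  (forall x, 0 <= f x <= 1) -> (forall x, 0 <= g x <= 1) ->
  (forall x, 0 <= h x <= 1) ->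
  (forall x y, f x * g y <= h (midt x y) ^+ 2) ->
  (\int[gaussn n]_x (f x)%:E * \int[gaussn n]_x (g x)%:E <=
   \int[gaussn n]_x (h x)%:E * \int[gaussn n]_x (h x)%:E)%E.
Proof.
elim: n f g h => [|n IH] f g h mf mg mh f01 g01 h01 fgh.
  have E (k : 0.-tuple R -> R) : measurable_fun setT k -> (forall x, 0 <= k x <= 1) ->
      (\int[gaussn 0]_x (k x)%:E = (k [tuple])%:E)%E.
    move=> mk k01; rewrite integral_gaussn0//.
      by move=> x; rewrite lee_fin; case/andP: (k01 x).
    exact/measurable_EFinP.
  rewrite !E// -!EFinM lee_fin -expr2.
  by have := fgh [tuple] [tuple]; rewrite [midt _ _]tuple0.
have sec (k : n.+1.-tuple R -> R) : measurable_fun setT k -> (forall x, 0 <= k x <= 1) ->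
    forall a, measurable_fun setT (fun t : n.-tuple R => k [tuple of a :: t]).
  by move=> mk _ a; exact: (measurableT_comp mk (measurable_cons_tuple a)).
pose I (k : n.+1.-tuple R -> R) a := (\int[gaussn n]_t (k [tuple of a :: t])%:E)%E.
have I01 (k : n.+1.-tuple R -> R) : measurable_fun setT k -> (forall x, 0 <= k x <= 1) ->
    forall a, (0 <= I k a <= 1)%E.
  by move=> mk k01 a; apply: unit_integral_gaussn => //; exact: sec.
have Ifin (k : n.+1.-tuple R -> R) : measurable_fun setT k -> (forall x, 0 <= k x <= 1) ->
    forall a, (fine (I k a))%:E = I k a.
  move=> mk k01 a; have /andP[i0 i1] := I01 k mk k01 a.
  by rewrite fineK// ge0_fin_numE//; apply: le_lt_trans i1 (ltry _).
have mI (k : n.+1.-tuple R -> R) : measurable_fun setT k -> (forall x, 0 <= k x <= 1) ->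
    measurable_fun setT (fun a => fine (I k a)).
  move=> mk k01; apply: measurableT_comp => //.
  apply: (measurable_gaussn_inner (F := fun t => (k t)%:E)).
    exact/measurable_EFinP.
  by move=> x; rewrite lee_fin; case/andP: (k01 x).
have E (k : n.+1.-tuple R -> R) : measurable_fun setT k -> (forall x, 0 <= k x <= 1) ->
    (\int[gaussn n.+1]_x (k x)%:E = \int[stdn]_a (fine (I k a))%:E)%E.
  move=> mk k01; rewrite integral_gaussnS; last 2 first.
  - exact/measurable_EFinP.
  - by move=> x; rewrite lee_fin; case/andP: (k01 x).
  by apply: eq_integral => a _; rewrite Ifin.
have F01 (k : n.+1.-tuple R -> R) : measurable_fun setT k -> (forall x, 0 <= k x <= 1) ->
    forall a, 0 <= fine (I k a) <= 1.
  by move=> mk k01 a; rewrite -!lee_fin Ifin//; exact: I01.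
rewrite !E//; apply: prekopa_leindler_stdn.
- exact: mI.
- exact: mI.
- exact: mI.
- exact: F01.
- exact: F01.
- exact: F01.
move=> a b; rewrite expr2 -lee_fin !EFinM !Ifin//.
apply: IH => //; do ?exact: sec.
by move=> x y; rewrite -midt_cons.
Qed.

(** The scaling formula at $s = -1$, where the weight is $1$. *)
Lemma gaussn_sym n (A : set (n.-tuple R)) : measurable A ->
  gaussn n (scalet (-1) @^-1` A) = gaussn n A.
Proof.
move=> mA.
have mA' : measurable (scalet (-1) @^-1` A).
  by rewrite -[X in measurable X]setTI; exact: (measurable_scalet (-1)).
have := @integral_gaussn_scale R n (-1) (fun t => (\1_A t)%:E).
rewrite oppr_eq0 oner_eq0 => /(_ isT) E.
transitivity (\int[gaussn n]_t (\1_(scalet (-1) @^-1` A) t)%:E)%E.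
  by rewrite integral_indic// setIT.
transitivity (\int[gaussn n]_t (\1_A (scalet (-1) t))%:E)%E; first by [].
rewrite E//; last exact/measurable_EFinP/measurable_indic.
rewrite normrN1 expr1n invr1 mul1e /tiltt sqrrN expr1n invr1 subrr.
under eq_integral do rewrite mul0r mul0r oppr0 expR0 mule1.
by rewrite integral_indic// setIT.
Qed.

(* Prekopa-Leindler for the indicators of the translates of [K] by [u] and by [-u], which
   have the same measure by symmetry. *)
Lemma anderson n (K : set (n.-tuple R)) (s : R) (u : n.-tuple R) : measurable K ->
  (forall t, K t -> K (scalet (-1) t)) ->
  (forall x y, K x -> K y -> K (midt x y)) ->
  (gaussn n [set w | K (addt (scalet s w) u)] <= gaussn n [set w | K (scalet s w)])%E.
Proof.
move=> mK symK cvxK.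
have mf (v : n.-tuple R) : measurable_fun setT (fun w => addt (scalet s w) v).
  by apply: measurable_addt => //; exact: measurable_scalet.
have mS (v : n.-tuple R) : measurable [set w | K (addt (scalet s w) v)].
  by rewrite -[X in measurable X]setTI; exact: (mf v).
have mSu := mS u; have mSn := mS (scalet (-1) u).
have mS0 : measurable [set w | K (scalet s w)].
  by rewrite -[X in measurable X]setTI; exact: (measurable_scalet s).
have negK t : K (scalet (-1) t) <-> K t.
  split=> [/symK|/symK//]; congr K; apply: eq_from_tnth => i.
  by rewrite !tnth_mktuple mulrA mulrNN !mul1r.
have E : gaussn n [set w | K (addt (scalet s w) u)] =
         gaussn n [set w | K (addt (scalet s w) (scalet (-1) u))].
  rewrite -[RHS]gaussn_sym//; congr (gaussn n _); apply/seteqP.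
  have H w : addt (scalet s (scalet (-1) w)) (scalet (-1) u) =
             scalet (-1) (addt (scalet s w) u).
    by apply: eq_from_tnth => i; rewrite !tnth_mktuple; ring.
  by split=> w /=; rewrite H negK.
have := @prekopa_leindler_gaussn n (\1_[set w | K (addt (scalet s w) u)])
  (\1_[set w | K (addt (scalet s w) (scalet (-1) u))]) (\1_[set w | K (scalet s w)]).
have iE (S : set (n.-tuple R)) : measurable S ->
    (\int[gaussn n]_t (\1_S t)%:E)%E = gaussn n S.
  by move=> mS'; rewrite integral_indic// setIT.
rewrite (iE _ mSu) (iE _ mSn) (iE _ mS0) -E.
have i01 (B : set (n.-tuple R)) x : 0 <= (\1_B x : R) <= 1.
  by rewrite indicE; case: (x \in B); rewrite ?lexx ?ler01.
move=> /(_ _ _ _ (i01 _) (i01 _) (i01 _)) H.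
have {H} : (gaussn n [set w | K (addt (scalet s w) u)] *
  gaussn n [set w | K (addt (scalet s w) u)] <=
  gaussn n [set w | K (scalet s w)] * gaussn n [set w | K (scalet s w)])%E.
  apply: H; do ?exact: measurable_indic.
  move=> x y; rewrite !indicE.
  case: (asboolP (K (addt (scalet s x) u))) => [Kx|Kx]; last first.
    by rewrite memNset// mul0r sqr_ge0.
  case: (asboolP (K (addt (scalet s y) (scalet (-1) u)))) => [Ky|Ky]; last first.
    by rewrite [y \in _]memNset// mulr0 sqr_ge0.
  rewrite !mem_set// ?mulr1 ?expr1n//=.
  have := cvxK _ _ Kx Ky; congr K; apply: eq_from_tnth => i.
  by rewrite !tnth_mktuple; field.
rewrite -(fineK (fin_num_measure (gaussn n) _ (mS u))).
rewrite -(fineK (fin_num_measure (gaussn n) _ mS0)) -!EFinM !lee_fin -!expr2.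
by rewrite ler_pXn2r// nnegrE fine_ge0.
Qed.

End anderson.

(** * Independence and Gaussian linear forms *)

Section independence.
Context {R : realType}.

Definition rect n (B : 'I_n -> set R) : set (n.-tuple R) :=
  [set t | forall i, B i (tnth t i)].

Definition rects n : set (set (n.-tuple R)) :=
  [set rect B | B in [set B | forall i, measurable (B i)]].

Lemma measurable_rect n (B : 'I_n -> set R) : (forall i, measurable (B i)) ->
  measurable (rect B).
Proof.
move=> mB; rewrite (_ : rect B =
    \bigcap_(i in [set: 'I_n]) ((fun t => tnth t i) @^-1` B i)); last first.
  by apply/seteqP; split => t H i //=; exact: H.
apply: fin_bigcap_measurable => // i _.
by rewrite -[X in measurable X]setTI; exact: (measurable_tnth i).
Qed.

Lemma setI_closed_rects n : setI_closed (@rects n).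
Proof.
move=> _ _ [B mB <-] [C mC <-]; exists (fun i => B i `&` C i).
  by move=> i; exact: measurableI.
apply/seteqP; split => t /=; first by move=> H; split => i; case: (H i).
by move=> [H1 H2] i; split.
Qed.

Lemma rects_setT n : @rects n setT.
Proof. by exists (fun=> setT) => //; apply/seteqP; split. Qed.

Lemma measurable_tuple_rects n : @measurable _ (n.-tuple R) = <<s @rects n >>.
Proof.
apply/seteqP; split; last first.
  apply: smallest_sub; first exact: sigma_algebra_measurable.
  by move=> _ [B mB <-]; exact: measurable_rect.
apply: smallest_sub; first exact: smallest_sigma_algebra.
move=> A; rewrite -bigcup_seq => -[i _ [B mB <-]]; rewrite setTI.
apply: sub_sigma_algebra; exists (fun j => if j == i then B else setT).
  by move=> j; case: ifP.
apply/seteqP; split => t /=; first by move/(_ i); rewrite eqxx.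
by move=> Bt j; case: eqP => // ->.
Qed.

Lemma gaussn_rect n (B : 'I_n -> set R) : (forall i, measurable (B i)) ->
  gaussn n (rect B) = (\prod_(i < n) stdn (B i))%E.
Proof.
elim: n B => [|n IH] B mB.
  rewrite big_ord0 [LHS](_ : _ = \d_([tuple] : 0.-tuple R) (rect B)) //.
  by rewrite diracE mem_set//; case.
have -> : gaussn n.+1 (rect B) = (stdn \x gaussn n)%E (@consp R n @^-1` rect B) by [].
rewrite (_ : _ @^-1` _ = B ord0 `*` rect (fun i => B (lift ord0 i))); last first.
  apply/seteqP; split => -[x t] /=.
    move=> H; split; first by have := H ord0; rewrite tnth0.
    by move=> i; have := H (lift ord0 i); rewrite tnthS.
  move=> [Bx Ht] i; case: (unliftP ord0 i) => [j ->|->]; rewrite ?tnth0//.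
  by rewrite tnthS; exact: Ht.
rewrite product_measure1E//; last by apply: measurable_rect.
by rewrite big_ord_recl; congr (_ * _)%E; exact: IH.
Qed.

(** Arbitrary measurable sets replace the sets of [G] one index at a time: with the other sets
    fixed, both sides are finite measures of the set at [e0] that agree on the pi-system [G]. *)
Lemma indep_extend d (T : measurableType d) (P : probability T R) (E : finType)
    dV (V : measurableType dV) (G : set (set V)) (mu : probability V R)
    (U : E -> T -> V) :
  @measurable _ V = <<s G >> -> setI_closed G -> G setT ->
  (forall e, measurable_fun setT (U e)) ->
  (forall D : E -> set V, (forall e, G (D e)) ->
    P (\bigcap_(e in [set: E]) (U e @^-1` D e)) = (\prod_e mu (D e))%E) ->
  forall D : E -> set V, (forall e, measurable (D e)) ->
    P (\bigcap_(e in [set: E]) (U e @^-1` D e)) = (\prod_e mu (D e))%E.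
Proof.
move=> mG GI GT mU PG.
have GM A : G A -> measurable A by rewrite mG; exact: sub_sigma_algebra.
have mpre e A : measurable A -> measurable (U e @^-1` A).
  by move=> mA; rewrite -[X in measurable X]setTI; exact: mU.
(* The list [s] holds the indices whose set is already arbitrary; outside it the sets are still in
   [G]. *)
suff H (s : seq E) D : (forall e, measurable (D e)) ->
    (forall e, e \notin s -> G (D e)) ->
    P (\bigcap_(e in [set: E]) (U e @^-1` D e)) = (\prod_e mu (D e))%E.
  by move=> D mD; apply: (H (enum E)) => // e; rewrite mem_enum.
elim: s D => [|e0 s IH] D mD GD; first by apply: PG => e; exact: GD.
have [e0s|e0s] := boolP (e0 \in s).
  by apply: IH => // e es; apply: GD; rewrite inE negb_or es andbT; apply: contraNneq es => ->.
pose D' C e := if e == e0 then C else D e.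
have mD' C : measurable C -> forall e, measurable (D' C e).
  by move=> mC e; rewrite /D'; case: ifP.
pose O := \bigcap_(e in [set: E]) (U e @^-1` D' setT e).
have mO : measurable O.
  by apply: fin_bigcap_measurable => // e _; apply: mpre; exact: mD'.
pose k : R := \prod_(e | e != e0) fine (mu (D e)).
have k0 : 0 <= k by apply: prodr_ge0 => e _; rewrite fine_ge0.
pose m1 := push_measure (mrestr P mO) (mU e0).
pose m2 := mscale (NngNum k0) mu.
have m1E C : m1 C = P (\bigcap_(e in [set: E]) (U e @^-1` D' C e)).
  rewrite /m1 /= /pushforward /mrestr; congr (P _); apply/seteqP; split => t /=.
    move=> [Ct Ot] e _; have := Ot e I; rewrite /D' /=.
    by case: eqP => // ->.
  move=> H; split; first by have := H e0 I; rewrite /D' eqxx.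
  by move=> e _; have := H e I; rewrite /D' /=; case: eqP.
have m2E C : m2 C = (\prod_e mu (D' C e))%E.
  rewrite /m2 /= /mscale /= (bigD1 e0)//= /D' eqxx muleC; congr (_ * _)%E.
  rewrite /k -prodEFin; apply: eq_bigr => e /negbTE ->.
  by rewrite fineK// fin_num_measure.
have DE : D = D' (D e0) by apply/funext => e; rewrite /D'; case: eqP => // ->.
rewrite DE -m1E -m2E.
apply: (@measure_unique _ R V G (fun=> setT)) => //.
- by rewrite bigcup_const//; exists 0%N.
- move=> A GA; rewrite [LHS]m1E [RHS]m2E; apply: IH.
    by apply: mD'; exact: GM.
  move=> e es; rewrite /D'; case: eqP => [//|/eqP ee0].
  by apply: GD; rewrite inE negb_or ee0.
- move=> _; rewrite m1E; apply: le_lt_trans (probability_le1 _ _) (ltry _).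
  by apply: fin_bigcap_measurable => // e _; apply: mpre; exact: mD'.
Qed.

End independence.

Section linear_forms.
Context {R : realType}.

Definition dott n (a : 'I_n -> R) (z : n.-tuple R) : R := \sum_i a i * tnth z i.

Lemma measurable_dott n (a : 'I_n -> R) : measurable_fun setT (dott a).
Proof.
by apply: measurable_sum => i; apply: measurable_funM => //; exact: measurable_tnth.
Qed.

Lemma dott_cons n (a : 'I_n.+1 -> R) x (z : n.-tuple R) :
  dott a [tuple of x :: z] = a ord0 * x + dott (a \o lift ord0) z.
Proof.
rewrite /dott big_ord_recl tnth0; congr (_ + _).
by apply: eq_bigr => i _; rewrite tnthS.
Qed.

(** The reflection with cosine $a/C$ and sine $A/C$, applied to a function of the first coordinate
    alone. *)
Lemma stdn_conv (a A : R) (H : R -> \bar R) : a != 0 -> measurable_fun setT H ->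
  (forall x, 0 <= H x)%E ->
  (\int[stdn]_x \int[stdn]_u H (a * x + A * u)%R =
   \int[stdn]_x H (Num.sqrt (a ^+ 2 + A ^+ 2) * x)%R)%E.
Proof.
move=> a0 mH H0; set C := Num.sqrt _.
have CC : C ^+ 2 = a ^+ 2 + A ^+ 2 by rewrite sqr_sqrtr// addr_ge0 ?sqr_ge0.
have C0 : C != 0.
  by rewrite -sqrf_eq0 CC paddr_eq0 ?sqr_ge0// sqrf_eq0 (negbTE a0).
pose F (z : R * R) := H (C * z.1).
have mF : measurable_fun setT F.
  by apply: (measurableT_comp mH); exact: measurable_funM.
have := @integral_stdn_reflection R (a / C) (A / C) F.
rewrite mulf_neq0 ?invr_eq0// => /(_ isT).
have -> : (a / C) ^+ 2 + (A / C) ^+ 2 = 1.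
  by rewrite 2!expr_div_n -mulrDl -CC divff// expf_neq0.
move=> /(_ erefl mF (fun z => H0 _)) => E.
transitivity (\int[stdn]_u \int[stdn]_v F ((a / C) * u + (A / C) * v, (A / C) * u - (a / C) * v)%R)%E.
  apply: eq_integral => x _; apply: eq_integral => u _; congr (H _).
  by rewrite /=; field.
rewrite E; apply: eq_integral => x _; rewrite /F/=.
by rewrite integral_cst// [X in (_ * X)%E]probability_setT mule1.
Qed.

(** As [a i * b i = 0], a new coordinate enters at most one of the forms: [stdn_conv] absorbs it
    there, and if it enters neither it integrates out. *)
Lemma integral_two_forms n (a b : 'I_n -> R) (F : R * R -> \bar R) :
  measurable_fun setT F -> (forall x, 0 <= F x)%E ->
  (forall i, a i * b i = 0) ->
  (\int[gaussn n]_z F (dott a z, dott b z) =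
   \int[stdn]_u \int[stdn]_v
     F (Num.sqrt (\sum_i a i ^+ 2) * u, Num.sqrt (\sum_i b i ^+ 2) * v)%R)%E.
Proof.
elim: n a b F => [|n IH] a b F mF F0 ab.
  have mFd : measurable_fun setT (fun z : 0.-tuple R => F (dott a z, dott b z)).
    by apply: (measurableT_comp mF); apply: measurable_fun_pair; exact: measurable_dott.
  rewrite (integral_gaussn0 (F := fun z => F (dott a z, dott b z)))// /dott !big_ord0.
  under [RHS]eq_integral do under eq_integral do rewrite sqrtr0 !mul0r.
  under [RHS]eq_integral do rewrite integral_cst// [X in (_ * X)%E]probability_setT mule1.
  by rewrite integral_cst// [X in (_ * X)%E]probability_setT mule1.
have mFd : measurable_fun setT (fun z : n.+1.-tuple R => F (dott a z, dott b z)).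
  by apply: (measurableT_comp mF); apply: measurable_fun_pair; exact: measurable_dott.
rewrite (integral_gaussnS mFd (fun z => F0 _)).
have msh (p q p' q' : R) :
    measurable_fun setT (fun z : R * R => F (p + p' * z.1, q + q' * z.2)).
  apply: (measurableT_comp mF); apply: measurable_fun_pair.
    by apply: measurable_funD => //; exact: measurable_funM.
  by apply: measurable_funD => //; exact: measurable_funM.
have msh1 (p q : R) : measurable_fun setT (fun z : R * R => F (p + z.1, q + z.2)).
  have := msh p q 1 1; congr measurable_fun.
  by apply/funext => z; rewrite !mul1r.
set A := \sum_(i < n) (a (lift ord0 i)) ^+ 2.
set B := \sum_(i < n) (b (lift ord0 i)) ^+ 2.
have A0 : 0 <= A by apply: sumr_ge0 => i _; rewrite sqr_ge0.
have B0 : 0 <= B by apply: sumr_ge0 => i _; rewrite sqr_ge0.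
transitivity (\int[stdn]_x \int[stdn]_u \int[stdn]_v
   F (a ord0 * x + Num.sqrt A * u, b ord0 * x + Num.sqrt B * v)%R)%E.
  apply: eq_integral => x _.
  under eq_integral do rewrite !dott_cons.
  exact: (IH _ _ _ (msh1 (a ord0 * x) (b ord0 * x)) (fun z => F0 _) (fun i => ab _)).
rewrite !big_ord_recl -/A -/B.
have [a0|a0] := eqVneq (a ord0) 0; last first.
  have b0 : b ord0 = 0 by have /eqP := ab ord0; rewrite mulf_eq0 (negbTE a0) => /eqP.
  rewrite b0 expr0n/= add0r.
  pose H p := (\int[stdn]_v F (p, Num.sqrt B * v)%R)%E.
  have mH : measurable_fun setT H.
    apply: (measurable_fun_fubini_tonelli_F (fun z : R * R => F (z.1, Num.sqrt B * z.2)%R)) => //.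
    apply: (measurableT_comp mF); apply: measurable_fun_pair => //.
    exact: measurable_funM.
  have H0 p : (0 <= H p)%E by apply: integral_ge0.
  transitivity (\int[stdn]_x \int[stdn]_u H (a ord0 * x + Num.sqrt A * u)%R)%E.
    apply: eq_integral => x _; apply: eq_integral => u _; apply: eq_integral => v _.
    by rewrite mul0r add0r.
  by rewrite (stdn_conv (Num.sqrt A) a0 mH H0) sqr_sqrtr.
rewrite a0 expr0n/= add0r.
have [b0|b0] := eqVneq (b ord0) 0.
  rewrite b0 expr0n/= add0r.
  under eq_integral do under eq_integral do under eq_integral do rewrite !mul0r !add0r.
  by rewrite integral_cst// [X in (_ * X)%E]probability_setT mule1.
pose H x u := (\int[stdn]_v F (Num.sqrt A * u, b ord0 * x + Num.sqrt B * v)%R)%E.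
have mH : measurable_fun setT (fun z : R * R => H z.1 z.2).
  apply: (measurable_fun_fubini_tonelli_F
    (fun w : (R * R) * R => F (Num.sqrt A * w.1.2, b ord0 * w.1.1 + Num.sqrt B * w.2)%R)) => //.
  apply: (measurableT_comp mF); apply: measurable_fun_pair.
    apply: measurable_funM => //; exact: (measurableT_comp measurable_snd measurable_fst).
  apply: measurable_funD; apply: measurable_funM => //.
  exact: (measurableT_comp measurable_fst measurable_fst).
transitivity (\int[stdn]_x \int[stdn]_u H x u)%E.
  apply: eq_integral => x _; apply: eq_integral => u _; apply: eq_integral => v _.
  by rewrite mul0r add0r.
have H0 (z : R * R) : (0 <= H z.1 z.2)%E by apply: integral_ge0.
etransitivity; first exact: (fubini_tonelli (fun z : R * R => H z.1 z.2) mH H0).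
apply: eq_integral => u _; rewrite /H /=.
have mFu : measurable_fun setT (fun q : R => F (Num.sqrt A * u, q)).
  exact: (measurableT_comp mF (pair1_measurable _)).
rewrite -[X in Num.sqrt (_ + X)](sqr_sqrtr B0).
exact: (stdn_conv (Num.sqrt B) b0 mFu (fun q => F0 _)).
Qed.

(* With [S = dott a] and [D = dott b], the pair [(S + D, S - D)] is obtained from
   two independent standard normals by the reflection below. *)
Lemma integral_sum_diff n (a b : 'I_n -> R) (G : R * R -> \bar R) :
  measurable_fun setT G -> (forall x, 0 <= G x)%E ->
  (forall i, a i * b i = 0) ->
  let al := \sum_i a i ^+ 2 in let be := \sum_i b i ^+ 2 in
  0 < al -> 0 < be ->
  (\int[gaussn n]_z G ((dott a z + dott b z) / Num.sqrt (al + be),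
     (Num.sqrt be / Num.sqrt al * dott a z - Num.sqrt al / Num.sqrt be * dott b z)
       / Num.sqrt (al + be))%R =
   \int[stdn]_u \int[stdn]_v G (u, v))%E.
Proof.
move=> mG G0 ab al be al0 be0.
set ra := Num.sqrt al; set rb := Num.sqrt be; set r := Num.sqrt _.
have ra0 : ra != 0 by rewrite gt_eqF// sqrtr_gt0.
have rb0 : rb != 0 by rewrite gt_eqF// sqrtr_gt0.
have r0 : r != 0 by rewrite gt_eqF// sqrtr_gt0 addr_gt0.
have cs : (ra / r) ^+ 2 + (rb / r) ^+ 2 = 1.
  rewrite 2!expr_div_n -mulrDl !sqr_sqrtr ?ltW ?addr_gt0//.
  by rewrite divff// gt_eqF// addr_gt0.
pose F (z : R * R) := G ((z.1 + z.2) / r, (rb / ra * z.1 - ra / rb * z.2) / r).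
have mF : measurable_fun setT F.
  apply: (measurableT_comp mG); apply: measurable_fun_pair.
    by apply: measurable_funM => //; exact: measurable_funD.
  by apply: measurable_funM => //; apply: measurable_funB; exact: measurable_funM.
transitivity (\int[gaussn n]_z F (dott a z, dott b z))%E; first by [].
rewrite (integral_two_forms mF (fun z => G0 _) ab).
have rar0 : ra / r != 0 by rewrite mulf_neq0// invr_eq0.
etransitivity; last exact: (integral_stdn_reflection rar0 cs mG G0).
apply: eq_integral => u _; apply: eq_integral => v _; rewrite /F /=.
rewrite -/al -/be -/ra -/rb.
by congr (G (_, _)); field; rewrite ?ra0 ?rb0 ?r0.
Qed.

End linear_forms.

(** * Operator norm and GOE norm balls *)

Section opnorm_facts.
Context {R : realType} {m : nat}.
Implicit Types (M : 'M[R]_m) (u v : 'cV[R]_m).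

Definition sqv v : R := \sum_(j < m) v j 0 ^+ 2.
Definition bil M u v : R := \sum_i \sum_j u i 0 * M i j * v j 0.

Lemma sqv_ge0 v : 0 <= sqv v.
Proof. by apply: sumr_ge0 => i _; rewrite sqr_ge0. Qed.

Lemma vnorm_ge0 v : 0 <= vnorm v. Proof. exact: sqrtr_ge0. Qed.

Lemma sqr_vnorm v : vnorm v ^+ 2 = sqv v.
Proof. by rewrite sqr_sqrtr// sqv_ge0. Qed.

Lemma sqv_scale a v : sqv (a *: v) = a ^+ 2 * sqv v.
Proof. by rewrite /sqv mulr_sumr; apply: eq_bigr => i _; rewrite !mxE exprMn. Qed.

Lemma vnorm_scale a v : vnorm (a *: v) = `|a| * vnorm v.
Proof. by rewrite /vnorm -/(sqv _) sqv_scale sqrtrM ?sqr_ge0// sqrtr_sqr. Qed.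

Lemma vnorm_eq0 v : vnorm v = 0 -> v = 0.
Proof.
move=> v0; have : sqv v = 0 by rewrite -sqr_vnorm v0 expr0n.
move=> /eqP; rewrite psumr_eq0; last by move=> i _; rewrite sqr_ge0.
move=> /allP H; apply/matrixP => i j; rewrite !mxE ord1; apply/eqP.
by rewrite -sqrf_eq0; apply: H; rewrite mem_index_enum.
Qed.

Lemma cauchy_schwarz u v : \sum_j u j 0 * v j 0 <= vnorm u * vnorm v.
Proof.
have [u0|u0] := eqVneq (vnorm u) 0.
  rewrite u0 mul0r (vnorm_eq0 u0) big1// => j _; by rewrite mxE mul0r.
have [v0|v0] := eqVneq (vnorm v) 0.
  rewrite v0 mulr0 (vnorm_eq0 v0) big1// => j _; by rewrite mxE mulr0.
have {}u0 : 0 < vnorm u by rewrite lt0r u0 vnorm_ge0.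
have {}v0 : 0 < vnorm v by rewrite lt0r v0 vnorm_ge0.
set a := vnorm u in u0 *; set b := vnorm v in v0 *.
have H : 0 <= \sum_j (b * u j 0 - a * v j 0) ^+ 2.
  by apply: sumr_ge0 => i _; rewrite sqr_ge0.
have E : \sum_j (b * u j 0 - a * v j 0) ^+ 2 =
    b ^+ 2 * sqv u + a ^+ 2 * sqv v - 2 * (a * b) * \sum_j u j 0 * v j 0.
  rewrite /sqv !mulr_sumr -big_split/= -sumrB; apply: eq_bigr => j _; ring.
move: H; rewrite E -!sqr_vnorm -/a -/b => H.
have ab : 0 < 2 * (a * b) by rewrite !mulr_gt0.
rewrite -(ler_pM2l ab); nra.
Qed.

Lemma bilE M u v : bil M u v = \sum_i u i 0 * (M *m v) i 0.
Proof.
apply: eq_bigr => i _; rewrite mxE mulr_sumr.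
by apply: eq_bigr => j _; rewrite mulrA.
Qed.

Lemma bil_le M u v : bil M u v <= vnorm u * vnorm (M *m v).
Proof. by rewrite bilE; exact: cauchy_schwarz. Qed.

Lemma bil_diag M v : bil M (M *m v) v = vnorm (M *m v) ^+ 2.
Proof. by rewrite bilE sqr_vnorm; apply: eq_bigr => i _; rewrite expr2. Qed.

Lemma coord_le v j : `|v j 0| <= vnorm v.
Proof.
rewrite -[leLHS]sqrtr_sqr ler_sqrt ?sqv_ge0// (bigD1 j)//= lerDl.
by apply: sumr_ge0 => i _; rewrite sqr_ge0.
Qed.

Lemma bil_entries M u v : bil M u v <= (\sum_i \sum_j `|M i j|) * (vnorm u * vnorm v).
Proof.
rewrite /bil mulr_suml; apply: ler_sum => i _; rewrite mulr_suml.
apply: ler_sum => j _; apply: le_trans (ler_norm _) _.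
rewrite !normrM mulrAC mulrC ler_wpM2l//.
by apply: ler_pM => //; exact: coord_le.
Qed.

Lemma vnorm_mul_entries M v : vnorm (M *m v) <= (\sum_i \sum_j `|M i j|) * vnorm v.
Proof.
have [->|n0] := eqVneq (vnorm (M *m v)) 0.
  rewrite mulr_ge0 ?vnorm_ge0//; do 2 (apply: sumr_ge0 => ? _); exact: normr_ge0.
have {}n0 : 0 < vnorm (M *m v) by rewrite lt0r n0 vnorm_ge0.
rewrite -(ler_pM2l n0) -expr2 -bil_diag mulrCA; exact: bil_entries.
Qed.

(** The crude entrywise bound makes the [sup] in [opnorm] a genuine supremum. *)
Lemma has_ubound_opnorm M :
  has_ubound [set vnorm (M *m v) | v in [set v : 'cV[R]_m | vnorm v = 1]].
Proof.
exists (\sum_i \sum_j `|M i j|) => _ [v /= v1 <-].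
by apply: le_trans (vnorm_mul_entries M v) _; rewrite v1 mulr1.
Qed.

Hypothesis m0 : (0 < m)%N.

Lemma unit_vector : exists v : 'cV[R]_m, vnorm v = 1.
Proof.
exists (\col_j (j == Ordinal m0)%:R); rewrite /vnorm (bigD1 (Ordinal m0))//= mxE eqxx.
rewrite expr1n big1 ?addr0 ?sqrtr1// => j /negbTE jn.
by rewrite mxE jn expr0n.
Qed.

(** Describes the norm ball by inequalities linear in [M], the form in which its convexity, its
    symmetry, its measurability and the union bound over a net are obtained. *)
Lemma opnorm_leP M r : 0 <= r ->
  (opnorm M <= r) <-> (forall u v, bil M u v <= r * (vnorm u * vnorm v)).
Proof.
move=> r0; split=> H.
  move=> u v; apply: le_trans (bil_le _ _ _) _.
  rewrite mulrCA ler_wpM2l ?vnorm_ge0//.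
  have [v0|v0] := eqVneq (vnorm v) 0.
    rewrite (vnorm_eq0 v0) mulmx0 -(vnorm_eq0 v0) v0.
    by rewrite mulr0.
  have vp : 0 < vnorm v by rewrite lt0r v0 vnorm_ge0.
  have : vnorm (M *m ((vnorm v)^-1 *: v)) <= r.
    apply: le_trans H; apply: ub_le_sup; first exact: has_ubound_opnorm.
    exists ((vnorm v)^-1 *: v) => //=.
    by rewrite vnorm_scale ger0_norm ?invr_ge0 ?vnorm_ge0// mulVf.
  rewrite -scalemxAr vnorm_scale ger0_norm ?invr_ge0 ?vnorm_ge0//.
  by rewrite mulrC ler_pdivrMr.
apply: ge_sup.
  by have [v v1] := unit_vector; exists (vnorm (M *m v)); exists v.
move=> _ [v /= v1 <-].
have [->//|n0] := eqVneq (vnorm (M *m v)) 0.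
have {}n0 : 0 < vnorm (M *m v) by rewrite lt0r n0 vnorm_ge0.
(* Testing with $u = Mv$ gives $|Mv|^2 \le r|Mv|$. *)
rewrite -(ler_pM2l n0) -expr2 -bil_diag mulrC -[X in _ <= _ * X]mulr1 -v1; exact: H.
Qed.

Lemma opnorm_ge0 M : 0 <= opnorm M.
Proof.
have [v v1] := unit_vector; apply: (@le_trans _ _ (vnorm (M *m v))).
  exact: vnorm_ge0.
by apply: ub_le_sup; [exact: has_ubound_opnorm|exists v].
Qed.

Lemma opnorm_scale_le M c r : 0 < c -> 0 <= r ->
  (opnorm (c *: M) <= c * r) <-> (opnorm M <= r).
Proof.
move=> c0 r0; have cr0 : 0 <= c * r by rewrite mulr_ge0// ltW.
have E u v : bil (c *: M) u v = c * bil M u v.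
  rewrite /bil mulr_sumr; apply: eq_bigr => i _; rewrite mulr_sumr.
  by apply: eq_bigr => j _; rewrite mxE; ring.
split=> /opnorm_leP H; apply/opnorm_leP => // u v.
  by rewrite -(ler_pM2l c0) -E mulrA; exact: H.
by rewrite E -mulrA ler_wpM2l ?(ltW c0)//; exact: H.
Qed.

(** Each column is the image of a unit vector, so its length is at most $r$. This bounds the
    Gaussian weight on the norm ball. *)
Lemma sum_sqr_entries_le M r : 0 <= r -> opnorm M <= r ->
  \sum_i \sum_j M i j ^+ 2 <= m%:R * r ^+ 2.
Proof.
move=> r0 Mr; rewrite exchange_big/=.
apply: (@le_trans _ _ (\sum_(j < m) r ^+ 2)); last first.
  by rewrite sumr_const card_ord mulr_natl.
apply: ler_sum => j _; pose v : 'cV[R]_m := \col_k (k == j)%:R.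
have v1 : vnorm v = 1.
  rewrite /vnorm (bigD1 j)//= mxE eqxx expr1n big1 ?addr0 ?sqrtr1// => k /negbTE kj.
  by rewrite mxE kj expr0n.
have -> : \sum_i M i j ^+ 2 = vnorm (M *m v) ^+ 2.
  rewrite sqr_vnorm; apply: eq_bigr => i _; congr (_ ^+ 2).
  rewrite mxE (bigD1 j)//= mxE eqxx mulr1 big1 ?addr0// => k /negbTE kj.
  by rewrite mxE kj mulr0.
rewrite !expr2; apply: ler_pM; rewrite ?vnorm_ge0//.
  apply: le_trans Mr; apply: ub_le_sup; first exact: has_ubound_opnorm.
  by exists v.
apply: le_trans Mr; apply: ub_le_sup; first exact: has_ubound_opnorm.
by exists v.
Qed.

Lemma opnorm_le_sum_entry M r i j : 0 <= r -> opnorm M <= r -> `|M i j| <= r.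
Proof.
move=> r0 /opnorm_leP - /(_ r0) H.
pose e k : 'cV[R]_m := \col_l (l == k)%:R.
have e1 k : vnorm (e k) = 1.
  rewrite /vnorm (bigD1 k)//= mxE eqxx expr1n big1 ?addr0 ?sqrtr1// => l /negbTE lk.
  by rewrite mxE lk expr0n.
have E (s : R) : bil M (s *: e i) (e j) = s * M i j.
  rewrite /bil (bigD1 i)//= [X in _ + X]big1 ?addr0; last first.
    move=> k /negbTE ki; rewrite big1// => l _.
    by rewrite !mxE ki mulr0 !mul0r.
  rewrite (bigD1 j)//= big1 ?addr0; last first.
    by move=> l /negbTE lj; rewrite !mxE lj mulr0.
  by rewrite !mxE !eqxx !mulr1.
rewrite ler_norml -[_ <= M i j]lerN2 opprK -[- M i j]mulN1r -[X in _ && (X <= _)]mul1r.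
by rewrite -!E; apply/andP; split; apply: le_trans (H _ _) _;
  rewrite vnorm_scale !e1 ?normrN1 ?normr1 !mulr1.
Qed.

(* A bilinear form is affine in each coordinate, so rounding each coordinate
   in the direction of its coefficient does not decrease it. *)
Lemma bil_round M u v : exists w : 'cV[int]_m,
  (forall j, `| (w j 0)%:~R - u j 0 | <= 1 :> R) /\
  bil M u v <= bil M (map_mx intr w) v.
Proof.
exists (\col_j (if 0 <= (M *m v) j 0 then Num.floor (u j 0) + 1 else Num.floor (u j 0))).
split.
  move=> j; rewrite mxE; have /andP[f1 f2] := floor_itv (u j 0).
  by case: ifP => _; rewrite ler_norml ?intrD; apply/andP; split;
    move: f1 f2; rewrite ?intrD; lra.
rewrite !bilE; apply: ler_sum => j _; rewrite !mxE -[\sum_(_ < _) _]/(_).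
have /andP[f1 f2] := floor_itv (u j 0).
have -> : \sum_j0 M j j0 * v j0 0 = (M *m v) j 0 by rewrite mxE.
case: ifP => [y0|/negbT]; last rewrite -ltNge => y0.
  by rewrite ler_wpM2r// ltW.
by rewrite ler_wnM2r// ltW.
Qed.

Lemma bil_tr M u v : bil M u v = bil M^T v u.
Proof.
rewrite /bil exchange_big/=; apply: eq_bigr => i _; apply: eq_bigr => j _.
by rewrite mxE; ring.
Qed.

Lemma bil_round2 M u v : exists w z : 'cV[int]_m,
  [/\ forall j, `| (w j 0)%:~R - u j 0 | <= 1 :> R,
      forall j, `| (z j 0)%:~R - v j 0 | <= 1 :> R &
      bil M u v <= bil M (map_mx intr w) (map_mx intr z)].
Proof.
have [w [wu H1]] := bil_round M u v.
have [z [zv H2]] := bil_round M^T v (map_mx intr w).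
exists w, z; split => //; apply: le_trans H1 _.
by rewrite bil_tr [leRHS]bil_tr.
Qed.

Lemma vnorm_add u v : vnorm (u + v) <= vnorm u + vnorm v.
Proof.
rewrite -(@ler_pXn2r _ 2)// ?nnegrE ?addr_ge0 ?vnorm_ge0// sqr_vnorm.
have -> : sqv (u + v) = sqv u + sqv v + 2 * \sum_j u j 0 * v j 0.
  rewrite /sqv mulr_sumr -!big_split/=; apply: eq_bigr => j _; rewrite mxE; ring.
rewrite -!sqr_vnorm; have := cauchy_schwarz u v; nra.
Qed.

Lemma vnorm_round u (w : 'cV[int]_m) :
  (forall j, `| (w j 0)%:~R - u j 0 | <= 1) ->
  vnorm (map_mx intr w) <= vnorm u + Num.sqrt m%:R.
Proof.
move=> wu; rewrite -[map_mx intr w](subrK u) addrC.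
apply: le_trans (vnorm_add _ _) _; rewrite lerD2l ler_sqrt//.
apply: (@le_trans _ _ (\sum_(j < m) 1)); last by rewrite sumr_const card_ord.
apply: ler_sum => j _; rewrite !mxE -real_normK ?num_real// expr_le1//.
Qed.

End opnorm_facts.

(** * Symmetric matrices as tuples of their upper entries *)

Section sym_matrix.
Context {R : realType} {m : nat}.

Definition upper := {x : 'I_m * 'I_m | (x.1 <= x.2)%N}.

Definition upper_of (p : 'I_m * 'I_m) : upper :=
  insubd (exist (fun x : 'I_m * 'I_m => (x.1 <= x.2)%N) (p.1, p.1) (leqnn _))
    (if (p.1 <= p.2)%N then p else (p.2, p.1)).

Lemma val_upper_of p : val (upper_of p) = if (p.1 <= p.2)%N then p else (p.2, p.1).
Proof.
rewrite val_insubd; case: ifP => //; case: (leqP p.1 p.2) => [->//|/ltnW].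
by move=> /= ->.
Qed.

Lemma upper_of_val (e : upper) : upper_of (val e) = e.
Proof. by apply: val_inj; rewrite val_upper_of (valP e). Qed.

Lemma upper_of_swap j k : upper_of (j, k) = upper_of (k, j).
Proof.
apply: val_inj; rewrite !val_upper_of /=.
by case: ltngtP => // /val_inj ->.
Qed.

Lemma sum_fiber (V : zmodType) (F : 'I_m * 'I_m -> V) (e : upper) :
  \sum_(p | upper_of p == e) F p =
  if (val e).1 == (val e).2 then F (val e)
  else F (val e) + F ((val e).2, (val e).1).
Proof.
rewrite (bigD1 (val e))/= ?upper_of_val//; case: eqP => [E|/eqP E].
  rewrite big1 ?addr0// => p /andP[/eqP pe /eqP pne]; exfalso; apply: pne.
  move: E; rewrite -pe val_upper_of; case: p {pe} => a b /=.
  by case: ifP => // _ /= ->.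
rewrite (bigD1 ((val e).2, (val e).1))/=; last first.
  rewrite upper_of_swap -surjective_pairing upper_of_val eqxx/=.
  by apply: contra E => /eqP/(congr1 snd)/= ->.
rewrite big1 ?addr0// => p /andP[/andP[/eqP pe p1 /eqP p2]].
exfalso; move: p1 p2; rewrite -pe val_upper_of; case: p {pe} => a b /=.
by case: ifP => //= _; rewrite eqxx.
Qed.

(** The fibers of [upper_of] have one or two elements. Below, these bounds stand in for the exact
    value $m(m+1)/2$. *)
Lemma upper_size : (#|{: upper}| <= m ^ 2)%N /\ (m ^ 2 <= 2 * #|{: upper}|)%N.
Proof.
have -> : (m ^ 2 = #|{: 'I_m * 'I_m}|)%N by rewrite card_prod card_ord.
split; first by rewrite card_sig; apply: max_card.
rewrite -sum1_card (partition_big upper_of predT)//=.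
rewrite -[X in (_ <= 2 * X)%N]sum1_card big_distrr/=; apply: leq_sum => e _.
rewrite sum1_card muln1.
apply: (@leq_trans #|pred2 (val e) ((val e).2, (val e).1)|).
  apply: subset_leq_card; apply/fintype.subsetP => p pe.
  have {pe}/eqP <- : upper_of p == e by exact: pe.
  rewrite inE.
  rewrite val_upper_of; case: p => a b /=.
  by case: ifP => _ /=; rewrite eqxx ?orbT.
by rewrite card2; case: eqP.
Qed.

Local Notation N := #|{: upper}|.

Lemma sum_upper (F : 'I_m * 'I_m -> R) :
  \sum_j \sum_k F (j, k) = \sum_(i < N) \sum_(p | upper_of p == enum_val i) F p.
Proof.
rewrite pair_big/= (partition_big upper_of predT)//=.
rewrite (reindex (@enum_val _ (mem {: upper})))/=; last first.
  by apply: onW_bij; apply: enum_val_bij.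
by apply: eq_bigr => i _; apply: eq_bigr => p _; rewrite -surjective_pairing.
Qed.

Definition sdev (j k : 'I_m) : R := if j == k then Num.sqrt 2 else 1.

(** Under the Gaussian measure on tuples this is a GOE matrix; [sdev] supplies the factor $\sqrt2$
    on the diagonal. *)
Definition mat (t : N.-tuple R) : 'M[R]_m :=
  \matrix_(j, k) (sdev j k * tnth t (enum_rank (upper_of (j, k)))).

Definition ball_op (r : R) : set (N.-tuple R) := [set t | opnorm (mat t) <= r].

Lemma mat_scale s t : mat (scalet s t) = s *: mat t.
Proof. by apply/matrixP => j k; rewrite !mxE tnth_mktuple mulrCA. Qed.

Lemma mat_add t u : mat (addt t u) = mat t + mat u.
Proof. by apply/matrixP => j k; rewrite !mxE tnth_mktuple mulrDr. Qed.

Lemma bil_scale (M : 'M[R]_m) s u v : bil (s *: M) u v = s * bil M u v.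
Proof.
rewrite /bil mulr_sumr; apply: eq_bigr => i _; rewrite mulr_sumr.
by apply: eq_bigr => j _; rewrite mxE; ring.
Qed.

Lemma bil_add (M M' : 'M[R]_m) u v : bil (M + M') u v = bil M u v + bil M' u v.
Proof.
rewrite /bil -big_split; apply: eq_bigr => i _ /=; rewrite -big_split.
by apply: eq_bigr => j _; rewrite mxE /=; ring.
Qed.

Lemma bil_scale_vec (M : 'M[R]_m) a b u v :
  bil M (a *: u) (b *: v) = a * b * bil M u v.
Proof.
rewrite /bil mulr_sumr; apply: eq_bigr => i _; rewrite mulr_sumr.
by apply: eq_bigr => j _; rewrite !mxE; ring.
Qed.

Definition coef (u v : 'cV[R]_m) (i : 'I_N) : R :=
  \sum_(p | upper_of p == enum_val i) u p.1 0 * sdev p.1 p.2 * v p.2 0.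

Lemma bil_mat u v t : bil (mat t) u v = dott (coef u v) t.
Proof.
rewrite /bil (sum_upper (fun p => u p.1 0 * mat t p.1 p.2 * v p.2 0)).
apply: eq_bigr => i _; rewrite /coef mulr_suml; apply: eq_bigr => p /eqP pi.
by rewrite mxE -surjective_pairing pi enum_valK; ring.
Qed.

(** The left side is the variance of $u^TXv$. A diagonal position contributes $2u_j^2v_j^2$, an
    off-diagonal one $(u_jv_k + u_kv_j)^2 \le 2(u_j^2v_k^2 + u_k^2v_j^2)$. *)
Lemma sum_sqr_coef u v : \sum_i coef u v i ^+ 2 <= 2 * (sqv u * sqv v).
Proof.
have -> : 2 * (sqv u * sqv v) =
    \sum_(i < N) \sum_(p | upper_of p == enum_val i) 2 * (u p.1 0 ^+ 2 * v p.2 0 ^+ 2).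
  rewrite -(sum_upper (fun p => 2 * (u p.1 0 ^+ 2 * v p.2 0 ^+ 2)))/=.
  rewrite /sqv mulr_suml mulr_sumr; apply: eq_bigr => j _.
  by rewrite !mulr_sumr.
apply: ler_sum => i _; rewrite /coef !sum_fiber /sdev.
case: eqP => [E|/eqP E] /=.
  by rewrite !exprMn sqr_sqrtr//; nra.
rewrite [_ == (val _).1]eq_sym (negbTE E).
set a := u _ _; set b := v _ _; set c := u _ _; set d := v _ _.
have := sqr_ge0 (a * b - c * d); nra.
Qed.

(** An off-diagonal coordinate occurs twice in the matrix and a diagonal one carries the factor
    $\sqrt2$, so each coordinate counts as $2t_i^2$. *)
Lemma sqt_le_sum_sqr t : 2 * sqt t <= \sum_i \sum_j mat t i j ^+ 2.
Proof.
rewrite (sum_upper (fun p => mat t p.1 p.2 ^+ 2)).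
rewrite /sqt mulr_sumr; apply: ler_sum => i _; rewrite sum_fiber.
have E : enum_rank (upper_of (val (enum_val i))) = i.
  by rewrite upper_of_val enum_valK.
rewrite !mxE /sdev [in X in _ <= if _ then _ else _ + X]upper_of_swap.
rewrite -surjective_pairing E.
case: eqP => [//|/eqP ne]; first by rewrite exprMn sqr_sqrtr.
rewrite [_ == (val _).1]eq_sym (negbTE ne) !mul1r; lra.
Qed.

Hypothesis m0 : (0 < m)%N.

Lemma sqt_ball r t : 0 <= r -> ball_op r t -> 2 * sqt t <= m%:R * r ^+ 2.
Proof.
move=> r0 tr; apply: le_trans (sqt_le_sum_sqr t) _.
exact: sum_sqr_entries_le.
Qed.

Lemma ball_scale s r t : 0 < s -> 0 <= r ->
  ball_op (s * r) (scalet s t) <-> ball_op r t.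
Proof. by move=> s0 r0; rewrite /ball_op /= mat_scale; exact: opnorm_scale_le. Qed.

Lemma ball_opp r t : 0 <= r -> ball_op r t -> ball_op r (scalet (-1) t).
Proof.
move=> r0 /(opnorm_leP m0 _ r0) H; apply/(opnorm_leP m0 _ r0) => u v.
rewrite mat_scale bil_scale -[-1 * _]mulr1 mulrAC.
have := H (-1 *: u) (1 *: v); rewrite bil_scale_vec !vnorm_scale normrN1 normr1 !mul1r.
by rewrite mulr1.
Qed.

Lemma ball_mid r x y : 0 <= r -> ball_op r x -> ball_op r y -> ball_op r (midt x y).
Proof.
move=> r0 /(opnorm_leP m0 _ r0) Hx /(opnorm_leP m0 _ r0) Hy.
apply/(opnorm_leP m0 _ r0) => u v.
rewrite /midt mat_scale mat_add bil_scale bil_add.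
by have := Hx u v; have := Hy u v; lra.
Qed.

Lemma ball_le r r' : r <= r' -> ball_op r `<=` ball_op r'.
Proof. by move=> rr t /le_trans; apply. Qed.

(** If a pair of vectors violates the bound, scaling it by $L$ enlarges the violation like $L^2$,
    whereas rounding costs only $O(L)$. Integer test vectors make the ball a countable
    intersection. *)
Lemma opnorm_le_int (M : 'M[R]_m) r : 0 <= r ->
  (opnorm M <= r) <-> (forall w z : 'cV[int]_m,
    bil M (map_mx intr w) (map_mx intr z) <=
    r * (vnorm (map_mx intr w : 'cV[R]_m) * vnorm (map_mx intr z : 'cV[R]_m))).
Proof.
move=> r0; split=> [/(opnorm_leP m0 _ r0) H w z|H]; first exact: H.
apply/(opnorm_leP m0 _ r0) => u v; rewrite leNgt; apply/negP => bad.
set a := vnorm u in bad *; set b := vnorm v in bad *; pose c : R := Num.sqrt m%:R.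
have a0 : 0 <= a by exact: vnorm_ge0.
have b0 : 0 <= b by exact: vnorm_ge0.
have c0 : 0 <= c by exact: sqrtr_ge0.
pose D := r * ((a + b) * c + c ^+ 2).
pose gap := bil M u v - r * (a * b).
have gap0 : 0 < gap by rewrite subr_gt0.
(* For $L \ge 1$ one has $r(La+c)(Lb+c) \le L^2rab + LD$, and $L^2\cdot$[gap] exceeds $LD$ by the
   choice of [L]. *)
pose L : R := (Num.truncn (D / gap)).+1%:R.
have L1 : 1 <= L by rewrite ler1n.
have LD : D < L * gap by rewrite -ltr_pdivrMr//; exact: truncnS_gt.
have [w [z [wu zv le1]]] := bil_round2 M (L *: u) (L *: v).
have := le_trans le1 (H w z); rewrite bil_scale_vec.
have nw := vnorm_round wu; have nz := vnorm_round zv.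
rewrite vnorm_scale ger0_norm ?(le_trans ler01)// -/a -/c in nw.
rewrite vnorm_scale ger0_norm ?(le_trans ler01)// -/b -/c in nz.
have wz : vnorm (map_mx intr w : 'cV[R]_m) * vnorm (map_mx intr z : 'cV[R]_m)
    <= (L * a + c) * (L * b + c).
  by apply: ler_pM => //; exact: vnorm_ge0.
move=> /le_trans /(_ (ler_wpM2l r0 wz)).
have -> : bil M u v = gap + r * (a * b) by rewrite subrK.
apply/negP; rewrite -ltNge.
have : r * ((L * a + c) * (L * b + c)) <= L * D + L * L * (r * (a * b)).
  have : 0 <= (L - 1) * (r * c ^+ 2) by rewrite mulr_ge0 ?subr_ge0// mulr_ge0// sqr_ge0.
  rewrite /D; nra.
by move=> /le_lt_trans; apply; rewrite mulrDr ltrD2r -mulrA ltr_pM2l.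
Qed.

Lemma measurable_ball r : 0 <= r -> measurable (ball_op r).
Proof.
move=> r0; pose f (n : nat) : 'cV[int]_m * 'cV[int]_m := odflt (0, 0) (unpickle n).
rewrite (_ : ball_op r = \bigcap_n [set t | bil (mat t) (map_mx intr (f n).1) (map_mx intr (f n).2) <=
    r * (vnorm (map_mx intr (f n).1 : 'cV[R]_m) * vnorm (map_mx intr (f n).2 : 'cV[R]_m))]).
  apply: bigcapT_measurable => n; set W := map_mx _ _; set Z := map_mx _ _.
  have mb : measurable_fun setT (fun t : N.-tuple R =>
      bil (mat t) W Z <= r * (vnorm W * vnorm Z)).
    rewrite (_ : (fun t => _) = fun t => dott (coef W Z) t <= r * (vnorm W * vnorm Z)).
      by apply: measurable_fun_ler => //; exact: measurable_dott.
    by apply/funext => t; rewrite bil_mat.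
  by rewrite -[X in measurable X]setTI; exact: (mb measurableT [set true]).
apply/seteqP; split => t /=.
  by move=> /(opnorm_le_int _ r0) H n _; exact: H.
move=> H; apply/(opnorm_le_int _ r0) => w z.
by have := H (pickle (w, z)) I; rewrite /= /f pickleK.
Qed.

End sym_matrix.

(** * Small-ball estimates *)

Section gaussian_tail.
Context {R : realType}.

Lemma mgf_stdn (t : R) : (\int[stdn]_u (expR (t * u))%:E = (expR (t ^+ 2 / 2))%:E)%E.
Proof.
have me : measurable_fun setT (fun u : R => (expR (t * u))%:E).
  by apply/measurable_EFinP; apply: measurableT_comp => //; exact: measurable_funM.
rewrite integral_stdn//.
have mp : measurable_fun setT (fun u : R => (phi u)%:E).
  by apply/measurable_EFinP; exact: measurable_phi.
have := @ge0_integral_affine R 1 (- t) (fun u => (phi u)%:E) (oner_neq0 _) mp.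
move=> /(_ (fun u => (phi_ge0 u : (0 <= (phi u)%:E)%E))).
rewrite normr1 mul1e; have -> : (\int[lebesgue_measure]_u (phi u)%:E = 1 :> \bar R)%E.
  by rewrite -stdnE probability_setT.
move=> E; transitivity ((expR (t ^+ 2 / 2))%:E *
    \int[lebesgue_measure]_u (phi (1 * u - t))%:E)%E; last by rewrite -E mule1.
rewrite -ge0_integralZl_EFin ?expR_ge0//.
- apply: eq_integral => u _; rewrite -!EFinM; congr _%:E.
  rewrite /phi mulrCA [RHS]mulrCA -!expRD; congr (_ * expR _).
  by rewrite mul1r; field.
- by move=> u _; rewrite lee_fin phi_ge0.
- apply/measurable_EFinP; apply: measurableT_comp; first exact: measurable_phi.
  by apply: measurable_funB => //; exact: measurable_funM.
Qed.

(** Chernoff's bound with parameter $s/S$, optimal for variance $S$; the law of the form is read off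
    [integral_two_forms] with a zero second form. *)
Lemma gaussn_tail n (a : 'I_n -> R) (s S : R) : 0 < S -> 0 <= s ->
  \sum_i a i ^+ 2 <= S ->
  (gaussn n [set z | (s < dott a z)%R] <= (expR (- (s ^+ 2 / (2 * S))))%:E)%E.
Proof.
move=> S0 s0 aS; pose l := s / S.
have l0 : 0 <= l by rewrite divr_ge0// ltW.
pose F (z : R * R) := (expR (l * (z.1 - s)))%:E.
have mF : measurable_fun setT F.
  apply/measurable_EFinP; apply: measurableT_comp => //.
  by apply: measurable_funM => //; exact: measurable_funB.
have F0 z : (0 <= F z)%E by rewrite lee_fin expR_ge0.
have mA : measurable [set z : n.-tuple R | s < dott a z].
  have mb : measurable_fun setT (fun z : n.-tuple R => s < dott a z).
    by apply: measurable_fun_ltr => //; exact: measurable_dott.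
  by rewrite -[X in measurable X]setTI; exact: (mb measurableT [set true]).
pose b : 'I_n -> R := fun=> 0.
have ab i : a i * b i = 0 by rewrite mulr0.
suff H : (gaussn n [set z | (s < dott a z)%R] <=
    \int[gaussn n]_z F (dott a z, dott b z))%E.
  apply: (le_trans H).
  rewrite (integral_two_forms mF F0 ab).
  set A := \sum_(i < n) a i ^+ 2 in aS *.
  have A0 : 0 <= A by apply: sumr_ge0 => i _; rewrite sqr_ge0.
  have -> : (\int[stdn]_u \int[stdn]_v
      F (Num.sqrt A * u, Num.sqrt (\sum_(i < n) b i ^+ 2) * v)%R =
      \int[stdn]_u ((expR (- (l * s)))%:E * (expR (l * Num.sqrt A * u))%:E))%E.
    apply: eq_integral => u _.
    transitivity (\int[@stdn R]_v (cst (F ((Num.sqrt A * u)%R, 0%R)) v))%E; first by [].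
    rewrite integral_cst// [X in (_ * X)%E]probability_setT mule1 -EFinM -expRD.
    by congr (expR _)%:E => /=; ring.
  have me : measurable_fun setT (fun u : R => (expR (l * Num.sqrt A * u))%:E).
    by apply/measurable_EFinP; apply: measurableT_comp => //; exact: measurable_funM.
  rewrite ge0_integralZl_EFin ?expR_ge0//.
  rewrite mgf_stdn -EFinM -expRD lee_fin ler_expR exprMn sqr_sqrtr// /l.
  have -> : - (s ^+ 2 / (2 * S)) = - (s / S * s) + (s / S) ^+ 2 * S / 2.
    by field; rewrite gt_eqF.
  by rewrite lerD2l ler_pM2r ?invr_gt0// ler_wpM2l// sqr_ge0.
have <- : (\int[gaussn n]_z (\1_[set z | (s < dott a z)%R] z)%:E =
    gaussn n [set z | (s < dott a z)%R])%E.
  by rewrite integral_indic// setIT.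
apply: ge0_le_integral => //.
- exact/measurable_EFinP/measurable_indic.
- apply: (measurableT_comp mF); apply: measurable_fun_pair; exact: measurable_dott.
move=> z _; rewrite lee_fin indicE; case: (boolP (z \in _)) => [|_]; last exact: expR_ge0.
rewrite inE /= => sz; rewrite -[leLHS]expR0 ler_expR mulr_ge0// subr_ge0.
exact: ltW.
Qed.

Lemma mu_bigU_le d (T : measurableType d) (mu : {measure set T -> \bar R})
    (I : Type) (s : seq I) (Q : pred I) (B : I -> set T) :
  (forall i, measurable (B i)) ->
  (mu (\big[setU/set0]_(i <- s | Q i) B i) <= \sum_(i <- s | Q i) mu (B i))%E.
Proof.
move=> mB; elim: s => [|i s IH]; first by rewrite !big_nil measure0.
rewrite !big_cons; case: ifP => _ //; apply: le_trans (measureU2 _ _ _) _ => //.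
  exact: bigsetU_measurable.
by rewrite leeD2l.
Qed.

End gaussian_tail.

(** * Lattice points in a ball of radius $2\sqrt m$ *)

Section lattice_count.
Context {R : realType}.

Lemma expR_half (k : nat) : expR (- (k%:R ^+ 2)) <= 2^-1 ^+ k :> R.
Proof.
apply: (@le_trans _ _ (expR (- k%:R))).
  rewrite ler_expR lerN2 expr2; case: k => [|k]; first by rewrite mul0r.
  by rewrite ler_peMl// ler1n.
rewrite expRN -[k%:R]mulr1 expRM_natl exprVn lef_pV2 ?posrE ?exprn_gt0 ?expR_gt0//.
rewrite lerXn2r ?nnegrE ?expR_ge0//.
by apply: le_trans (expR_ge1Dx 1); lra.
Qed.

(** What matters is the bound $3$, uniform in [B]. The subtracted term carries the induction: the
    two new summands add up to at most $2^{-B}$, exactly the growth of the right side. *)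
Lemma sum_expR_sqr (B : nat) :
  \sum_(k < B.*2.+1) expR (- (k%:R - B%:R) ^+ 2) <= 3 - 2 * 2^-1 ^+ B :> R.
Proof.
elim: B => [|B IH].
  by rewrite big_ord_recl big_ord0 /= subrr expr0n/= oppr0 expR0; lra.
rewrite doubleS big_ord_recl big_ord_recr/=.
have -> : \sum_(i < B.*2.+1) expR (- ((bump 0 i)%:R - B.+1%:R) ^+ 2) =
          \sum_(k < B.*2.+1) expR (- (k%:R - B%:R) ^+ 2) :> R.
  apply: eq_bigr => i _; congr (expR (- (_ ^+ 2))).
  by rewrite /bump leq0n add1n -!natr1; ring.
have -> : (0%:R - B.+1%:R) ^+ 2 = B.+1%:R ^+ 2 :> R by rewrite sub0r sqrrN.
have -> : ((bump 0 B.*2.+1)%:R - B.+1%:R) ^+ 2 = B.+1%:R ^+ 2 :> R.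
  by rewrite /bump leq0n add1n -addnn -!natr1 natrD; ring.
have := expR_half B.+1; rewrite !exprS; lra.
Qed.

End lattice_count.

Section net.
Context {R : realType} (m : nat).

(* Integer vectors with entries in [[-2m, 2m]], which contain the roundings of the
   vectors of length [sqrt m]. *)
Definition lat : finType := {ffun 'I_m -> 'I_(m.*2.*2.+1)}.

Definition latv (a : lat) : 'cV[int]_m := \col_j ((a j)%:Z - (m.*2)%:Z).
Definition latR (a : lat) : 'cV[R]_m := map_mx intr (latv a).

Lemma latv_onto (w : 'cV[int]_m) : (forall j, `|w j 0| <= (m.*2)%:Z) ->
  exists a, latv a = w.
Proof.
move=> wm; exists [ffun j => inord `|(w j 0%R + (m.*2)%:Z)%R|%N].
apply/matrixP => i j; rewrite !mxE ffunE ord1.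
have := wm i; rewrite ler_norml => /andP[w1 w2].
have w0 : 0 <= w i 0 + (m.*2)%:Z by lia.
rewrite inordK; last by lia.
by rewrite gez0_abs// addrK.
Qed.

(** The indicator is at most $\exp(4m - |a|^2)$, whose sum over the lattice factorizes; each
    coordinate gives at most $3 \le e^2$, whence $6 = 4 + 2$. *)
Lemma lat_count :
  \sum_(a : lat | sqv (latR a) <= 4 * m%:R) 1 <= expR (6 * m%:R) :> R.
Proof.
apply: (@le_trans _ _ (\sum_(a : lat) expR (4 * m%:R - sqv (latR a)))).
  rewrite [leRHS](bigID (fun a => sqv (latR a) <= 4 * m%:R))/=.
  rewrite -[leLHS]addr0; apply: lerD.
    by apply: ler_sum => a am; rewrite -[leLHS]expR0 ler_expR subr_ge0.
  by apply: sumr_ge0 => a _; exact: expR_ge0.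
have E (a : lat) : expR (4 * m%:R - sqv (latR a)) =
    expR (4 * m%:R) * \prod_j expR (- ((a j)%:R - (m.*2)%:R) ^+ 2) :> R.
  rewrite expRD -expR_sum sumrN; congr (_ * expR (- _)).
  by apply: eq_bigr => j _; rewrite !mxE intrD intrN.
under eq_bigr do rewrite E.
rewrite -mulr_sumr -(bigA_distr_bigA (fun _ (k : 'I_(m.*2.*2.+1)) =>
  expR (- (k%:R - (m.*2)%:R) ^+ 2) : R))/=.
have -> : 6 * m%:R = 4 * m%:R + 2 * m%:R :> R by ring.
rewrite expRD ler_wpM2l ?expR_ge0//.
rewrite prodr_const card_ord mulrC expRM_natl lerXn2r ?nnegrE ?expR_ge0//.
  by apply: sumr_ge0 => k _; exact: expR_ge0.
apply: le_trans (sum_expR_sqr (R := R) m.*2) _.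
apply: le_trans (expR_ge1Dx 2).
rewrite lerBlDr -[leLHS]addr0 lerD ?mulr_ge0 ?exprn_ge0//; lra.
Qed.

End net.

Section ball_prob.
Context {R : realType} (m : nat).
Hypothesis m0 : (0 < m)%N.
Local Notation N := #|{: @upper m}|.

Let mR0 : 0 < m%:R :> R. Proof. by rewrite ltr0n. Qed.

(** Two violating vectors are normalized to length $\sqrt m$. Rounding moves each by at most $\sqrt
    m$, so lengths stay below $2\sqrt m$, and does not decrease the form, hence the threshold
    $mr$. *)
Lemma not_ball_op (r : R) (t : N.-tuple R) : 0 <= r -> ~ ball_op r t ->
  exists a b : lat m, [/\ sqv (latR a : 'cV[R]_m) <= 4 * m%:R,
    sqv (latR b : 'cV[R]_m) <= 4 * m%:R & m%:R * r < dott (coef (latR a) (latR b)) t].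
Proof.
move=> r0 nb.
have [u [v uv]] : exists u v, r * (vnorm u * vnorm v) < bil (mat t) u v.
  apply: contrapT => H; apply: nb; apply/(opnorm_leP m0 _ r0) => u v.
  by rewrite leNgt; apply/negP => bad; apply: H; exists u, v.
have nz (x : 'cV[R]_m) : vnorm x != 0 -> 0 < vnorm x by rewrite lt0r vnorm_ge0 => ->.
have u0 : 0 < vnorm u.
  apply: nz; apply/eqP => u0; move: uv; rewrite u0 mul0r mulr0 (vnorm_eq0 u0).
  rewrite /bil big1 ?ltxx// => i _; rewrite big1// => j _.
  by rewrite mxE !mul0r.
have v0 : 0 < vnorm v.
  apply: nz; apply/eqP => v0; move: uv; rewrite v0 !mulr0 (vnorm_eq0 v0).
  rewrite /bil big1 ?ltxx// => i _; rewrite big1// => j _.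
  by rewrite [X in _ * X]mxE mulr0.
pose c : R := Num.sqrt m%:R.
have c0 : 0 < c by rewrite sqrtr_gt0.
have cc : c * c = m%:R by rewrite -expr2 sqr_sqrtr// ltW.
pose u' := (c / vnorm u) *: u; pose v' := (c / vnorm v) *: v.
have nu' : vnorm u' = c.
  by rewrite vnorm_scale ger0_norm ?divr_ge0 ?ltW// divfK// gt_eqF.
have nv' : vnorm v' = c.
  by rewrite vnorm_scale ger0_norm ?divr_ge0 ?ltW// divfK// gt_eqF.
have uv' : m%:R * r < bil (mat t) u' v'.
  rewrite bil_scale_vec mulrACA cc -invfM -mulrA ltr_pM2l//.
  by rewrite mulrC ltr_pdivlMr// mulr_gt0.
have [w [z [wu zv le1]]] := bil_round2 (mat t) u' v'.
have c1 : 1 <= c by rewrite -[1]sqrtr1 ler_sqrt ?ler1n.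
have cm : c <= m%:R by rewrite -cc ler_peMl// ltW.
have bound (x : 'cV[R]_m) (y : 'cV[int]_m) : vnorm x = c ->
    (forall j, `|(y j 0)%:~R - x j 0| <= 1) ->
    exists2 a : lat m, latv a = y & sqv (latR a : 'cV[R]_m) <= 4 * m%:R.
  move=> xc yx; have nw := vnorm_round yx; rewrite xc -/c in nw.
  have [j|a ay] := @latv_onto m y.
    rewrite -(@ler_int R) intr_norm.
    apply: le_trans (_ : `|(map_mx intr y : 'cV[R]_m) j 0| <= _).
      by rewrite mxE.
    apply: le_trans (coord_le _ _) _; apply: le_trans nw _.
    by rewrite -addnn PoszD intrD lerD.
  exists a => //; rewrite /latR ay -sqr_vnorm -cc.
  have := vnorm_ge0 (map_mx intr y : 'cV[R]_m); nra.
have [a aw sa] := bound _ _ nu' wu; have [b bz sb] := bound _ _ nv' zv.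
exists a, b; split => //; rewrite -bil_mat /latR aw bz.
exact: lt_le_trans uv' le1.
Qed.

(** Union bound over at most $e^{12m}$ pairs of lattice vectors. Each form has variance at most
    $32m^2$ and would have to exceed $32m^{3/2}$, which has probability at most $e^{-16m}$; the
    constant $32$ secures $16 > 12$. *)
Lemma gaussn_ball_half : ((2^-1)%:E <= gaussn N (ball_op (32 * Num.sqrt m%:R : R)%R))%E.
Proof.
pose r : R := 32 * Num.sqrt m%:R.
have r0 : 0 <= r by rewrite mulr_ge0// sqrtr_ge0.
have mB := @measurable_ball R m m0 r r0.
pose Q (p : lat m * lat m) := (sqv (latR p.1 : 'cV[R]_m) <= 4 * m%:R) &&
   (sqv (latR p.2 : 'cV[R]_m) <= 4 * m%:R).
pose C (p : lat m * lat m) : set (N.-tuple R) :=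
  [set t | m%:R * r < dott (coef (latR p.1) (latR p.2)) t].
have mC p : measurable (C p).
  have mb : measurable_fun setT (fun z : N.-tuple R =>
      m%:R * r < dott (coef (latR p.1) (latR p.2)) z).
    by apply: measurable_fun_ltr => //; exact: measurable_dott.
  by rewrite -[X in measurable X]setTI; exact: (mb measurableT [set true]).
suff H : (gaussn N (~` ball_op r) <= (2^-1)%:E)%E.
  move: H; rewrite probability_setC// leeBlDr; last exact: fin_num_measure.
  rewrite -leeBlDl// -EFinB; apply: le_trans; rewrite lee_fin; lra.
apply: (@le_trans _ _ (gaussn N (\big[setU/set0]_(p | Q p) C p))).
  apply: le_measure; rewrite ?inE//.
  - exact: measurableC.
  - exact: bigsetU_measurable.
  move=> t nt; have [a [b [sa sb ab]]] := not_ball_op r0 nt.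
  have Qab : Q (a, b) by rewrite /Q /= sa sb.
  by rewrite (bigD1 (a, b) Qab)/=; left.
apply: le_trans (mu_bigU_le (gaussn N) (index_enum _) Q mC) _.
apply: (@le_trans _ _ (\sum_(p | Q p) (expR (- (16 * m%:R)))%:E)%E).
  apply: lee_sum => p /andP[p1 p2].
  have mm0 : 0 < 32 * m%:R ^+ 2 :> R by rewrite mulr_gt0// exprn_gt0.
  apply: le_trans (gaussn_tail mm0 _ _) _.
  - by rewrite mulr_ge0// ltW.
  - apply: le_trans (sum_sqr_coef _ _) _.
    have := sqv_ge0 (latR p.1 : 'cV[R]_m); have := sqv_ge0 (latR p.2 : 'cV[R]_m).
    move: p1 p2; set x := sqv _; set y := sqv _ => x4 y4 y0 x0.
    have : x * y <= (4 * m%:R) * (4 * m%:R) by apply: ler_pM.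
    rewrite expr2; lra.
  rewrite lee_fin ler_expR lerN2 /r !exprMn sqr_sqrtr ?(ltW mR0)//.
  suff -> : m%:R ^+ 2 * (32 ^+ 2 * m%:R) / (2 * (32 * m%:R ^+ 2)) = 16 * m%:R :> R by [].
  by field; rewrite gt_eqF.
rewrite sumEFin lee_fin -[X in \sum_(_ | _) X]mul1r -mulr_suml.
have -> : \sum_(p | Q p) (1 : R) =
   (\sum_(a : lat m | sqv (latR a : 'cV[R]_m) <= 4 * m%:R) 1) *
   (\sum_(a : lat m | sqv (latR a : 'cV[R]_m) <= 4 * m%:R) 1).
  rewrite mulr_suml; under [RHS]eq_bigr do rewrite mul1r.
  by rewrite pair_big.
have cnt := @lat_count R m.
apply: (@le_trans _ _ (expR (6 * m%:R) * expR (6 * m%:R) * expR (- (16 * m%:R)))).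
  rewrite ler_wpM2r ?expR_ge0//; apply: ler_pM => //; exact: sumr_ge0.
rewrite -!expRD (_ : _ + _ = - (4 * m%:R)); last by ring.
apply: (@le_trans _ _ (expR (-1))).
  by have m1 : 1 <= m%:R :> R; [rewrite ler1n|rewrite ler_expR lerN2; lra].
rewrite expRN lef_pV2 ?posrE ?expR_gt0//.
by apply: le_trans (expR_ge1Dx 1); lra.
Qed.

(* Substituting [t = s u] in the Gaussian integral gives a Jacobian [s ^+ N] and the weight
   [expR (- (s ^+ 2 - 1) |u|^2 / 2)], and [2 |u|^2 <= m r^2] on the ball. *)
Lemma gaussn_ball_scale (s r : R) : 1 <= s -> 0 <= r ->
  (gaussn N (ball_op (s * r)%R) <= (s ^+ N)%:E * gaussn N (ball_op r))%E /\
  ((s ^+ N * expR (- ((s ^+ 2 - 1) * (m%:R * r ^+ 2) / 4)))%:E * gaussn N (ball_op r) <=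
   gaussn N (ball_op (s * r)%R))%E.
Proof.
move=> s1 r0; have s0 : 0 < s by exact: lt_le_trans ltr01 s1.
have sr0 : 0 <= s * r by rewrite mulr_ge0// ltW.
have mB := @measurable_ball R m m0 r r0.
have mB' := @measurable_ball R m m0 _ sr0.
pose F (t : N.-tuple R) := (\1_(ball_op r) t)%:E : \bar R.
have mF : measurable_fun setT F by exact/measurable_EFinP/measurable_indic.
have F0 t : (0 <= F t)%E by rewrite lee_fin.
have IF : (\int[gaussn N]_t F t = gaussn N (ball_op r))%E.
  by rewrite integral_indic// setIT.
have sV0 : s^-1 != 0 by rewrite invr_eq0 gt_eqF.
have E : gaussn N (ball_op (s * r)%R) =
    ((s ^+ N)%:E * \int[gaussn N]_t tiltt s^-1 F t)%E.
  have := integral_gaussn_scale sV0 mF F0.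
  rewrite normfV gtr0_norm// exprVn invrK => <-.
  have <- : (\int[gaussn N]_t (\1_(ball_op (s * r)%R) t)%:E =
    gaussn N (ball_op (s * r)%R))%E by rewrite integral_indic// setIT.
  apply: eq_integral => t _; rewrite /F !indicE.
  suff -> : (t \in ball_op (s * r)) = (scalet s^-1 t \in ball_op r) by [].
  have bs := @ball_scale R m m0 s r (scalet s^-1 t) s0 r0.
  have ss : scalet s (scalet s^-1 t) = t.
    by apply: eq_from_tnth => i; rewrite !tnth_mktuple mulrA divff ?mul1r// gt_eqF.
  rewrite ss in bs.
  by apply/idP/idP; rewrite !inE => /bs.
have mT := measurable_tiltt s^-1 mF.
have sN0 : 0 <= s ^+ N by rewrite exprn_ge0// ltW.
split.
  rewrite E lee_wpmul2l ?lee_fin// -IF; apply: ge0_le_integral => //.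
  - by move=> t _; exact: tiltt_ge0.
  - move=> t _; rewrite /tiltt -[leRHS]mule1 lee_wpmul2l// lee_fin.
    rewrite -[leRHS]expR0 ler_expR oppr_le0 exprVn invrK divr_ge0// mulr_ge0//.
      by rewrite subr_ge0 exprn_ege1.
    by apply: sumr_ge0 => i _; rewrite sqr_ge0.
rewrite E EFinM -muleA lee_wpmul2l ?lee_fin// -IF -ge0_integralZl_EFin ?expR_ge0//.
apply: ge0_le_integral => //.
- by move=> t _; rewrite mule_ge0// lee_fin expR_ge0.
- exact: emeasurable_funM.
- move=> t _; rewrite /tiltt /F indicE muleC.
  case: (boolP (t \in _)) => [|_]; last by rewrite !mul0e.
  rewrite inE => tr; have {tr} := sqt_ball r0 tr => tr; rewrite !mul1e lee_fin ler_expR lerN2.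
  rewrite exprVn invrK -!mulrA ler_wpM2l ?subr_ge0 ?exprn_ege1//; lra.
Qed.

End ball_prob.

Section correlated_balls.
Context {R : realType} (m : nat).
Hypothesis m0 : (0 < m)%N.
Local Notation N := #|{: @upper m}|.

(** For a fixed first tuple in the ball, the second condition is a shifted ball for the second
    tuple; once the shift is dropped, scaling by $\tau^{-1} \ge 1$ costs $\tau^{-N}$. *)
Lemma correlated_balls (r rho tau : R) : 0 <= r -> 0 < tau <= 1 ->
  (((gaussn N \x gaussn N) [set z | ball_op r z.1 /\
      ball_op r (addt (scalet tau z.2) (scalet rho z.1))]) <=
   ((tau ^- N)%:E * (gaussn N (ball_op r) * gaussn N (ball_op r))))%E.
Proof.
move=> r0 /andP[t0 t1].
have mB := @measurable_ball R m m0 r r0.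
pose f (z : N.-tuple R * N.-tuple R) := addt (scalet tau z.2) (scalet rho z.1).
have mf : measurable_fun setT f.
  by apply: measurable_addt; apply: measurableT_comp => //; exact: measurable_scalet.
set S := [set z | _].
have mS : measurable S.
  rewrite (_ : S = fst @^-1` (ball_op r) `&` f @^-1` (ball_op r)); last first.
    by apply/seteqP; split => z /=.
  apply: measurableI; rewrite -[X in measurable X]setTI; first exact: measurable_fst.
  exact: mf.
have tau1 : 1 <= tau^-1 by rewrite invf_ge1.
have sc (w : N.-tuple R) : ball_op r (scalet tau w) <-> ball_op (tau^-1 * r) w.
  have r't : 0 <= tau^-1 * r by rewrite mulr_ge0// invr_ge0 ltW.
  by have := @ball_scale R m m0 tau (tau^-1 * r) w t0 r't; rewrite mulrA divff ?mul1r ?gt_eqF.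
have key (x : N.-tuple R) : (gaussn N (xsection S x) <=
    (tau ^- N)%:E * gaussn N (ball_op r) * (\1_(ball_op r) x)%:E)%E.
  case: (pselect (ball_op r x)) => [bx|nbx]; last first.
    rewrite (_ : xsection S x = set0) ?measure0 ?mule_ge0//.
      by rewrite lee_fin invr_ge0 exprn_ge0// ltW.
    by apply/seteqP; split => w //; rewrite /xsection /= inE => -[].
  rewrite indicE mem_set// mule1.
  rewrite (_ : xsection S x = [set w | ball_op r (addt (scalet tau w) (scalet rho x))]); last first.
    by apply/seteqP; split => w; rewrite /xsection /= inE => //= -[].
  apply: le_trans (anderson tau (scalet rho x) mB _ _) _.
  - by move=> t; exact: (ball_opp m0).
  - by move=> y z; exact: (ball_mid m0).
  rewrite (_ : [set w | _] = ball_op (tau^-1 * r)); last first.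
    by apply/seteqP; split => w /=; rewrite sc.
  by have [+ _] := @gaussn_ball_scale R m m0 _ _ tau1 r0; rewrite exprVn.
rewrite /product_measure1.
have mI : measurable_fun setT (fun x : N.-tuple R => (\1_(ball_op r) x)%:E : \bar R).
  exact/measurable_EFinP/measurable_indic.
set g := gaussn N in key *.
have pE : (fine (g (ball_op r)))%:E = g (ball_op r) by rewrite fineK// fin_num_measure.
rewrite -pE -EFinM in key *.
apply: (@le_trans _ _ (\int[g]_x ((tau ^- N * fine (g (ball_op r)))%:E * (\1_(ball_op r) x)%:E))%E).
  apply: ge0_le_integral => //.
  - exact: measurable_fun_xsection.
  - exact: emeasurable_funM.
  - by move=> x _; exact: key.
have tn0 : 0 <= tau ^- N * fine (g (ball_op r)).
  by rewrite mulr_ge0 ?fine_ge0// invr_ge0 exprn_ge0// ltW.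
rewrite ge0_integralZl_EFin// integral_indic// setIT.
set q := fine (g (ball_op r)) in pE *.
by rewrite -[X in (_ * X <= _)%E]pE -!EFinM mulrA.
Qed.

End correlated_balls.

(** * Laws of signed sums *)

Section normal_scaling.
Context {R : realType}.
Local Notation mu := (@lebesgue_measure R).

Lemma normal_prob_scale (s : R) (B : set R) : 0 < s -> measurable B ->
  normal_prob 0 s ((fun y => y / s) @^-1` B) = stdn B.
Proof.
move=> s0 mB; have sn0 : s != 0 by rewrite gt_eqF.
have mS : measurable ((fun y : R => y / s) @^-1` B).
  by rewrite -[X in measurable X]setTI; apply: measurable_funM.
pose f y := ((\1_B (y / s))%:E * (normal_pdf 0 s y)%:E)%E.
have mind : measurable_fun setT (fun y : R => (\1_B (y / s))%:E : \bar R).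
  apply/measurable_EFinP; apply: (measurableT_comp (measurable_indic mB)).
  exact: measurable_funM.
have mf : measurable_fun setT f.
  apply: emeasurable_funM => //; apply/measurable_EFinP; exact: measurable_normal_pdf.
have f0 y : (0 <= f y)%E by rewrite mule_ge0// lee_fin// normal_pdf_ge0.
transitivity (\int[mu]_y f y)%E.
  rewrite /normal_prob integral_mkcond; apply: eq_integral => y _.
  rewrite /patch /f indicE; have -> : (y \in (fun y => y / s) @^-1` B) = (y / s \in B) by [].
  by case: ifP; rewrite ?mul1e ?mul0e.
rewrite (@ge0_integral_affine R s 0 f)// gtr0_norm// stdnE [RHS]integral_mkcond.
have mfs : measurable_fun setT (fun x : R => f (s * x + 0)).
  apply: (measurableT_comp mf); apply: measurable_funD => //; exact: measurable_funM.
rewrite -ge0_integralZl_EFin ?(ltW s0)//.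
apply: eq_integral => x _; rewrite /f addr0 mulrAC divff// mul1r /patch indicE.
case: ifP => _; rewrite ?mul0e ?mule0 ?mul1e//.
rewrite -EFinM; congr _%:E; rewrite normal_pdfE// /normal_fun /phi mulrA.
congr (_ * expR _); last by rewrite subr0; field.
rewrite /normal_peak expr1n mul1r -mulrnAr sqrtrM ?sqr_ge0// sqrtr_sqr gtr0_norm//.
by rewrite invfM mulrA divff// mul1r.
Qed.

End normal_scaling.

Section transfer.
Context {R : realType} {n m : nat} {d : measure_display} {T : measurableType d}.
Context {P : probability T R} {Y : 'I_n -> 'I_m -> 'I_m -> T -> R}.
Hypothesis HY : indep_GOE P Y.
Local Notation N := #|{: @upper m}|.

Let sd (e : @upper m) : R := sdev (val e).1 (val e).2.

Let sd_gt0 e : 0 < sd e.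
Proof. by rewrite /sd /sdev; case: ifP => _ //; rewrite sqrtr_gt0. Qed.

(** Entries of all [n] matrices are grouped by position, because a linear combination of the
    matrices acts on every group by the same linear form. *)
Definition entries (e : @upper m) (t : T) : n.-tuple R :=
  [tuple Y i (val e).1 (val e).2 t / sd e | i < n].

Lemma measurable_entry i (e : @upper m) : measurable_fun setT (Y i (val e).1 (val e).2).
Proof.
have [_ _ [mY _]] := HY.
pose x : 'I_n * 'I_m * 'I_m := (i, (val e).1, (val e).2).
by have := mY (exist (fun x : 'I_n * 'I_m * 'I_m => (x.1.2 <= x.2)%N) x (valP e)).
Qed.

Lemma measurable_entries e : measurable_fun setT (entries e).
Proof.
apply/measurable_fun_tnthP => i.
rewrite (_ : _ \o _ = fun t => Y i (val e).1 (val e).2 t / sd e); last first.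
  by apply/funext => t /=; rewrite tnth_mktuple.
by apply: measurable_funM => //; exact: measurable_entry.
Qed.

(** On rectangles this is the product rule of [HY] with the factors regrouped by position;
    [indep_extend] does the rest. *)
Lemma entries_indep (D : @upper m -> set (n.-tuple R)) :
  (forall e, measurable (D e)) ->
  P (\bigcap_(e in [set: @upper m]) (entries e @^-1` D e)) =
  (\prod_e gaussn n (D e))%E.
Proof.
apply: (indep_extend (@measurable_tuple_rects R n) (@setI_closed_rects R n)
  (@rects_setT R n) measurable_entries) => {}D DG.
have /choice[B BD] : forall e, exists B : 'I_n -> set R,
    (forall i, measurable (B i)) /\ rect B = D e.
  by move=> e; have [B mB <-] := DG e; exists B.
have [_ lawY [mY indY]] := HY.
pose ex (x : upper_idx n m) : @upper m :=
  exist (fun x : 'I_m * 'I_m => (x.1 <= x.2)%N) ((val x).1.2, (val x).2) (valP x).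
pose C (x : upper_idx n m) : set R :=
  (fun y => y / sd (ex x)) @^-1` B (ex x) (val x).1.1.
have mC x : measurable (C x).
  rewrite -[X in measurable X]setTI; apply: measurable_funM => //.
  exact: (BD _).1.
transitivity (P (\bigcap_(x in [set: upper_idx n m])
    ((fun x : upper_idx n m => Y (val x).1.1 (val x).1.2 (val x).2) x @^-1` C x))).
  congr (P _); apply/seteqP; split => t /= H.
    move=> x _; have := H (ex x) I; rewrite /= -(BD _).2 => /(_ (val x).1.1).
    by rewrite tnth_mktuple.
  move=> e _; rewrite /= -(BD e).2 => i; rewrite tnth_mktuple.
  pose x : upper_idx n m := exist (fun x : 'I_n * 'I_m * 'I_m => (x.1.2 <= x.2)%N)
    (i, (val e).1, (val e).2) (valP e).
  have := H x I; rewrite /C /=.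
  suff -> : ex x = e by [].
  by apply: val_inj; rewrite /= -surjective_pairing.
rewrite indY//.
transitivity (\prod_(x : upper_idx n m) stdn (B (ex x) (val x).1.1))%E.
  apply: eq_bigr => x _; rewrite (lawY _ _ _ _ (mC x)).
  exact: (normal_prob_scale (sd_gt0 (ex x)) ((BD _).1 _)).
transitivity (\prod_e \prod_(i < n) stdn (B e i))%E; last first.
  by apply: eq_bigr => e _; rewrite -(BD e).2 gaussn_rect//; exact: (BD e).1.
rewrite pair_big/=.
pose h (p : @upper m * 'I_n) : upper_idx n m :=
  exist (fun x : 'I_n * 'I_m * 'I_m => (x.1.2 <= x.2)%N)
    (p.2, (val p.1).1, (val p.1).2) (valP p.1).
rewrite (reindex h)/=; last first.
  exists (fun x => (ex x, (val x).1.1)) => [[e i] _|x _].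
    congr (_, _); apply: val_inj => /=; by rewrite -surjective_pairing.
  apply: val_inj => /=; by case: (x) => -[[a b] c].
apply: eq_bigr => -[e i] _ /=; congr (stdn (B _ _)).
by apply: val_inj; rewrite /= -surjective_pairing.
Qed.

(** For [phi = dott c] this is the coordinate tuple of $\sum_i c_iA_i$. *)
Definition images (phi : n.-tuple R -> R) (t : T) : N.-tuple R :=
  [tuple phi (entries (enum_val k) t) | k < N].

Lemma measurable_images phi : measurable_fun setT phi ->
  measurable_fun setT (images phi).
Proof.
move=> mphi; apply/measurable_fun_tnthP => k.
rewrite (_ : _ \o _ = fun t => phi (entries (enum_val k) t)); last first.
  by apply/funext => t /=; rewrite tnth_mktuple.
exact: (measurableT_comp mphi (measurable_entries _)).
Qed.

(** Reduces the joint law of several combinations of the matrices to that of scalar functions of one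
    Gaussian tuple: positions are independent, and on rectangles the products over positions and
    over [J] are exchanged. *)
Lemma images_indep (J : finType) (phi : J -> n.-tuple R -> R) :
  (forall j, measurable_fun setT (phi j)) ->
  (forall B : J -> set R, (forall j, measurable (B j)) ->
    gaussn n (\bigcap_(j in [set: J]) (phi j @^-1` B j)) = (\prod_j stdn (B j))%E) ->
  forall C : J -> set (N.-tuple R), (forall j, measurable (C j)) ->
    P (\bigcap_(j in [set: J]) (images (phi j) @^-1` C j)) =
    (\prod_j gaussn N (C j))%E.
Proof.
move=> mphi law.
apply: (indep_extend (@measurable_tuple_rects R N) (@setI_closed_rects R N)
  (@rects_setT R N) (fun j => measurable_images (mphi j))) => D DG.
have /choice[B BD] : forall j, exists B : 'I_N -> set R,
    (forall i, measurable (B i)) /\ rect B = D j.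
  by move=> j; have [B mB <-] := DG j; exists B.
pose C e := \bigcap_(j in [set: J]) (phi j @^-1` B j (enum_rank e)).
have mC e : measurable (C e).
  apply: fin_bigcap_measurable => // j _.
  by rewrite -[X in measurable X]setTI; apply: mphi => //; exact: (BD j).1.
transitivity (P (\bigcap_(e in [set: @upper m]) (entries e @^-1` C e))).
  congr (P _); apply/seteqP; split => t /= H.
    move=> e _ j _; have := H j I; rewrite /= -(BD j).2 => /(_ (enum_rank e)).
    by rewrite tnth_mktuple enum_rankK.
  move=> j _; rewrite /= -(BD j).2 => k; rewrite tnth_mktuple.
  by have := H (enum_val k) I j I; rewrite /= enum_valK.
rewrite entries_indep//.
transitivity (\prod_e \prod_j stdn (B j (enum_rank e)))%E.
  apply: eq_bigr => e _; rewrite law// => j; exact: (BD j).1.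
rewrite exchange_big/=; apply: eq_bigr => j _.
rewrite -(BD j).2 gaussn_rect; last exact: (BD j).1.
rewrite (reindex (@enum_rank (@upper m)))//=.
by apply: onW_bij; exact: enum_rank_bij.
Qed.

End transfer.

Section sign_events.
Context {R : realType} {n m : nat} {d : measure_display} {T : measurableType d}.
Context {P : probability T R} {Y : 'I_n -> 'I_m -> 'I_m -> T -> R}.
Hypothesis HY : indep_GOE P Y.
Hypothesis m0 : (0 < m)%N.
Local Notation N := #|{: @upper m}|.

Lemma sdev_neq0 (j k : 'I_m) : sdev j k != 0 :> R.
Proof. by rewrite /sdev; case: ifP => _; rewrite ?oner_neq0// gt_eqF// sqrtr_gt0. Qed.

Lemma sum_rmatrix (c : 'I_n -> R) t :
  \sum_i c i *: rmatrix Y i t = mat (images (Y := Y) (dott c) t).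
Proof.
have [symY _ _] := HY.
apply/matrixP => j k; rewrite summxE mxE tnth_mktuple enum_rankK /dott mulr_sumr.
apply: eq_bigr => i _; rewrite !mxE tnth_mktuple val_upper_of/=.
have E : sdev (if (j <= k)%N then (j, k) else (k, j)).1
           (if (j <= k)%N then (j, k) else (k, j)).2 = sdev j k :> R.
  by case: ifP => //= _; rewrite /sdev eq_sym.
rewrite E; have := sdev_neq0 j k; case: ifP => /= _ s0; first by field.
by rewrite symY; field.
Qed.

Lemma gaussn_unit_form (c : 'I_n -> R) (B : set R) : \sum_i c i ^+ 2 = 1 ->
  measurable B -> gaussn n (dott c @^-1` B) = stdn B.
Proof.
move=> c1 mB.
have mS : measurable (dott c @^-1` B).
  by rewrite -[X in measurable X]setTI; exact: (measurable_dott c).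
pose F (z : R * R) := (\1_B z.1)%:E : \bar R.
have mF : measurable_fun setT F.
  by apply/measurable_EFinP; apply: (measurableT_comp (measurable_indic mB)).
have F0 z : (0 <= F z)%E by rewrite lee_fin.
pose b : 'I_n -> R := fun=> 0.
have cb i : c i * b i = 0 by rewrite mulr0.
have := integral_two_forms mF F0 cb; rewrite c1 sqrtr1 => E.
transitivity (\int[gaussn n]_z F (dott c z, dott b z))%E.
  transitivity (\int[gaussn n]_z (\1_(dott c @^-1` B) z)%:E)%E; last by [].
  by rewrite integral_indic// setIT.
rewrite E; transitivity (\int[@stdn R]_u (\1_B u)%:E)%E; last first.
  by rewrite integral_indic// setIT.
apply: eq_integral => u _.
transitivity (\int[@stdn R]_v (cst ((\1_B u)%:E : \bar R) v))%E.
  by apply: eq_integral => v _; rewrite /F /= mul1r.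
by rewrite integral_cst// [X in (_ * X)%E]probability_setT mule1.
Qed.

Lemma prob_unit_form (c : 'I_n -> R) (C : set (N.-tuple R)) :
  \sum_i c i ^+ 2 = 1 -> measurable C ->
  P (images (Y := Y) (dott c) @^-1` C) = gaussn N C.
Proof.
move=> c1 mC.
have := @images_indep _ _ _ _ _ _ _ HY 'I_1 (fun=> dott c) (fun=> measurable_dott c).
have H (B : 'I_1 -> set R) : (forall j, measurable (B j)) ->
    gaussn n (\bigcap_(j in [set: 'I_1]) (dott c @^-1` B j)) = (\prod_j stdn (B j))%E.
  move=> mB; rewrite big_ord1 -(gaussn_unit_form c1)//; congr (gaussn n _).
  by apply/seteqP; split => z /= Hz; [exact: Hz|move=> j _; rewrite ord1].
move=> /(_ H (fun=> C) (fun=> mC)); rewrite big_ord1 => <-; congr (P _).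
by apply/seteqP; split => z /= Hz; [move=> j _|exact: (Hz ord0 I)].
Qed.

(** One matrix is the combination along a basis vector. This ties the small-ball hypothesis on $\xi$
    to [gaussn]. *)
Lemma prob_rmatrix i r : 0 <= r ->
  P [set t | opnorm (rmatrix Y i t) <= r] = gaussn N (ball_op r).
Proof.
move=> r0; pose c j : R := (j == i)%:R.
have c1 : \sum_j c j ^+ 2 = 1.
  rewrite (bigD1 i)//= /c eqxx expr1n big1 ?addr0// => j /negbTE ->.
  by rewrite expr0n.
rewrite -(prob_unit_form c1 (measurable_ball m0 r0)); congr (P _).
apply/seteqP; split => t; rewrite /= /ball_op /= -sum_rmatrix.
  rewrite (bigD1 i)//= /c eqxx scale1r big1 ?addr0// => j /negbTE ->.
  by rewrite scale0r.
rewrite (bigD1 i)//= /c eqxx scale1r big1 ?addr0// => j /negbTE ->.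
by rewrite scale0r.
Qed.

Hypothesis n0 : (0 < n)%N.
Implicit Types x y : {ffun 'I_n -> bool}.

Let sn : R := Num.sqrt n%:R.

Let sn0 : 0 < sn. Proof. by rewrite sqrtr_gt0 ltr0n. Qed.

Let snE : sn ^+ 2 = n%:R. Proof. by rewrite sqr_sqrtr. Qed.

Lemma sqr_sgnb b : sgnb R b ^+ 2 = 1.
Proof. by case: b; rewrite /sgnb ?sqrrN expr1n. Qed.

Definition sgn_event (r : R) x : set T :=
  [set t | opnorm (\sum_(i < n) sgnb R (x i) *: rmatrix Y i t) <= sn * r].

Definition sgn_form x : 'I_n -> R := fun i => sgnb R (x i) / sn.

Lemma sgn_eventE r x : 0 <= r ->
  sgn_event r x = images (Y := Y) (dott (sgn_form x)) @^-1` ball_op r.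
Proof.
move=> r0.
have E t : \sum_(i < n) sgnb R (x i) *: rmatrix Y i t =
    sn *: mat (images (Y := Y) (dott (sgn_form x)) t).
  rewrite -sum_rmatrix scaler_sumr; apply: eq_bigr => i _.
  by rewrite scalerA /sgn_form mulrC divfK// gt_eqF.
have scale t := opnorm_scale_le m0 (mat (images (Y := Y) (dott (sgn_form x)) t)) sn0 r0.
apply/seteqP; split => t; rewrite /sgn_event /preimage /ball_op /mkset E.
  by move/(scale t).
by move=> ?; exact/(scale t).
Qed.

Lemma sum_sqr_sgn_form x : \sum_i sgn_form x i ^+ 2 = 1.
Proof.
under eq_bigr do rewrite expr_div_n sqr_sgnb snE.
rewrite sumr_const card_ord -[_ *+ n]mulr_natr mul1r mulVf//.
by rewrite pnatr_eq0 -lt0n.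
Qed.

Lemma measurable_sgn_event r x : 0 <= r -> measurable (sgn_event r x).
Proof.
move=> r0; rewrite sgn_eventE// -[X in measurable X]setTI.
apply: (measurable_images HY (measurable_dott _)) => //.
exact: measurable_ball.
Qed.

Lemma prob_sgn_event r x : 0 <= r -> P (sgn_event r x) = gaussn N (ball_op r).
Proof.
move=> r0; rewrite sgn_eventE// prob_unit_form//; first exact: sum_sqr_sgn_form.
exact: measurable_ball.
Qed.

Definition agree x y : nat := #|[pred i | x i == y i]|.

(* The normalized signed sums along [x] and [y] are [X] and [rho X + tau W], with [W] an
   independent copy of [X] and [rho = (k - l) / n]. *)
Lemma prob_sgn_event2 r x y (k l tau : R) : 0 <= r -> (0 < agree x y < n)%N ->
  k = (agree x y)%:R -> l = n%:R - k -> tau = 2 * Num.sqrt (k * l) / n%:R ->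
  (P (sgn_event r x `&` sgn_event r y) <=
   (tau ^- N)%:E * (gaussn N (ball_op r) * gaussn N (ball_op r)))%E.
Proof.
move=> r0 /andP[k0 kn] kE lE tauE0.
(* Up to normalization the two sums are $S + D$ and $S - D$, where $S$ and $D$ collect the
   coordinates on which the signs agree and differ, with variances $k$ and $l$. *)
pose a i : R := sgnb R (x i) * (x i == y i)%:R.
pose b i : R := sgnb R (x i) * (x i != y i)%:R.
have ab i : a i * b i = 0.
  by rewrite /a /b; case: (x i == y i); rewrite /= ?mulr0 ?mul0r.
have a2 : \sum_i a i ^+ 2 = k.
  rewrite kE /agree -sum1_card natr_sum [RHS]big_mkcond/=; apply: eq_bigr => i _.
  by rewrite exprMn sqr_sgnb mul1r ?inE; case: (x i == y i); rewrite /= ?expr1n ?expr0n.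
have b2 : \sum_i b i ^+ 2 = l.
  rewrite lE; apply/eqP; rewrite eq_sym subr_eq -a2 -big_split/=; apply/eqP.
  rewrite -[n in LHS]card_ord -sum1_card natr_sum; apply: eq_bigr => i _.
  rewrite !exprMn !sqr_sgnb !mul1r.
  by case: (x i == y i); rewrite /= ?expr1n ?expr0n /= ?add0r ?addr0.
have kp : 0 < k by rewrite kE ltr0n.
have lp : 0 < l by rewrite lE kE subr_gt0 ltr_nat.
have np : 0 < n%:R :> R by rewrite ltr0n.
have kl : k + l = n%:R by rewrite lE; ring.
have alp : 0 < \sum_i a i ^+ 2 by rewrite a2.
have blp : 0 < \sum_i b i ^+ 2 by rewrite b2.
pose phi z := (dott a z + dott b z) / sn.
(* The combination of $S$ and $D$ that has unit variance and is uncorrelated with [phi]. *)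
pose psi z := (Num.sqrt l / Num.sqrt k * dott a z -
               Num.sqrt k / Num.sqrt l * dott b z) / sn.
have mphi : measurable_fun setT phi.
  by apply: measurable_funM => //; apply: measurable_funD; exact: measurable_dott.
have mpsi : measurable_fun setT psi.
  apply: measurable_funM => //; apply: measurable_funB; apply: measurable_funM => //;
  exact: measurable_dott.
have mimg := measurable_images HY.
have law (B B' : set R) : measurable B -> measurable B' ->
    gaussn n (phi @^-1` B `&` psi @^-1` B') = (stdn B * stdn B')%E.
  move=> mB mB'; pose G (z : R * R) := (\1_B z.1 * \1_B' z.2)%:E : \bar R.
  have mG : measurable_fun setT G.
    apply/measurable_EFinP; apply: measurable_funM.
      exact: (measurableT_comp (measurable_indic mB)).
    exact: (measurableT_comp (measurable_indic mB')).
  have G0 z : (0 <= G z)%E by rewrite lee_fin mulr_ge0.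
  have := integral_sum_diff mG G0 ab alp blp; rewrite a2 b2 kl -/sn => E.
  transitivity (\int[gaussn n]_z G (phi z, psi z))%E.
    have mS : measurable (phi @^-1` B `&` psi @^-1` B').
      by apply: measurableI; rewrite -[X in measurable X]setTI; [exact: mphi|exact: mpsi].
    transitivity (\int[gaussn n]_z (\1_(phi @^-1` B `&` psi @^-1` B') z)%:E)%E.
      by rewrite integral_indic// setIT.
    by apply: eq_integral => z _; rewrite indicI.
  rewrite E /G /=.
  transitivity (\int[@stdn R]_u ((\1_B u)%:E * stdn B'))%E.
    apply: eq_integral => u _.
    under eq_integral do rewrite EFinM.
    have mI : measurable_fun setT (fun v : R => (\1_B' v)%:E : \bar R).
      exact/measurable_EFinP/measurable_indic.
    by rewrite ge0_integralZl_EFin// integral_indic// setIT.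
  have mI : measurable_fun setT (fun v : R => (\1_B v)%:E : \bar R).
    exact/measurable_EFinP/measurable_indic.
  by rewrite ge0_integralZr// integral_indic// setIT.
have lawN (C C' : set (N.-tuple R)) : measurable C -> measurable C' ->
    P (images (Y := Y) phi @^-1` C `&` images (Y := Y) psi @^-1` C') =
    (gaussn N C * gaussn N C')%E.
  move=> mC mC'; pose f (j : bool) := if j then phi else psi.
  have mf j : measurable_fun setT (f j) by case: j.
  have Hf (B : bool -> set R) : (forall j, measurable (B j)) ->
      gaussn n (\bigcap_(j in [set: bool]) (f j @^-1` B j)) = (\prod_j stdn (B j))%E.
    move=> mB; rewrite big_bool /= -law//; congr (gaussn n _).
    apply/seteqP; split => z /=.
      by move=> H; split; [exact: (H true I)|exact: (H false I)].
    by move=> [H1 H2] [].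
  have := images_indep HY mf Hf (C := fun j => if j then C else C').
  move=> H; have {}H := H (fun j => match j with true => mC | false => mC' end).
  rewrite big_bool /= in H; rewrite -H; congr (P _).
  apply/seteqP; split => z /=; first by move=> [H1 H2] [].
  by move=> Hz; split; [exact: (Hz true I)|exact: (Hz false I)].
pose XW t := (images (Y := Y) phi t, images (Y := Y) psi t).
have mXW : measurable_fun setT XW.
  by apply: measurable_fun_pair; exact: mimg.
pose rho := (k - l) / n%:R.
have skn0 : Num.sqrt k != 0 by rewrite gt_eqF// sqrtr_gt0.
have sln0 : Num.sqrt l != 0 by rewrite gt_eqF// sqrtr_gt0.
have nn0 : n%:R != 0 :> R by rewrite gt_eqF.
have sk2 : Num.sqrt k * Num.sqrt k = k by rewrite -expr2 sqr_sqrtr// ltW.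
have sl2 : Num.sqrt l * Num.sqrt l = l by rewrite -expr2 sqr_sqrtr// ltW.
have tauE : tau = 2 * (Num.sqrt k * Num.sqrt l) / n%:R by rewrite tauE0 sqrtrM// ltW.
have formx z : dott (sgn_form x) z = phi z.
  rewrite /dott /phi -big_split/= mulr_suml; apply: eq_bigr => i _.
  rewrite /sgn_form /a /b -mulrDl -mulrDr.
  by case: (x i == y i); rewrite /= ?addr0 ?add0r mulr1 mulrAC.
have formy z : dott (sgn_form y) z = tau * psi z + rho * phi z.
  have -> : dott (sgn_form y) z = (dott a z - dott b z) / sn.
    rewrite /dott -sumrB mulr_suml; apply: eq_bigr => i _.
    rewrite /sgn_form /a /b -mulrBl -mulrBr mulrAC; congr (_ * _ / _).
    by case: (x i) => //; case: (y i) => /=; rewrite /sgnb; ring.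
  rewrite /psi /phi tauE /rho -kl.
  have kl0 : k + l != 0 by rewrite kl.
  have -> : 2 * (Num.sqrt k * Num.sqrt l) / (k + l) *
      ((Num.sqrt l / Num.sqrt k * dott a z - Num.sqrt k / Num.sqrt l * dott b z) / sn) =
      (2 * l / (k + l) * dott a z - 2 * k / (k + l) * dott b z) / sn.
    rewrite -[X in 2 * X / _ * dott a z]sl2 -[X in 2 * X / _ * dott b z]sk2.
    by field; rewrite skn0 sln0 kl0 gt_eqF.
  by field; rewrite kl0 gt_eqF.
have t01 : 0 < tau <= 1.
  rewrite tauE divr_gt0 ?mulr_gt0 ?sqrtr_gt0//= ler_pdivrMr// mul1r -kl.
  by have := sqr_ge0 (Num.sqrt k - Num.sqrt l); rewrite -[X in _ <= X + _]sk2 -[X in _ <= _ + X]sl2; nra.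
apply: le_trans (correlated_balls m0 rho r0 t01); rewrite le_eqVlt; apply/orP; left; apply/eqP.
have mB := measurable_ball m0 r0.
set S := [set z | _].
have mf : measurable_fun setT (fun z : N.-tuple R * N.-tuple R => addt (scalet tau z.2) (scalet rho z.1)).
  by apply: measurable_addt; apply: measurableT_comp => //; exact: measurable_scalet.
have mS : measurable S.
  rewrite (_ : S = fst @^-1` (ball_op r) `&`
     (fun z => addt (scalet tau z.2) (scalet rho z.1)) @^-1` (ball_op r)); last first.
    by apply/seteqP; split => z /=.
  apply: measurableI; rewrite -[X in measurable X]setTI; first exact: measurable_fst.
  exact: mf.
transitivity (push_measure P mXW S); last first.
  by apply/esym; apply: product_measure_unique => //; exact: lawN.
rewrite /= /pushforward; congr (P _); rewrite !sgn_eventE//.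
have Ey t : images (Y := Y) (dott (sgn_form y)) t =
    addt (scalet tau (XW t).2) (scalet rho (XW t).1).
  by apply: eq_from_tnth => i; rewrite !tnth_mktuple formy.
have Ex t : images (Y := Y) (dott (sgn_form x)) t = (XW t).1.
  by apply: eq_from_tnth => i; rewrite !tnth_mktuple formx.
by apply/seteqP; split => t /=; rewrite Ey Ex.
Qed.

End sign_events.

(** * Correlations of sign vectors *)

Section sign_moments.
Context {R : realType} (n : nat).
Implicit Types z : {ffun 'I_n -> bool}.

Let nsum : n%:R = \sum_(i < n) 1 :> R. Proof. by rewrite sumr_const card_ord. Qed.

Definition ntrue z : nat := #|[pred i | z i]|.
Definition signsum z : R := \sum_i sgnb R (z i).

Lemma ntrueE z : (ntrue z)%:R = \sum_i (z i)%:R :> R.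
Proof.
rewrite /ntrue -sum1_card natr_sum big_mkcond/=; apply: eq_bigr => i _.
by rewrite ?inE; case: (z i).
Qed.

Lemma signsumE z : signsum z = 2 * (ntrue z)%:R - n%:R.
Proof.
rewrite ntrueE mulr_sumr nsum -sumrB.
by apply: eq_bigr => i _; case: (z i); rewrite /sgnb/=; ring.
Qed.

Lemma sum_prod_bool (g : bool -> R) :
  \sum_(z : {ffun 'I_n -> bool}) \prod_i g (z i) = (g true + g false) ^+ n.
Proof.
rewrite -(bigA_distr_bigA (fun _ b => g b)) prodr_const card_ord.
by rewrite big_bool.
Qed.

(** For $t > 1/2$ because $t \le 2t^2$; for smaller $t$ from $e^{\pm t} \le (1 \mp t)^{-1}$, whose
    sum is $2/(1-t^2) \le 2(1 + 2t^2)$. *)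
Lemma cosh_le (t : R) : expR t + expR (- t) <= 2 * expR (2 * t ^+ 2).
Proof.
wlog t0 : t / 0 <= t.
  move=> H; have [/H//|/ltW t0] := leP 0 t.
  by have := H (- t); rewrite oppr_ge0 opprK sqrrN addrC => /(_ t0).
have [t1|t1] := leP t 2^-1; last first.
  have a : expR t <= expR (2 * t ^+ 2) by rewrite ler_expR; nra.
  have b : expR (- t) <= expR (2 * t ^+ 2) by rewrite ler_expR; nra.
  by lra.
have e1 : expR t <= (1 - t)^-1.
  rewrite -[expR t]invrK lef_pV2 ?posrE ?invr_gt0 ?expR_gt0//; last by lra.
  by rewrite -expRN; have := expR_ge1Dx (- t).
have e2 : expR (- t) <= (1 + t)^-1.
  by rewrite expRN lef_pV2 ?posrE ?expR_gt0//; [exact: expR_ge1Dx|lra].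
apply: le_trans (lerD e1 e2) _.
apply: (@le_trans _ _ (2 * (1 + 2 * t ^+ 2))); last first.
  by rewrite ler_wpM2l//; exact: expR_ge1Dx.
have p1 : 0 < 1 - t by lra.
have p2 : 0 < 1 + t by lra.
have t4 : t ^+ 2 <= 4^-1 by rewrite expr2; nra.
have p3 : 0 < 1 - t ^+ 2 by lra.
have -> : (1 - t)^-1 + (1 + t)^-1 = 2 / (1 - t ^+ 2).
  by field; rewrite !gt_eqF.
rewrite ler_wpM2l// -[leLHS]mul1r ler_pdivrMr//.
by have := sqr_ge0 t; nra.
Qed.

(** The scaling formula for the constant $1$ at $s = \sqrt2$, where the weight is $\exp(x^2/4)$. *)
Lemma integral_expR_sqr :
  (\int[@stdn R]_x (expR (x ^+ 2 / 4))%:E = (Num.sqrt 2)%:E)%E.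
Proof.
pose s : R := Num.sqrt 2.
have s0 : 0 < s by rewrite sqrtr_gt0.
have s2 : s ^+ 2 = 2 by rewrite sqr_sqrtr.
have := @integral_stdn_scale R s (cst 1%E) (lt0r_neq0 s0) (measurable_cst _) (fun=> lee01).
rewrite integral_cst// [X in (_ * X)%E]probability_setT mule1 gtr0_norm// s2 => E.
transitivity (s%:E * (s^-1%:E * \int[@stdn R]_x (cst 1 x * (expR (- ((2^-1 - 1) * x ^+ 2 / 2)))%:E)))%E.
  rewrite muleA -EFinM divff ?gt_eqF// mul1e; apply: eq_integral => x _.
  by rewrite mul1e; congr (expR _)%:E; field.
by rewrite -E mule1.
Qed.

Hypothesis n0 : (0 < n)%N.

(* Gaussian linearization: [exp (S^2 / 16 n)] is the average of [exp (c g S)]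
   over a standard normal [g], which factorizes over the signs. *)
Lemma signsum_moment :
  \sum_z expR (signsum z ^+ 2 / (16 * n%:R)) <= 2 * 2 ^+ n.
Proof.
have np : 0 < n%:R :> R by rewrite ltr0n.
(* With $c^2 = 1/(8n)$ the average is $\exp(c^2S^2/2) = \exp(S^2/(16n))$, and the bound $2(cu)^2$ of
   [cosh_le], taken $n$ times, is $u^2/4$, which is still integrable. *)
pose c : R := Num.sqrt (8 * n%:R)^-1.
have c2 : c ^+ 2 = (8 * n%:R)^-1 by rewrite sqr_sqrtr// invr_ge0 mulr_ge0.
rewrite -lee_fin -sumEFin.
have me (k : R) : measurable_fun setT (fun u : R => (expR (k * u))%:E).
  by apply/measurable_EFinP; apply: measurableT_comp => //; exact: measurable_funM.
have -> : (\sum_z (expR (signsum z ^+ 2 / (16 * n%:R)))%:E =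
    \int[@stdn R]_u \sum_z (expR (c * signsum z * u))%:E)%E.
  rewrite ge0_integral_sum//; apply: eq_bigr => z _; rewrite mgf_stdn.
  by congr (expR _)%:E; rewrite exprMn c2; field; rewrite gt_eqF.
have meq : measurable_fun setT (fun x : R => (expR (x ^+ 2 / 4))%:E).
  by apply/measurable_EFinP; apply: measurableT_comp => //; apply: measurable_funM.
apply: (@le_trans _ _ (\int[@stdn R]_u ((2 ^+ n)%:E * (expR (u ^+ 2 / 4))%:E))%E).
  apply: ge0_le_integral => //.
  - by move=> u _; apply: sume_ge0 => z _; rewrite lee_fin expR_ge0.
  - by apply: emeasurable_sum => z.
  - by apply: emeasurable_funM.
  move=> u _; rewrite sumEFin -EFinM lee_fin.
  have E z : expR (c * signsum z * u) = \prod_i expR (c * u * sgnb R (z i)).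
    by rewrite -expR_sum -mulr_sumr -/(signsum z) mulrAC.
  under eq_bigr do rewrite E.
  rewrite (sum_prod_bool (fun b => expR (c * u * sgnb R b))) /sgnb mulr1 mulrN1.
  have -> : expR (u ^+ 2 / 4) = expR (2 * (c * u) ^+ 2) ^+ n.
    rewrite -expRM_natl; congr expR; rewrite exprMn c2; field.
    by rewrite gt_eqF.
  rewrite -exprMn lerXn2r ?nnegrE ?mulr_ge0 ?addr_ge0 ?expR_ge0//.
  exact: cosh_le.
rewrite ge0_integralZl_EFin ?exprn_ge0// integral_expR_sqr -EFinM lee_fin mulrC.
rewrite ler_wpM2r ?exprn_ge0// -[leRHS]ger0_norm// -sqrtr_sqr ler_sqrt ?sqr_ge0//; lra.
Qed.

(** Chernoff's bound for counting: the sum of $\exp(u(L - \#))$ over all patterns is $e^{uL}(1 +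
    e^{-u})^n$. *)
Lemma card_few (b : bool) (u L : R) : 0 <= u ->
  \sum_(z : {ffun 'I_n -> bool} | \sum_i (z i == b)%:R <= L) 1 <=
  expR (u * L + n%:R * expR (- u)) :> R.
Proof.
move=> u0.
apply: (@le_trans _ _ (\sum_(z : {ffun 'I_n -> bool})
    (expR (u * L) * \prod_i expR (- u * (z i == b)%:R)) : R)).
  rewrite [leRHS](bigID (fun z => \sum_i (z i == b)%:R <= L))/=.
  rewrite -[leLHS]addr0; apply: lerD.
    apply: ler_sum => z zL; rewrite -expR_sum -mulr_sumr -expRD mulNr -mulrBr.
    by rewrite -[leLHS]expR0 ler_expR mulr_ge0// subr_ge0.
  apply: sumr_ge0 => z _; apply: mulr_ge0; first exact: expR_ge0.
  by apply: prodr_ge0 => i _; exact: expR_ge0.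
rewrite -mulr_sumr (sum_prod_bool (fun c => expR (- u * (c == b)%:R))) expRD.
rewrite ler_wpM2l ?expR_ge0// expRM_natl lerXn2r ?nnegrE ?addr_ge0 ?expR_ge0//.
by case: b; rewrite /= mulr1 mulr0 expR0; have := expR_ge1Dx (expR (- u)) ; lra.
Qed.

End sign_moments.

(** * Averaging over the agreement patterns of two signings *)

Section second_moment.
Context {R : realType} (n N : nat).
Implicit Types z : {ffun 'I_n -> bool}.
Hypotheses (n0 : (0 < n)%N) (N0 : (0 < N)%N).
Variables (kappa q : R).
Hypotheses (kappa0 : 0 < kappa) (q0 : 0 < q).
Let w : R := n%:R / N%:R.
Hypotheses (w1 : 128 ^+ 2 <= w) (w2 : kappa ^- 3 <= w).
Hypothesis (qlarge : expR (4 * kappa * N%:R) <= 2 ^+ n * q).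

Let np : 0 < n%:R :> R. Proof. by rewrite ltr0n. Qed.
Let Np : 0 < N%:R :> R. Proof. by rewrite ltr0n. Qed.
Let wp : 0 < w. Proof. by rewrite divr_gt0. Qed.
Let wN : w * N%:R = n%:R. Proof. by rewrite /w divfK// gt_eqF. Qed.

(** With [k] agreements the correlation is $\rho = (2k - n)/n$, and this is $\sqrt{1-\rho^2}$. *)
Definition tau_of (k : nat) : R := 2 * Num.sqrt (k%:R * (n%:R - k%:R)) / n%:R.

Lemma sqr_tau_of z : tau_of (ntrue z) ^+ 2 = 1 - (signsum (R := R) z / n%:R) ^+ 2.
Proof.
have le : (ntrue z <= n)%N by rewrite -[X in (_ <= X)%N]card_ord max_card.
have k0 : 0 <= (ntrue z)%:R * (n%:R - (ntrue z)%:R) :> R.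
  by rewrite mulr_ge0// subr_ge0 ler_nat.
rewrite /tau_of signsumE !exprMn sqr_sqrtr//; field.
by rewrite gt_eqF.
Qed.

Lemma tau_of_ge0 k : 0 <= tau_of k.
Proof. by rewrite divr_ge0// mulr_ge0// sqrtr_ge0. Qed.

(** The tangent inequalities at $\theta a$, evaluated at $a$ and at $0$ and averaged with weights
    $\theta$ and $1-\theta$. *)
Lemma expR_convex01 (th a : R) : 0 <= th <= 1 ->
  expR (th * a) <= 1 + th * (expR a - 1).
Proof.
move=> /andP[t0 t1]; have e0 := expR_gt0 (th * a).
have h1 : expR (th * a) * (1 + (1 - th) * a) <= expR a.
  have -> : expR a = expR (th * a) * expR ((1 - th) * a).
    by rewrite -expRD; congr expR; ring.
  by rewrite ler_pM2l//; exact: expR_ge1Dx.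
have h2 : expR (th * a) * (1 - th * a) <= 1.
  rewrite -[leRHS](expRxMexpNx_1 (th * a)) ler_pM2l//.
  by have := expR_ge1Dx (- (th * a)).
have := ler_wpM2l t0 h1; have t1' : 0 <= 1 - th by lra.
have := ler_wpM2l t1' h2; nra.
Qed.

(** For $\rho^2 \le 1/2$ one has $\tau^{-1} \le e^{\rho^2}$, and $N\rho^2 = (16/w)\,S^2/(16n)$;
    convexity pulls out the small factor $16/w$ and leaves an exponential of bounded average. *)
Lemma tau_bound z : 2^-1 <= tau_of (ntrue z) ^+ 2 ->
  tau_of (ntrue z) ^- N <= 1 + 16 / w * expR (signsum (R := R) z ^+ 2 / (16 * n%:R)).
Proof.
move=> t2; set t := tau_of _ in t2 *.
have tE : t ^+ 2 = 1 - (signsum z / n%:R) ^+ 2 by exact: sqr_tau_of.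
set rho := signsum z / n%:R in tE *.
have tp : 0 < t.
  rewrite lt0r tau_of_ge0 andbT; apply/eqP => t0.
  by move: t2; rewrite t0 expr0n/=; lra.
have tinv : t^-1 <= expR (rho ^+ 2).
  rewrite -(@ler_pXn2r _ 2)// ?nnegrE ?invr_ge0 ?expR_ge0 ?(ltW tp)//.
  rewrite exprVn -expRM_natl -[leLHS]mul1r ler_pdivrMr ?exprn_gt0//.
  have := expR_ge1Dx (2 * rho ^+ 2).
  have r2 : 0 <= rho ^+ 2 by exact: sqr_ge0.
  set r := rho ^+ 2 in tE r2 *; set e := expR _ => he.
  have : (1 + 2 * r) * t ^+ 2 <= e * t ^+ 2 by rewrite ler_wpM2r// sqr_ge0.
  apply: le_trans; rewrite tE; nra.
apply: (@le_trans _ _ (expR (N%:R * rho ^+ 2))).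
  by rewrite -exprVn expRM_natl lerXn2r ?nnegrE ?invr_ge0 ?expR_ge0 ?(ltW tp).
have -> : N%:R * rho ^+ 2 = 16 / w * (signsum z ^+ 2 / (16 * n%:R)).
  by rewrite /rho /w; field; rewrite !gt_eqF.
have th01 : 0 <= 16 / w <= 1.
  by rewrite divr_ge0 ?(ltW wp)//= ler_pdivrMr// mul1r; apply: le_trans w1; lra.
apply: le_trans (expR_convex01 _ th01) _.
rewrite lerD2l ler_wpM2l//; first by case/andP: th01.
by rewrite gerBl.
Qed.

(** Three ranges: [far] patterns, with $\rho^2 \le 1/2$, carry the main term; [bad] ones, from
    nearly equal or opposite signings, get the trivial bound; in between $\tau^{-N} \le w^N$ is
    affordable. *)
Definition far z : bool := signsum (R := R) z ^+ 2 / n%:R ^+ 2 <= 2^-1.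
Definition bad z : bool := tau_of (ntrue z) < w^-1.

Lemma sum_far : \sum_(z | far z) tau_of (ntrue z) ^- N <= 2 ^+ n * (1 + 32 / w).
Proof.
apply: (@le_trans _ _ (\sum_z (1 + 16 / w * expR (signsum (R := R) z ^+ 2 / (16 * n%:R))))).
  rewrite [leRHS](bigID far)/= -[leLHS]addr0; apply: lerD; last first.
    by apply: sumr_ge0 => z _; rewrite addr_ge0// mulr_ge0 ?expR_ge0// divr_ge0 ?ltW.
  apply: ler_sum => z fz; apply: tau_bound; rewrite sqr_tau_of expr_div_n.
  by move: fz; rewrite /far; lra.
rewrite big_split/= -mulr_sumr.
rewrite sumr_const card_ffun card_bool card_ord natrX.
have := ler_wpM2l (divr_ge0 (ler0n R 16) (ltW wp)) (signsum_moment (R := R) n0).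
set s := \sum_z _; move=> H.
have -> : 2 ^+ n * (1 + 32 / w) = 2 ^+ n + 16 / w * (2 * 2 ^+ n) by ring.
by apply: lerD.
Qed.

(** Here $\tau^{-N} \le w^N \le e^{n/64}$, while $\rho^2 > 1/2$ means $S^2/(16n) > n/32$, so the
    exponential moment pays for these patterns with a factor $e^{-n/32}$. *)
Lemma sum_near : \sum_(z | ~~ far z && ~~ bad z) tau_of (ntrue z) ^- N <=
  2 ^+ n * (2 * expR (- (n%:R / 64))).
Proof.
have wexp : w ^+ N <= expR (n%:R / 64).
  have -> : n%:R / 64 = N%:R * (w / 64) by rewrite mulrA -[N%:R * w]mulrC wN.
  rewrite expRM_natl lerXn2r ?nnegrE ?expR_ge0 ?(ltW wp)//.
  (* The threshold $128^2$ comes from here: it gives $w \le (w/128)^2 \le e^{w/64}$. *)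
  have h : w / 128 <= expR (w / 128) by apply: le_trans (expR_ge1Dx _); lra.
  have -> : w / 64 = w / 128 + w / 128 by field.
  rewrite expRD; apply: (@le_trans _ _ (w / 128 * (w / 128))).
    by move: w1; rewrite expr2; nra.
  by apply: ler_pM => //; rewrite divr_ge0 ?(ltW wp).
apply: (@le_trans _ _ (\sum_z (w ^+ N * expR (- (n%:R / 32))) *
    expR (signsum (R := R) z ^+ 2 / (16 * n%:R)))).
  rewrite [leRHS](bigID (fun z => ~~ far z && ~~ bad z))/= -[leLHS]addr0.
  apply: lerD; last first.
    by apply: sumr_ge0 => z _; rewrite !mulr_ge0 ?expR_ge0 ?exprn_ge0 ?(ltW wp).
  apply: ler_sum => z /andP[]; rewrite /far /bad -ltNge -leNgt => fz bz.
  rewrite -mulrA -expRD -[leLHS]mulr1; apply: ler_pM => //.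
  - by rewrite invr_ge0 exprn_ge0// tau_of_ge0.
  - rewrite -exprVn lerXn2r ?nnegrE ?invr_ge0 ?tau_of_ge0 ?(ltW wp)//.
    rewrite -[leRHS]invrK lef_pV2 ?posrE ?invr_gt0//.
    by apply: lt_le_trans bz; rewrite invr_gt0.
  - rewrite -[leLHS]expR0 ler_expR addrC subr_ge0.
    move: fz; rewrite ltr_pdivlMr ?exprn_gt0// => fz.
    rewrite ler_pdivlMr ?mulr_gt0//; apply: le_trans (ltW fz).
    by rewrite expr2 -subr_ge0 [X in 0 <= X](_ : _ = 0)//; field.
rewrite -mulr_sumr.
apply: le_trans (ler_wpM2l _ (signsum_moment (R := R) n0)) _.
  by rewrite mulr_ge0 ?expR_ge0 ?exprn_ge0 ?(ltW wp).
apply: (@le_trans _ _ (expR (n%:R / 64) * expR (- (n%:R / 32)) * (2 * 2 ^+ n))).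
  by rewrite ler_wpM2r ?mulr_ge0 ?exprn_ge0// ler_wpM2r ?expR_ge0.
rewrite -expRD (_ : n%:R / 64 + - (n%:R / 32) = - (n%:R / 64)); last by field.
by rewrite le_eqVlt; apply/orP; left; apply/eqP; ring.
Qed.

(** If $\tau < 1/w$, then the agreements or the disagreements number at most $L = n/(2w^2)$. In
    Chernoff's bound with $u = 2\kappa w$ both $uL$ and the bound on $ne^{-u}$ are $\kappa N$. *)
Lemma card_bad : \sum_(z | bad z) 1 <= 2 * expR (2 * kappa * N%:R) :> R.
Proof.
pose u : R := 2 * kappa * w; pose L : R := n%:R / (2 * w ^+ 2).
have u0 : 0 <= u by rewrite mulr_ge0 ?(ltW wp)// mulr_ge0// ltW.
(* By $e^{2\kappa w} \ge (\kappa w)^2 \ge w/\kappa$, the last step being [w2]. *)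
have eu : expR (- u) <= kappa / w.
  rewrite expRN -[leRHS]invrK lef_pV2 ?posrE ?invr_gt0 ?divr_gt0 ?expR_gt0//.
  rewrite invf_div /u (_ : 2 * kappa * w = kappa * w + kappa * w); last by ring.
  have h : kappa * w <= expR (kappa * w) by apply: le_trans (expR_ge1Dx _); lra.
  have kw0 : 0 <= kappa * w by rewrite mulr_ge0 ?(ltW wp) ?(ltW kappa0).
  rewrite expRD; have hh := ler_pM kw0 kw0 h h.
  apply: (le_trans _ hh).
  rewrite ler_pdivrMr//; move: w2; rewrite -[kappa ^- 3]mul1r ler_pdivrMr ?exprn_gt0// => h3.
  have := ler_wpM2l (ltW wp) h3; rewrite mulr1 => h4.
  by apply: le_trans h4 _; rewrite le_eqVlt; apply/orP; left; apply/eqP; ring.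
have few b : \sum_(z : {ffun 'I_n -> bool} | \sum_i (z i == b)%:R <= L) 1 <=
    expR (2 * kappa * N%:R) :> R.
  have h := @card_few R n b u L u0; apply: (le_trans h); rewrite ler_expR.
  have -> : 2 * kappa * N%:R = u * L + n%:R * (kappa / w).
    by rewrite /u /L -wN; field; rewrite gt_eqF.
  by rewrite lerD2l ler_wpM2l.
have -> : 2 * expR (2 * kappa * N%:R) =
   expR (2 * kappa * N%:R) + expR (2 * kappa * N%:R) by ring.
apply: le_trans _ (lerD (few true) (few false)).
rewrite [X in _ <= X + _]big_mkcond [X in _ <= _ + X]big_mkcond -big_split.
rewrite big_mkcond; apply: ler_sum => z _ /=.
case: ifP => [bz|_]; last by rewrite addr_ge0//; case: ifP.
have cT : \sum_i (z i == true)%:R = (ntrue z)%:R :> R.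
  by rewrite ntrueE; apply: eq_bigr => i _; case: (z i).
have cF : \sum_i (z i == false)%:R = n%:R - (ntrue z)%:R :> R.
  have -> : n%:R = \sum_(i < n) 1 :> R by rewrite sumr_const card_ord.
  rewrite ntrueE -sumrB.
  by apply: eq_bigr => i _; case: (z i) => /=; ring.
rewrite cT cF; set k : R := (ntrue z)%:R.
suff : (k <= L) || (n%:R - k <= L).
  by case/orP => ->; case: ifP; lra.
have le : (ntrue z <= n)%N by rewrite -[X in (_ <= X)%N]card_ord max_card.
have k0 : 0 <= k by rewrite ler0n.
have l0 : 0 <= n%:R - k by rewrite subr_ge0 ler_nat.
have : 4 * (k * (n%:R - k)) < 2 * n%:R * L.
  have : tau_of (ntrue z) ^+ 2 < w^-1 ^+ 2.
    by rewrite ltr_pXn2r ?nnegrE ?invr_ge0 ?(ltW wp) ?tau_of_ge0.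
  rewrite /tau_of expr_div_n exprMn sqr_sqrtr ?mulr_ge0// exprVn -/k => H.
  have n2 : 0 < n%:R ^+ 2 :> R by rewrite exprn_gt0.
  have := H; rewrite ltr_pdivrMr// => {}H.
  have -> : 2 * n%:R * L = w ^- 2 * n%:R ^+ 2 by rewrite /L; field; rewrite gt_eqF.
  by apply: le_lt_trans H; rewrite expr2; lra.
move=> H; case: (leP k L) => //= Lk; rewrite leNgt; apply/negP => Ll.
have [kl|kl] := leP k (n%:R - k).
  have : n%:R <= 2 * (n%:R - k) by lra.
  move=> h; have h1 : 0 <= k * (2 * (n%:R - k) - n%:R) by rewrite mulr_ge0// subr_ge0.
  have h2 : n%:R * L < n%:R * k by rewrite ltr_pM2l.
  by lra.
have : n%:R <= 2 * k by lra.
move=> h; have h1 : 0 <= (n%:R - k) * (2 * k - n%:R) by rewrite mulr_ge0// subr_ge0.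
have h2 : n%:R * L < n%:R * (n%:R - k) by rewrite ltr_pM2l.
by lra.
Qed.

Lemma second_moment (p : {ffun 'I_n -> bool} -> R) :
  (forall z, p z <= q) ->
  (forall z, (0 < ntrue z < n)%N -> p z <= tau_of (ntrue z) ^- N * q ^+ 2) ->
  \sum_z p z <= 2 ^+ n * q ^+ 2 *
    (1 + 32 / w + 2 * expR (- (n%:R / 64)) + 2 * expR (- (2 * kappa * N%:R))).
Proof.
move=> p1 p2.
(* At $0$ or $n$ agreements [tau_of] is $0$ and its inverse takes the default value $0$; such
   patterns are [bad], so [p2] covers the others. *)
have good z : ~~ bad z -> p z <= tau_of (ntrue z) ^- N * q ^+ 2.
  move=> bz; apply: p2; apply/andP; split.
    rewrite lt0n; apply: contra bz => /eqP k0; rewrite /bad k0 /tau_of.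
    by rewrite mul0r sqrtr0 mulr0 mul0r invr_gt0.
  rewrite ltn_neqAle -[X in (_ <= X)%N]card_ord max_card andbT.
  apply: contra bz => /eqP kn; rewrite /bad kn /tau_of.
  by rewrite subrr mulr0 sqrtr0 mulr0 mul0r invr_gt0.
have farbad z : far z -> ~~ bad z.
  rewrite /far /bad -leNgt => fz; rewrite -(@ler_pXn2r _ 2)// ?nnegrE ?invr_ge0 ?tau_of_ge0 ?(ltW wp)//.
  rewrite sqr_tau_of expr_div_n.
  have : w^-1 ^+ 2 <= 2^-1.
    have : w^-1 <= 2^-1 by rewrite lef_pV2 ?posrE//; apply: le_trans w1; lra.
    have : 0 <= w^-1 by rewrite invr_ge0 ltW.
    by rewrite expr2; nra.
  lra.
rewrite (bigID bad)/= (bigID far (fun z => ~~ bad z))/=.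
have q2 : 0 <= q ^+ 2 by exact: sqr_ge0.
have s1 : \sum_(z | bad z) p z <= q * (2 * expR (2 * kappa * N%:R)).
  apply: le_trans _ (ler_wpM2l (ltW q0) card_bad).
  by rewrite mulr_sumr; apply: ler_sum => z _; rewrite mulr1.
have s2 : \sum_(z | ~~ bad z && far z) p z <= q ^+ 2 * (2 ^+ n * (1 + 32 / w)).
  apply: le_trans _ (ler_wpM2l q2 sum_far); rewrite mulr_sumr.
  rewrite (eq_bigl far); last by move=> z; case: (boolP (far z)) => [/farbad ->|]; rewrite ?andbF.
  by apply: ler_sum => z /farbad/good; rewrite mulrC.
have s3 : \sum_(z | ~~ bad z && ~~ far z) p z <= q ^+ 2 * (2 ^+ n * (2 * expR (- (n%:R / 64)))).
  apply: le_trans _ (ler_wpM2l q2 sum_near); rewrite mulr_sumr.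
  rewrite (eq_bigl (fun z => ~~ far z && ~~ bad z)); last by move=> z; rewrite andbC.
  by apply: ler_sum => z /andP[_ /good]; rewrite mulrC.
(* The trivial bound has $q$ in place of $q^2$; the missing $2^nq$ is at least $e^{4\kappa N}$,
   twice the exponent in the count of [bad] patterns. *)
have s1' : q * (2 * expR (2 * kappa * N%:R)) <=
    q ^+ 2 * (2 ^+ n * (2 * expR (- (2 * kappa * N%:R)))).
  have -> : expR (2 * kappa * N%:R) = expR (4 * kappa * N%:R) * expR (- (2 * kappa * N%:R)).
    by rewrite -expRD; congr expR; ring.
  have := ler_wpM2l (mulr_ge0 (ltW q0) (expR_ge0 (- (2 * kappa * N%:R)))) qlarge.
  nra.
apply: le_trans (lerD (le_trans s1 s1') (lerD s2 s3)) _.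
by rewrite le_eqVlt; apply/orP; left; apply/eqP; ring.
Qed.

End second_moment.

(** * First and second moments *)

Section second_moment_union.
Context d (T : measurableType d) (R : realType) (P : probability T R).

(** Chebyshev's inequality for the number of events that occur, of mean [M], arranged so that only
    nonnegative functions are integrated. *)
Lemma second_moment_union (I : finType) (E : I -> set T) (q e : R) :
  (forall i, measurable (E i)) -> (forall i, P (E i) = q%:E) ->
  0 < #|I|%:R * q ->
  (\sum_i \sum_j P (E i `&` E j) <= ((#|I|%:R * q) ^+ 2 * (1 + e))%:E)%E ->
  (P (\bigcap_(i in [set: I]) ~` E i) <= e%:E)%E.
Proof.
move=> mE PE; set M := #|I|%:R * q => M0 PEE.
pose Z0 := \bigcap_(i in [set: I]) ~` E i.
have mZ0 : measurable Z0 by apply: fin_bigcap_measurable => // i _; exact: measurableC.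
have mI (A : set T) : measurable A -> measurable_fun setT (fun t => (\1_A t)%:E : \bar R).
  by move=> mA; exact/measurable_EFinP/measurable_indic.
have iI (A : set T) : measurable A -> (\int[P]_t (\1_A t)%:E = P A)%E.
  by move=> mA; rewrite integral_indic// setIT.
have mEE i j : measurable (E i `&` E j) by exact: measurableI.
have M20 : 0 <= M ^+ 2 by exact: sqr_ge0.
have M2 : 0 <= 2 * M by rewrite mulr_ge0// ltW.
(* With [Z] the number of events that occur, this is [M^2 * \1_(Z = 0) <= (Z - M)^2]. *)
have pt t : ((M ^+ 2)%:E * (\1_Z0 t)%:E + (2 * M)%:E * (\sum_i (\1_(E i) t)%:E) <=
    \sum_i \sum_j (\1_(E i `&` E j) t)%:E + (M ^+ 2)%:E :> \bar R)%E.
  have -> : (\sum_i \sum_j (\1_(E i `&` E j) t)%:E =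
      (\sum_i \sum_j \1_(E i `&` E j) t : R)%:E)%E.
    by rewrite -sumEFin; apply: eq_bigr => i _; rewrite sumEFin.
  rewrite sumEFin -!EFinM -!EFinD lee_fin.
  have -> : \sum_i \sum_j \1_(E i `&` E j) t = (\sum_i \1_(E i) t) ^+ 2 :> R.
    rewrite expr2 mulr_suml; apply: eq_bigr => i _; rewrite mulr_sumr.
    by apply: eq_bigr => j _; rewrite indicI.
  set Z := \sum_i _; rewrite indicE; case: (boolP (t \in Z0)) => [|_].
    rewrite inE => tZ; have -> : Z = 0.
      by apply: big1 => i _; rewrite indicE memNset//; exact: tZ.
    by rewrite mulr0 expr0n/= mulr1 addr0 add0r.
  by rewrite mulr0 add0r; have := sqr_ge0 (Z - M); rewrite sqrrB; nra.
have mS : measurable_fun setT (fun t => (\sum_i (\1_(E i) t)%:E)%E : \bar R).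
  by apply: emeasurable_sum => i; exact: mI.
have mSS : measurable_fun setT (fun t => (\sum_i \sum_j (\1_(E i `&` E j) t)%:E)%E : \bar R).
  by apply: emeasurable_sum => i; apply: emeasurable_sum => j; exact: mI.
have S0 t : (0 <= \sum_i (\1_(E i) t)%:E :> \bar R)%E.
  by apply: sume_ge0 => i _; rewrite lee_fin.
have SS0 t : (0 <= \sum_i \sum_j (\1_(E i `&` E j) t)%:E :> \bar R)%E.
  by apply: sume_ge0 => i _; apply: sume_ge0 => j _; rewrite lee_fin.
have mZ := mI _ mZ0.
have mL1 : measurable_fun setT (fun t => (M ^+ 2)%:E * (\1_Z0 t)%:E : \bar R)%E.
  exact: emeasurable_funM.
have mL2 : measurable_fun setT (fun t => (2 * M)%:E * (\sum_i (\1_(E i) t)%:E) : \bar R)%E.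
  exact: emeasurable_funM.
have L10 t : (0 <= (M ^+ 2)%:E * (\1_Z0 t)%:E :> \bar R)%E by rewrite mule_ge0// lee_fin.
have L20 t : (0 <= (2 * M)%:E * (\sum_i (\1_(E i) t)%:E) :> \bar R)%E.
  by rewrite mule_ge0.
have int : (\int[P]_t ((M ^+ 2)%:E * (\1_Z0 t)%:E + (2 * M)%:E * (\sum_i (\1_(E i) t)%:E)) <=
  \int[P]_t (\sum_i \sum_j (\1_(E i `&` E j) t)%:E + (M ^+ 2)%:E))%E.
  apply: ge0_le_integral => //.
  - by move=> t _; rewrite adde_ge0.
  - exact: emeasurable_funD.
  - exact: emeasurable_funD.
move: int; rewrite ge0_integralD// ge0_integralZl_EFin// iI//.
rewrite ge0_integralZl_EFin// ge0_integralD//.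
have -> : (\int[P]_t (M ^+ 2)%:E = (M ^+ 2)%:E)%E.
  by rewrite integral_cst//= probability_setT mule1.
have -> : (\int[P]_t \sum_i (\1_(E i) t)%:E = M%:E)%E.
  rewrite ge0_integral_sum//; last by move=> i; exact: mI.
  under eq_bigr do rewrite iI// PE.
  by rewrite sumEFin sumr_const /M mulr_natl.
have -> : (\int[P]_t \sum_i \sum_j (\1_(E i `&` E j) t)%:E =
    \sum_i \sum_j P (E i `&` E j))%E.
  rewrite ge0_integral_sum//; last 2 first.
  - by move=> i; apply: emeasurable_sum => j; exact: mI.
  - by move=> i t _; apply: sume_ge0 => j _; rewrite lee_fin.
  apply: eq_bigr => i _; rewrite ge0_integral_sum//; last by move=> j; exact: mI.
  by apply: eq_bigr => j _; rewrite iI.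
move=> /le_trans /(_ (leeD2r _ PEE)).
rewrite -(fineK (fin_num_measure P _ mZ0)) -!EFinM -!EFinD !lee_fin.
set z := fine _ => H.
have M2p : 0 < M ^+ 2 by rewrite exprn_gt0.
rewrite -(ler_pM2l M2p); move: H; set G := M ^+ 2.
have -> : 2 * M * M = 2 * G by rewrite /G; ring.
lra.
Qed.

End second_moment_union.

Section fixed_size.
Context {R : realType} {n m : nat} {d : measure_display} {T : measurableType d}.
Context {P : probability T R} {Y : 'I_n -> 'I_m -> 'I_m -> T -> R}.
Hypothesis HY : indep_GOE P Y.
Hypotheses (m0 : (0 < m)%N) (n0 : (0 < n)%N).
Local Notation N := #|{: @upper m}|.

Definition pball (r : R) : R := fine (gaussn N (ball_op r)).

Lemma pballE r : 0 <= r -> gaussn N (ball_op r) = (pball r)%:E.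
Proof. by move=> r0; rewrite fineK// fin_num_measure//; exact: measurable_ball. Qed.

Lemma pball_le r r' : 0 <= r -> r <= r' -> pball r <= pball r'.
Proof.
move=> r0 rr; rewrite -lee_fin -!pballE//; last exact: le_trans rr.
apply: le_measure; rewrite ?inE//; try exact: measurable_ball.
  by apply: measurable_ball => //; exact: le_trans rr.
exact: ball_le.
Qed.

Lemma pball_scale (s r : R) : 1 <= s -> 0 <= r ->
  pball (s * r) <= s ^+ N * pball r /\
  s ^+ N * expR (- ((s ^+ 2 - 1) * (m%:R * r ^+ 2) / 4)) * pball r <= pball (s * r).
Proof.
move=> s1 r0; have := gaussn_ball_scale m0 s1 r0.
have sr0 : 0 <= s * r by rewrite mulr_ge0// (le_trans ler01).
by rewrite !pballE// -!EFinM !lee_fin.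
Qed.

Lemma pball_half : 2^-1 <= pball (32 * Num.sqrt m%:R).
Proof.
have r0 : 0 <= 32 * Num.sqrt m%:R :> R by rewrite mulr_ge0// sqrtr_ge0.
by have := @gaussn_ball_half R m m0; rewrite pballE.
Qed.

(** A diagonal coordinate in $]r, r+1]$ already pushes the norm above $r$, and this interval has
    positive mass. It serves to exclude a degenerate exponent in the calibration. *)
Lemma pball_lt1 (r : R) : 0 <= r -> pball r < 1.
Proof.
move=> r0.
pose e : @upper m := upper_of (Ordinal m0, Ordinal m0).
pose c (i : 'I_N) : R := (i == enum_rank e)%:R.
have c1 : \sum_i c i ^+ 2 = 1.
  rewrite (bigD1 (enum_rank e))//= /c eqxx expr1n big1 ?addr0// => j /negbTE ->.
  by rewrite expr0n.
have dc t : dott c t = tnth t (enum_rank e).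
  rewrite /dott (bigD1 (enum_rank e))//= /c eqxx mul1r big1 ?addr0// => j /negbTE ->.
  by rewrite mul0r.
have mA : measurable (`]r, r + 1] : set R) by [].
have mC : measurable (dott c @^-1` `]r, r + 1]).
  by rewrite -[X in measurable X]setTI; exact: (measurable_dott c).
have mB := @measurable_ball R m m0 r r0.
have sub : dott c @^-1` `]r, r + 1] `<=` ~` ball_op r.
  move=> t /=; rewrite in_itv/= dc => /andP[rt _]; apply/negP; rewrite -ltNge.
  rewrite ltNge; apply/negP => /(opnorm_le_sum_entry m0 (Ordinal m0) (Ordinal m0) r0).
  rewrite mxE /sdev eqxx -/e normrM => H.
  have s1 : 1 <= Num.sqrt 2 :> R by rewrite -[leLHS]sqrtr1 ler_sqrt ?ler1n//.
  have : r < `|tnth t (enum_rank e)| by apply: lt_le_trans rt (ler_norm _).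
  move: H; rewrite ger0_norm ?sqrtr_ge0//; have := normr_ge0 (tnth t (enum_rank e)).
  by set x := `|_|; nra.
have pos : (0 < stdn [set` `]r, (r + 1)%R]])%E.
  have rr1 : r <= r + 1 by lra.
  apply: (@lt_le_trans _ _ (\int[lebesgue_measure]_(x in `]r, (r + 1)%R]) (phi (r + 1))%:E)%E).
    rewrite integral_cst//= lebesgue_measure_itv/= lte_fin ltrDl ltr01 -EFinD.
    by rewrite -EFinM lte_fin mulr_gt0 ?phi_gt0//; lra.
  rewrite stdnE; apply: ge0_le_integral => //.
  - by move=> x _; rewrite lee_fin phi_ge0.
  - by apply/measurable_EFinP/measurable_funTS; exact: measurable_phi.
  move=> x /=; rewrite in_itv/= lee_fin => /andP[rx x1].
  rewrite /phi ler_wpM2l ?normal_peak_ge0// ler_expR lerN2 ler_pM2r//.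
  by rewrite !expr2; nra.
rewrite -lte_fin -pballE//.
have := probability_setC (gaussn N) mB => E.
have : (0 < gaussn N (~` ball_op r))%E.
  apply: lt_le_trans pos _; rewrite -(gaussn_unit_form c1)//.
  by apply: le_measure; rewrite ?inE//; exact: measurableC.
by rewrite E pballE// -EFinB !lte_fin subr_gt0.
Qed.

Lemma upper_sizeR : N%:R <= m%:R ^+ 2 :> R /\ m%:R ^+ 2 <= 2 * N%:R :> R.
Proof.
have [h1 h2] := upper_size (m := m).
by rewrite -natrX -natrM !ler_nat.
Qed.

Variable delta : R.
Hypotheses (d0 : 0 < delta) (pdelta : pball delta = 2 ^- n).

(* Otherwise scaling [sqrt (eta m)] up to [32 sqrt m], whose ball has probability at least [1/2],
   would gain more than a factor [2 ^ (n - 1)]. *)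
Lemma delta_small (eta : R) : 0 < eta <= 1 ->
  2 * (32 / Num.sqrt eta) ^+ N < 2 ^+ n -> delta ^+ 2 <= eta * m%:R.
Proof.
move=> /andP[e0 e1] big; rewrite leNgt; apply/negP => dl.
have se0 : 0 < Num.sqrt eta by rewrite sqrtr_gt0.
have se1 : Num.sqrt eta <= 1 by rewrite -[leRHS]sqrtr1 ler_sqrt.
pose r : R := Num.sqrt (eta * m%:R); pose s : R := 32 / Num.sqrt eta.
have s1 : 1 <= s by rewrite /s ler_pdivlMr// mul1r; lra.
have r0 : 0 <= r by exact: sqrtr_ge0.
have rd : r <= delta.
  by rewrite /r -[delta]ger0_norm ?(ltW d0)// -sqrtr_sqr ler_sqrt ?sqr_ge0// ltW.
have sr : s * r = 32 * Num.sqrt m%:R.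
  by rewrite /s /r sqrtrM ?ltW//; field; rewrite gt_eqF.
have [H _] := pball_scale s1 r0; have := pball_half; rewrite -sr => half.
have sN : 0 <= s ^+ N by rewrite exprn_ge0// (le_trans ler01).
have := ler_wpM2l sN (pball_le r0 rd); rewrite pdelta => H2.
have p2 : 0 < 2 ^+ n :> R by rewrite exprn_gt0.
have H3 : 2^-1 <= s ^+ N * 2 ^- n by apply: le_trans half (le_trans H H2).
by move: H3; rewrite ler_pdivlMr// ler_pdivrMl// leNgt big.
Qed.

Variable eta : R.
Hypotheses (eta0 : 0 <= eta) (dsmall : delta ^+ 2 <= eta * m%:R).

(** Hence a scaling by $s$ from $\delta$ loses at most $(s^2-1)\eta N/2$ in the exponent, against a
    gain of $N\ln s$. *)
Let mdelta : m%:R * delta ^+ 2 <= 2 * eta * N%:R.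
Proof.
have [_ h] := upper_sizeR; have mr0 : 0 <= m%:R :> R by [].
have h1 := ler_wpM2l mr0 dsmall; have h2 := ler_wpM2l eta0 h.
by move: h1 h2; rewrite expr2; lra.
Qed.

(** The condition on $\eta$ keeps the loss below half of the gain $N\ln\gamma$; the other half is
    $4\kappa N$ with $\kappa = (\ln\gamma)/8$. *)
Lemma pball_above (gamma : R) : 1 < gamma -> (gamma ^+ 2 - 1) * eta <= ln gamma ->
  expR (4 * (ln gamma / 8) * N%:R) <= 2 ^+ n * pball (gamma * delta).
Proof.
move=> g1 geta; have g0 : 0 < gamma by exact: lt_trans ltr01 g1.
have [_ H] := pball_scale (ltW g1) (ltW d0); rewrite pdelta in H.
have p2 : 0 < 2 ^+ n :> R by rewrite exprn_gt0.
apply: le_trans (ler_wpM2l (ltW p2) H).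
rewrite [leRHS]mulrCA mulfV ?gt_eqF// mulr1.
rewrite -[X in X ^+ N](@lnK _ gamma) ?posrE// -expRM_natl -expRD ler_expR.
have g2 : 0 <= gamma ^+ 2 - 1 by rewrite subr_ge0 exprn_ege1// ltW.
have h1 := ler_wpM2l g2 mdelta.
have h2 : (gamma ^+ 2 - 1) * eta * N%:R <= ln gamma * N%:R by rewrite ler_wpM2r.
move: h1 h2; set G := gamma ^+ 2 - 1; set D := m%:R * delta ^+ 2; lra.
Qed.

(** The lower scaling bound is used upwards, from $\beta\delta$ to $\delta$; since $\eta \le
    -\ln\beta$, at most half of the gain $-N\ln\beta$ is lost. *)
Lemma pball_below (beta : R) : 0 < beta < 1 -> eta <= - ln beta ->
  2 ^+ n * pball (beta * delta) <= expR (ln beta / 2 * N%:R).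
Proof.
move=> /andP[b0 b1] beta_eta.
have bi1 : 1 <= beta^-1 by rewrite invf_ge1// ltW.
have bd0 : 0 <= beta * delta by rewrite mulr_ge0// ltW.
have [_ H] := pball_scale bi1 bd0.
have p2 : 0 < 2 ^+ n :> R by rewrite exprn_gt0.
rewrite mulKf ?gt_eqF// pdelta in H.
have := ler_wpM2l (ltW p2) H; rewrite divff ?gt_eqF//.
rewrite -[X in X ^+ N](@lnK _ beta^-1) ?posrE ?invr_gt0// -expRM_natl -expRD lnV ?posrE//.
set p := pball _; set e := _ + _ => H1.
have X1 : 2 ^+ n * p <= expR (- e).
  by rewrite expRN -[leRHS]mul1r ler_pdivlMr ?expR_gt0// -mulrA (mulrC p).
apply: le_trans X1 _; rewrite ler_expR /e.
have -> : (beta^-1 ^+ 2 - 1) * (m%:R * (beta * delta) ^+ 2) = (1 - beta ^+ 2) * (m%:R * delta ^+ 2).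
  by field; rewrite gt_eqF.
have md0 : 0 <= m%:R * delta ^+ 2 by rewrite mulr_ge0// sqr_ge0.
have b2 : 0 <= beta ^+ 2 by exact: sqr_ge0.
have h1 : (1 - beta ^+ 2) * (m%:R * delta ^+ 2) <= m%:R * delta ^+ 2.
  by rewrite ler_piMl//; lra.
have h2 : eta * N%:R <= - ln beta * N%:R by rewrite ler_wpM2r.
move: h1 h2 mdelta; set D := m%:R * delta ^+ 2; lra.
Qed.

Lemma prob_some_sgn_event (r : R) : 0 <= r ->
  (P (\bigcup_(x in [set: {ffun 'I_n -> bool}]) (sgn_event (Y := Y) r x)) <=
   (2 ^+ n * pball r)%:E)%E.
Proof.
move=> r0.
have mE x := measurable_sgn_event HY m0 n0 x r0.
have -> : \bigcup_(x in [set: {ffun 'I_n -> bool}]) (sgn_event (Y := Y) r x) =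
    \big[setU/set0]_(x : {ffun 'I_n -> bool}) sgn_event (Y := Y) r x.
  by rewrite -bigcup_seq; apply: eq_bigcupl; split => x _ /=; rewrite ?mem_index_enum.
apply: (le_trans (mu_bigU_le _ _ _ mE)).
rewrite (eq_bigr (fun=> (pball r)%:E)); last first.
  by move=> x _; rewrite -pballE//; exact: (prob_sgn_event HY m0 n0 x r0).
by rewrite sumEFin sumr_const card_ffun card_bool card_ord -natrX mulr_natl.
Qed.

Lemma prob_no_sgn_event (r kappa w : R) : 0 <= r -> 0 < kappa ->
  w = n%:R / N%:R -> 128 ^+ 2 <= w -> kappa ^- 3 <= w ->
  expR (4 * kappa * N%:R) <= 2 ^+ n * pball r ->
  (P (\bigcap_(x in [set: {ffun 'I_n -> bool}]) ~` sgn_event (Y := Y) r x) <=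
   (32 / w + 2 * expR (- (n%:R / 64)) + 2 * expR (- (2 * kappa * N%:R)))%:E)%E.
Proof.
move=> r0 k0 wE w1 w2 qlarge; set e := _ + _ + _.
have p2 : 0 < 2 ^+ n :> R by rewrite exprn_gt0.
have q0 : 0 < pball r.
  by rewrite -(pmulr_rgt0 _ p2); apply: lt_le_trans qlarge; exact: expR_gt0.
have mE x := measurable_sgn_event HY m0 n0 x r0.
have PE x : P (sgn_event (Y := Y) r x) = (pball r)%:E.
  by rewrite (prob_sgn_event HY m0 n0 _ r0) pballE.
have cardE : #|{: {ffun 'I_n -> bool}}|%:R = 2 ^+ n :> R.
  by rewrite card_ffun card_bool card_ord natrX.
have N0 : (0 < N)%N by apply/card_gt0P; exists (upper_of (Ordinal m0, Ordinal m0)).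
apply: (second_moment_union mE PE); first by rewrite cardE mulr_gt0.
rewrite cardE.
(* The pattern of agreement with [x] is an involution in [y], so for fixed [x] the sum over [y] is a
   sum over patterns. *)
pose diff (x y : {ffun 'I_n -> bool}) : {ffun 'I_n -> bool} := [ffun i => x i == y i].
have diffK x : cancel (diff x) (diff x).
  by move=> y; apply/ffunP => i; rewrite !ffunE; case: (x i); case: (y i).
have row (x : {ffun 'I_n -> bool}) :
    (\sum_y P (sgn_event (Y := Y) r x `&` sgn_event (Y := Y) r y) <=
     (2 ^+ n * pball r ^+ 2 * (1 + e))%:E)%E.
  have fP z : (P (sgn_event (Y := Y) r x `&` sgn_event (Y := Y) r z)) \is a fin_num.
    by apply: fin_num_measure; exact: measurableI.
  pose p z := fine (P (sgn_event (Y := Y) r x `&` sgn_event (Y := Y) r (diff x z))).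
  have -> : (\sum_y P (sgn_event (Y := Y) r x `&` sgn_event (Y := Y) r y) = (\sum_z p z)%:E)%E.
    rewrite (reindex (diff x))/=; last by exists (diff x) => y _; exact: diffK.
    by rewrite -sumEFin; apply: eq_bigr => z _; rewrite /p fineK.
  rewrite lee_fin.
  have -> : 1 + e = 1 + 32 / w + 2 * expR (- (n%:R / 64)) + 2 * expR (- (2 * kappa * N%:R)).
    by rewrite /e !addrA.
  rewrite wE in w1 w2 *; apply: (second_moment n0 N0 k0 q0 w1 w2 qlarge) => z.
    rewrite -lee_fin /p fineK// -(PE x).
    by apply: le_measure; rewrite ?inE//; exact: measurableI.
  have az : agree x (diff x z) = ntrue z.
    rewrite /agree /ntrue; apply: eq_card => i; rewrite !inE ffunE.
    by case: (x i); case: (z i).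
  move=> nz; rewrite -lee_fin /p fineK//.
  have nz' : (0 < agree x (diff x z) < n)%N by rewrite az.
  have := prob_sgn_event2 HY m0 n0 r0 nz' erefl erefl erefl.
  by rewrite az -/(tau_of n (ntrue z)) !pballE// -!EFinM expr2.
apply: le_trans (lee_sum _ (fun x _ => row x)) _.
rewrite sumEFin sumr_const cardT -cardE lee_fin.
by rewrite -mulr_natl cardT !exprMn; lra.
Qed.

End fixed_size.

(** * The discrepancy *)

Section discrepancy.
Context {R : realType} {n m : nat} {d : measure_display} {T : measurableType d}.
Context {P : probability T R} {Y : 'I_n -> 'I_m -> 'I_m -> T -> R}.
Hypothesis HY : indep_GOE P Y.
Hypotheses (m0 : (0 < m)%N) (n0 : (0 < n)%N).
Local Notation N := #|{: @upper m}|.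
Local Notation signed_sum x t := (opnorm (\sum_(i < n) sgnb R (x i) *: rmatrix Y i t)).
Local Notation discY t := (disc (fun i => rmatrix Y i t)).
Implicit Types x : {ffun 'I_n -> bool}.

Let np : 0 < n%:R :> R. Proof. by rewrite ltr0n. Qed.
Let sn0 : 0 < Num.sqrt n%:R :> R. Proof. by rewrite sqrtr_gt0. Qed.

Lemma disc_le x t : discY t <= signed_sum x t.
Proof.
apply: ge_inf; last by exists x.
by exists 0 => _ [y _ <-]; exact: opnorm_ge0.
Qed.

Lemma le_disc (s : R) t : (forall x, s <= signed_sum x t) -> s <= discY t.
Proof.
move=> H; apply: lb_le_inf; last by move=> _ [x _ <-].
by exists (signed_sum [ffun=> true] t); exists [ffun=> true].
Qed.

(** The sublevel sets of one signed sum are the events [sgn_event], and the infimum is below [s]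
    exactly when some signed sum is. *)
Lemma measurable_disc : measurable_fun setT (fun t => discY t).
Proof.
have msum x : measurable_fun setT (fun t => signed_sum x t).
  move=> mT; apply: (measurability _ (RGenOInfty.measurableE R)) => // _ [_ [s ->] <-].
  rewrite setTI.
  have -> : (fun t => signed_sum x t) @^-1` `]s, +oo[ = ~` [set t | signed_sum x t <= s].
    by apply/seteqP; split => t /=; rewrite in_itv/= andbT ltNge; move/negP.
  apply: measurableC; have [s0|s0] := leP 0 s.
    have s0' : 0 <= s / Num.sqrt n%:R by rewrite divr_ge0// ltW.
    have := measurable_sgn_event HY m0 n0 x s0'.
    by rewrite /sgn_event mulrC divfK// gt_eqF.
  rewrite (_ : [set t | _] = set0)//; apply/seteqP; split => t //= H.
  by have := le_lt_trans (le_trans (opnorm_ge0 m0 _) H) s0; rewrite ltxx.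
move=> mT; apply: (measurability _ (RGenInftyO.measurableE R)) => // _ [_ [s ->] <-].
rewrite setTI.
have -> : (fun t => discY t) @^-1` `]-oo, s[ =
    \bigcup_(x in [set: {ffun 'I_n -> bool}]) [set t | signed_sum x t < s].
  apply/seteqP; split => t /=; rewrite in_itv/=.
    move=> /inf_lt[|_ [x _ <-] xs]; last by exists x.
    by exists (signed_sum [ffun=> true] t); exists [ffun=> true].
  by move=> [x _]; exact/le_lt_trans/disc_le.
apply: fin_bigcup_measurable => // x _.
have mI : measurable (`]-oo, s[%classic : set R) by [].
have := msum x measurableT _ mI; rewrite setTI => H.
rewrite (_ : [set t | _] = (fun t => signed_sum x t) @^-1` `]-oo, s[%classic); first exact: H.
by apply/seteqP; split => t /=; rewrite in_itv.
Qed.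

Lemma measurable_disc_window (a b : R) : measurable [set t | a <= discY t <= b].
Proof.
have mI : measurable (`[a, b]%classic : set R) by [].
have := measurable_disc measurableT mI; rewrite setTI => H.
rewrite (_ : [set t | _] = (fun t => discY t) @^-1` `[a, b]%classic); first exact: H.
by apply/seteqP; split => t /=; rewrite in_itv.
Qed.

Variables (delta beta gamma eta kappa w : R).
Hypotheses (d0 : 0 < delta) (pdelta : pball (m := m) delta = 2 ^- n).
Hypotheses (b01 : 0 < beta < 1) (g1 : 1 < gamma).
Hypotheses (eta01 : 0 < eta <= 1) (geta : (gamma ^+ 2 - 1) * eta <= ln gamma).
Hypotheses (beta_eta : eta <= - ln beta).
Hypotheses (kappaE : kappa = ln gamma / 8) (wE : w = n%:R / N%:R).
Hypotheses (w1 : 128 ^+ 2 <= w) (w2 : kappa ^- 3 <= w).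
Hypothesis (big : 2 * (32 / Num.sqrt eta) ^+ N < 2 ^+ n).

(** Outside the window either no signing has norm at most $\gamma c$ or some signing has norm at
    most $\beta c$; the first event accounts for three error terms, the second for the last. *)
Lemma prob_disc_window (c : R) : c = Num.sqrt n%:R * delta ->
  ((1 - (32 / w + 2 * expR (- (n%:R / 64)) + 2 * expR (- (2 * kappa * N%:R)) +
         expR (ln beta / 2 * N%:R)))%:E <=
   P [set t | (beta * c <= discY t <= gamma * c)%R])%E.
Proof.
move=> cE; have /andP[b0 b1] := b01; have /andP[e0 e1] := eta01.
have g0 : 0 < gamma by exact: lt_trans ltr01 g1.
have dsmall := delta_small m0 d0 pdelta eta01 big.
have gd0 : 0 <= gamma * delta by rewrite mulr_ge0// ltW.
have bd0 : 0 <= beta * delta by rewrite mulr_ge0// ltW.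
have k0 : 0 < kappa by rewrite kappaE divr_gt0// ln_gt0.
have qlarge : expR (4 * kappa * N%:R) <= 2 ^+ n * pball (m := m) (gamma * delta).
  by rewrite kappaE; exact: (pball_above m0 d0 pdelta (ltW e0) dsmall).
have Pno := prob_no_sgn_event HY m0 n0 gd0 k0 wE w1 w2 qlarge.
have Psome := prob_some_sgn_event HY m0 n0 bd0.
have below := pball_below m0 d0 pdelta (ltW e0) dsmall b01 beta_eta.
set E := [set t | _].
set A := \bigcap_(x in _) _ in Pno; set B := \bigcup_(x in _) _ in Psome.
have mA : measurable A.
  by apply: fin_bigcap_measurable => // x _; apply: measurableC; exact: (measurable_sgn_event HY).
have mB : measurable B.
  by apply: fin_bigcup_measurable => // x _; exact: (measurable_sgn_event HY).
have mE : measurable E by exact: measurable_disc_window.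
have sub : ~` E `<=` A `|` B.
  move=> t /= nE; apply: contrapT => /not_orP[nA nB]; apply: nE; apply/andP; split.
    apply: le_disc => x; rewrite leNgt; apply/negP => /ltW H.
    by apply: nB; exists x => //; rewrite /sgn_event/= mulrCA -cE.
  have [x nx] : exists x, sgn_event (Y := Y) (gamma * delta) x t.
    apply: contrapT => /forallNP H; apply: nA => x _; exact: H.
  by apply: le_trans (disc_le x t) _; rewrite cE mulrCA.
have PC : (P (~` E) <= P A + P B)%E.
  apply: (@le_trans _ _ (P (A `|` B))); last exact: measureU2.
  by apply: le_measure; rewrite ?inE//; [exact: measurableC|exact: measurableU].
have PE : P E = (1 - P (~` E))%E.
  by rewrite probability_setC// oppeB ?fin_num_measure// addeA subee// add0e.
rewrite PE EFinB leeB//; apply: le_trans PC _; rewrite EFinD; apply: leeD => //.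
by apply: le_trans Psome _; rewrite lee_fin.
Qed.

End discrepancy.

(** * Calibration of the radius with the small-ball formula *)

Section calibration.
Context {R : realType}.

Lemma half_expR_le2 : expR (2^-1) <= 2 :> R.
Proof.
have := expR_ge1Dx (- 2^-1 : R); rewrite expRN => H.
have H2 : 2^-1 <= (expR 2^-1)^-1 :> R by apply: le_trans H; lra.
by rewrite -[leLHS]invrK -[leRHS]invrK lef_pV2// posrE ?invr_gt0// expR_gt0.
Qed.

(** The bounds $s^N \le e^{sN}$, $2 \le e$ and $2^n \ge e^{n/2}$ make the condition linear in
    $n/N$. *)
Lemma exp_scale_lt (s : R) (n N : nat) : 0 < s -> (0 < N)%N ->
  (2 * s + 4) * N%:R <= n%:R -> 2 * s ^+ N < 2 ^+ n.
Proof.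
move=> s0 N0 H; have N1 : 1 <= N%:R :> R by rewrite ler1n.
have h1 : s ^+ N <= expR (N%:R * s).
  rewrite expRM_natl lerXn2r ?nnegrE ?expR_ge0 ?(ltW s0)//.
  by apply: le_trans (expR_ge1Dx s); lra.
have h2 : 2 <= expR 1 :> R by apply: le_trans (expR_ge1Dx 1); lra.
have h3 : expR (n%:R * 2^-1) <= 2 ^+ n :> R.
  by rewrite expRM_natl lerXn2r ?nnegrE ?expR_ge0//; exact: half_expR_le2.
apply: lt_le_trans h3; apply: (@le_lt_trans _ _ (expR 1 * expR (N%:R * s))).
  by apply: ler_pM => //; rewrite exprn_ge0// ltW.
by rewrite -expRD ltr_expR; nra.
Qed.

Lemma powR4_half (n : nat) : 4 `^ (- (n%:R / 2)) = 2 ^- n :> R.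
Proof.
have -> : 4 = 2 `^ 2%:R :> R by rewrite powR_mulrn//; ring.
by rewrite -powRrM mulrN powRN mulrCA divff// mulr1 powR_mulrn.
Qed.

(* At [xi = 0] the exponent [xi^-1 * m^2 / 2] is the junk value [0], and the small ball
   would have probability [1]. *)
Lemma pball_calibrated (n m : nat) (xi : R) : (0 < n)%N -> (0 < m)%N ->
  let delta := 2 / expR (3 / 4) * Num.sqrt m%:R * 4 `^ (- (xi * n%:R / m%:R ^+ 2)) in
  pball (m := m) delta =
    (expR (3 / 4) / (2 * Num.sqrt m%:R) * delta) `^ (xi^-1 * m%:R ^+ 2 / 2) ->
  pball (m := m) delta = 2 ^- n.
Proof.
move=> n0 m0 delta pE.
have e0 : 0 < expR (3 / 4) :> R by exact: expR_gt0.
have s0 : 0 < Num.sqrt m%:R :> R by rewrite sqrtr_gt0 ltr0n.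
have a0 : 0 < 4 `^ (- (xi * n%:R / m%:R ^+ 2)) :> R by rewrite powR_gt0.
have d0 : 0 < delta by rewrite !mulr_gt0// invr_gt0.
(* The prefactor of [delta] is the inverse of the one in the small-ball formula, so that a power of
   $4$ remains. *)
have E : expR (3 / 4) / (2 * Num.sqrt m%:R) * delta = 4 `^ (- (xi * n%:R / m%:R ^+ 2)).
  by rewrite /delta; field; rewrite !gt_eqF.
rewrite E in pE.
have xi0 : xi != 0.
  apply/eqP => x0; have := pball_lt1 m0 (ltW d0).
  by rewrite pE x0 invr0 !mul0r powRr0 ltxx.
rewrite pE -powRrM -powR4_half; congr (_ `^ _).
by field; rewrite xi0 pnatr_eq0 -lt0n.
Qed.

End calibration.

Lemma expRN_le (R : realType) (e x : R) : 0 < e -> e^-1 <= x -> expR (- x) <= e.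
Proof.
move=> e0 ex; have x0 : 0 < x by apply: lt_le_trans ex; rewrite invr_gt0.
rewrite expRN -[leRHS]invrK lef_pV2 ?posrE ?expR_gt0 ?invr_gt0//.
by apply: le_trans ex (le_trans _ (expR_ge1Dx x)); lra.
Qed.

Unset Implicit Arguments.

Theorem theorem1p1 (R : realType) (m : nat -> nat)
  (m_pos : forall n, (0 < m n)%N)
  (m2_infty : (fun n => (m n)%:R ^+ 2 : R) @ \oo --> +oo)
  (m2_n_0 : (fun n => (m n)%:R ^+ 2 / n%:R : R) @ \oo --> 0)
  (d : measure_display) (T : nat -> measurableType d)
  (P : forall n, probability (T n) R)
  (Y : forall n, 'I_n -> 'I_(m n) -> 'I_(m n) -> T n -> R)
  (HY : forall n, indep_GOE (P n) (Y n))
  (xi : nat -> R)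
  (Hxi : forall n (i : 'I_n),
     let delta := 2 / expR (3 / 4) * Num.sqrt (m n)%:R
                  * 4 `^ (- (xi n * n%:R / (m n)%:R ^+ 2)) in
     P n [set t | opnorm (rmatrix (Y n) i t) <= delta] =
     ((expR (3 / 4) / (2 * Num.sqrt (m n)%:R) * delta)
        `^ ((xi n)^-1 * (m n)%:R ^+ 2 / 2))%:E)
  (beta gamma : R) (Hbeta : beta < 1) (Hgamma : 1 < gamma) :
  (fun n =>
     let c := 2 / expR (3 / 4) * Num.sqrt (n%:R * (m n)%:R)
              * 4 `^ (- (xi n * n%:R / (m n)%:R ^+ 2)) in
     P n [set t | beta * c <= disc (fun i => rmatrix (Y n) i t) <= gamma * c])
    @ \oo --> 1%E.
Proof.
pose N n := #|{: @upper (m n)}|.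
have NR n : (N n)%:R <= (m n)%:R ^+ 2 :> R /\ (m n)%:R ^+ 2 <= 2 * (N n)%:R :> R.
  exact: upper_sizeR.
have N0 n : (0 < N n)%N.
  by apply/card_gt0P; exists (upper_of (Ordinal (m_pos n), Ordinal (m_pos n))).
have largeN (A : R) : \forall n \near \oo, A <= (N n)%:R.
  have /cvgryPge/(_ (2 * A)) := m2_infty; apply: filterS => n.
  by have [_] := NR n; lra.
have largen (A : R) : \forall n \near \oo, A <= n%:R :> R by exact: nbhs_infty_ger.
have largew (A : R) : \forall n \near \oo, A <= n%:R / (N n)%:R.
  pose B := Num.max A 1; have B0 : 0 < B by rewrite lt_max ltr01 orbT.
  have Bi : 0 < B^-1 by rewrite invr_gt0.
  have /cvgrPdist_le/(_ B^-1 Bi) H := m2_n_0.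
  near=> n; have n1 : 1 <= n%:R :> R by near: n; exact: largen.
  have np : 0 < n%:R :> R by lra.
  have Np : 0 < (N n)%:R :> R by rewrite ltr0n.
  apply: (@le_trans _ _ B); first by rewrite le_max lexx.
  have : `|0 - (m n)%:R ^+ 2 / n%:R| <= B^-1 :> R by near: n.
  rewrite sub0r normrN ger0_norm ?divr_ge0 ?sqr_ge0// ler_pdivrMr// ler_pdivlMl// => H2.
  have [h _] := NR n; rewrite ler_pdivlMr//; apply: le_trans H2.
  by rewrite ler_pM2l.
(* [beta] may be nonpositive; raising it to at least $1/2$ only narrows the window and makes its
   logarithm available. *)
pose be := Num.max beta 2^-1.
have be01 : 0 < be < 1.
  by rewrite lt_max gt_max Hbeta /=; apply/andP; split; [apply/orP; right|]; lra.
have /andP[be0 be1] := be01.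
have lg0 : 0 < ln gamma by rewrite ln_gt0.
have lb0 : 0 < - ln be by rewrite oppr_gt0 ln_lt0.
have g2 : 0 < gamma ^+ 2 - 1 by rewrite subr_gt0 exprn_egt1.
(* The last two entries keep the loss in the scaling bound below half of the gain, above and below
   $\delta$ respectively. *)
pose eta := Num.min 1 (Num.min (ln gamma / (gamma ^+ 2 - 1)) (- ln be)).
have eta0 : 0 < eta by rewrite !lt_min ltr01 lb0 divr_gt0.
have eta1 : eta <= 1 by rewrite ge_min lexx.
have geta : (gamma ^+ 2 - 1) * eta <= ln gamma.
  by rewrite mulrC -ler_pdivlMr// !ge_min lexx orbT.
have beta_eta : eta <= - ln be by rewrite !ge_min lexx !orbT.
pose kappa := ln gamma / 8; have k0 : 0 < kappa by rewrite divr_gt0.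
pose s := 32 / Num.sqrt eta; have s0 : 0 < s by rewrite divr_gt0// sqrtr_gt0.
set F := (fun n => P n _).
have Ffin : \forall n \near \oo, F n \is a fin_num.
  apply: filterS (largen 1) => n n1; apply: fin_num_measure.
  by apply: (measurable_disc_window (HY n)) => //; rewrite ler1n in n1.
apply/fine_cvgP; split => //; apply/cvgrPdist_le => e e0.
near=> n.
have n1 : 1 <= n%:R :> R by near: n; exact: largen.
have n0 : (0 < n)%N by rewrite ler1n in n1.
have mn0 : 0 < (m n)%:R :> R by rewrite ltr0n.
pose delta : R := 2 / expR (3 / 4) * Num.sqrt (m n)%:R * 4 `^ (- (xi n * n%:R / (m n)%:R ^+ 2)).
have d0 : 0 < delta.
  by rewrite !mulr_gt0 ?invr_gt0 ?expR_gt0 ?sqrtr_gt0 ?powR_gt0.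
have pdelta : pball (m := m n) delta = 2 ^- n.
  apply: (@pball_calibrated _ _ _ (xi n)) => //.
  have E := prob_rmatrix (HY n) (m_pos n) (Ordinal n0) (ltW d0).
  rewrite pballE ?(ltW d0)// in E.
  by have [] := etrans (esym E) (Hxi n (Ordinal n0)).
pose w : R := n%:R / (N n)%:R.
have w1 : 128 ^+ 2 <= w by rewrite /w; near: n; exact: largew.
have w2 : kappa ^- 3 <= w by rewrite /w; near: n; exact: largew.
have w3 : 2 * s + 4 <= w by rewrite /w; near: n; exact: largew.
(* [w4], [n2], [N1] and [N2] bound each of the four error terms by $e/4$. *)
have w4 : 128 / e <= w by rewrite /w; near: n; exact: largew.
have n2 : 512 / e <= n%:R by near: n; exact: largen.
have N1 : 4 / (kappa * e) <= (N n)%:R by near: n; exact: largeN.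
have N2 : 8 / (- ln be * e) <= (N n)%:R by near: n; exact: largeN.
have Np : 0 < (N n)%:R :> R by rewrite ltr0n.
have big : 2 * s ^+ N n < 2 ^+ n.
  by apply: exp_scale_lt => //; rewrite -ler_pdivlMr.
pose c : R := Num.sqrt n%:R * delta.
have c0 : 0 <= c by rewrite mulr_ge0// ?sqrtr_ge0// ltW.
have eta01 : 0 < eta <= 1 by rewrite eta0.
have := prob_disc_window (HY n) (m_pos n) n0 d0 pdelta be01 Hgamma eta01 geta beta_eta
  erefl erefl w1 w2 big (erefl c).
rewrite -/(N n) -/w; set err := (X in 1 - X) => Plow.
have err_le : err <= e.
  have h1 : 32 / w <= e / 4.
    rewrite ler_pdivrMr; last by apply: lt_le_trans w1; rewrite exprn_gt0.
    by move: w4; rewrite ler_pdivrMr//; lra.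
  have e8 : 0 < e / 8 by rewrite divr_gt0.
  have h2 : expR (- (n%:R / 64)) <= e / 8.
    by apply: expRN_le => //; rewrite invf_div; lra.
  have h3 : expR (- (2 * kappa * (N n)%:R)) <= e / 8.
    apply: expRN_le => //; rewrite invf_div ler_pdivrMr//.
    by move: N1; rewrite ler_pdivrMr ?mulr_gt0//; lra.
  have h4 : expR (ln be / 2 * (N n)%:R) <= e / 4.
    rewrite -[ln be]opprK !mulNr; apply: expRN_le; first by rewrite divr_gt0.
    rewrite invf_div ler_pdivrMr//.
    by move: N2; rewrite ler_pdivrMr ?mulr_gt0//; lra.
  by rewrite /err; lra.
have mW a b := measurable_disc_window (HY n) (m_pos n) n0 a b.
have Feq : F n = P n [set t | (beta * c <= disc (fun i => rmatrix (Y n) i t) <= gamma * c)%R].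
  rewrite /F/= (_ : 2 / expR (3 / 4) * Num.sqrt (n%:R * (m n)%:R) * _ = c)//.
  by rewrite /c /delta sqrtrM//; ring.
have Fle : (F n <= 1)%E by rewrite Feq; exact: (probability_le1 (P n) (mW _ _)).
have Fge : ((1 - e)%:E <= F n)%E.
  apply: (@le_trans _ _ (1 - err)%:E); first by rewrite lee_fin; lra.
  apply: le_trans Plow _; rewrite Feq; apply: le_measure; rewrite ?inE//.
  move=> t /= /andP[h1 ->]; rewrite andbT; apply: le_trans h1.
  by rewrite ler_wpM2r// le_max lexx.
have Fn : F n \is a fin_num by near: n.
move: Fle Fge; rewrite -(fineK Fn) !lee_fin => h1 h2.
by rewrite ger0_norm ?subr_ge0//=; lra.
Unshelve. all: by end_near.
Qed.
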